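(* Let $\lambda$ be a partition of $n$ and let $\Lambda$ be a standard tableau of shape $\lambda$. The restriction to the subspace $\mathcal{H}_\Lambda\subset\mathbb{C}^n$ of the $\mathbb{C}S_n$-valued rational function $F_\Lambda(z_1,\dots,z_n)$ is regular at $z_1=z_2=\cdots=z_n$. The value of this restriction at $z_1=z_2=\cdots=z_n$ coincides with the diagonal matrix element $F_\Lambda=\sum_{\sigma\in S_n}(v_\Lambda,\sigma v_\Lambda)\,\sigma\in\mathbb{C}S_n$.
   Context: A partition $\lambda=(\lambda_1\ge\lambda_2\ge\cdots)$ of $n$ is identified with its Young diagram, with boxes $(i,j)$, $1\le j\le\lambda_i$ ($i$ = row index increasing downwards, $j$ = column index increasing to the right). A standard tableau $\Lambda$ of shape $\lambda$ is a filling of the boxes by $1,\dots,n$, each used once, increasing along rows and down columns. The content of box $(i,j)$ is $j-i$; $c_p(\Lambda)$ denotes the content of the box of $\Lambda$ containing $p$. The $i$-th principal hook of $\lambda$ is the set of boxes $\{(i,j'):j'\ge i\}\cup\{(i',i):i'\ge i\}$ of $\lambda$. For distinct $p,q\in\{1,\dots,n\}$ let $(pq)\in S_n$ be the transposition and put $f_{pq}(u,v)=1-\frac{(pq)}{u-v}$, a rational function of two complex variables with values in $\mathbb{C}S_n$. Define the rational function $$F_\Lambda(z_1,\dots,z_n)=\prod_{(p,q)}^{\rightarrow} f_{pq}\bigl(z_p+c_p(\Lambda),z_q+c_q(\Lambda)\bigr),$$ the product over all pairs $1\le p<q\le n$, ordered lexicographically from left to right. $\mathcal{H}_\Lambda\subset\mathbb{C}^n$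 is the vector subspace of all tuples $(z_1,\dots,z_n)$ such that $z_p=z_q$ whenever $p$ and $q$ appear in the same principal hook of $\Lambda$. $V_\lambda$ is the irreducible complex $S_n$-module corresponding to $\lambda$ (e.g. the left ideal of $\mathbb{C}S_n$ generated by the Young symmetrizer $P_\Lambda Q_\Lambda$, where $P_\Lambda$ is the sum of the elements of the row group and $Q_\Lambda$ the signed sum of the elements of the column group of $\Lambda$), equipped with an $S_n$-invariant inner product $(\ ,\ )$. The Young basis of $V_\lambda$ consists of vectors $v_\Lambda$, one for each standard tableau $\Lambda$ of shape $\lambda$, with $(v_\Lambda,v_\Lambda)=1$, obtained by successive restriction along $S_n\supset S_{n-1}\supset\cdots\supset S_1$: $v_\Lambda$ is, for each $k$, contained in the $S_k$-irreducible submodule of $V_\lambda$ (along the chain of restrictions) whose shape is that of the tableau formed by the entries $1,\dots,k$ of $\Lambda$. This determines $v_\Lambda$ up to a scalar of modulus one. *)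

(* Defs.v *)
From HB Require Import structures.
From mathcomp Require Import all_boot all_order all_algebra all_fingroup.
From mathcomp Require Import mxrepresentation sesquilinear fraction reals.
From mathcomp Require Import complex mpoly.

Set Implicit Arguments.
Unset Strict Implicit.
Unset Printing Implicit Defensive.

Import Order.TTheory GRing.Theory Num.Theory.
Local Open Scope ring_scope.
Local Open Scope complex_scope.

Local Notation "x %:F" := (@FracField.tofrac _ x) : ring_scope.

(* Rows, columns and entries are all numbered from 0, so that the entries     *)
(* 1, .., n are the elements of 'I_n.  Contents and the shape of principal    *)
(* hooks are not affected by this shift.                                      *)

Definition is_partition (n : nat) (lam : seq nat) : bool :=
  [&& sorted geq lam, 0%N \notin lam & sumn lam == n].

Definition diagram (lam : seq nat) : pred (nat * nat) :=
  fun b => (b.2 < nth 0 lam b.1)%N.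

(* A tableau is given by the bijection sending each entry to its box (row,    *)
(* column), i.e. by the inverse of the filling.                               *)
Definition standard_tableau (n : nat) (lam : seq nat)
    (T : 'I_n -> nat * nat) : Prop :=
  [/\ injective T,
      forall b, diagram lam b <-> exists p, T p = b,
      forall p q, (T p).1 = (T q).1 -> ((T p).2 < (T q).2)%N -> (p < q)%N
    & forall p q, (T p).2 = (T q).2 -> ((T p).1 < (T q).1)%N -> (p < q)%N].

Definition content (b : nat * nat) : int := b.2%:Z - b.1%:Z.

Definition principal_hook (i : nat) : pred (nat * nat) :=
  fun b => ((b.1 == i) && (i <= b.2)%N) || ((b.2 == i) && (i <= b.1)%N).

(* {ffun 'S_n -> K} is the group algebra K S_n, a standing for the sum of     *)
(* the a s times s.  The product of K S_n is the one for which S_n acts on    *)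
(* the left, with (s t) i = s (t i); this element is (t * s)%g in MathComp.   *)
Section GroupAlgebra.

Variable n : nat.

Definition ga_one (K : pzSemiRingType) : {ffun 'S_n -> K} :=
  [ffun s => (s == 1%g)%:R].

Definition ga_mul (K : pzSemiRingType) (a b : {ffun 'S_n -> K}) :
    {ffun 'S_n -> K} :=
  [ffun r => \sum_(st : 'S_n * 'S_n | (st.2 * st.1)%g == r) a st.1 * b st.2].

Definition f_factor (K : fieldType) (p q : 'I_n) (u v : K) :
    {ffun 'S_n -> K} :=
  [ffun s => (s == 1%g)%:R - (s == tperm p q)%:R / (u - v)].

End GroupAlgebra.

Section FusionFunction.

Variables (C : fieldType) (n : nat).

Definition shifted_var (T : 'I_n -> nat * nat) (p : 'I_n) :
    {fraction {mpoly C[n]}} :=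
  ('X_p : {mpoly C[n]})%:F + (content (T p))%:~R.

Definition F_function (T : 'I_n -> nat * nat) :
    {ffun 'S_n -> {fraction {mpoly C[n]}}} :=
  \big[@ga_mul n _ / ga_one n _]_(p < n)
    \big[@ga_mul n _ / ga_one n _]_(q < n | (p < q)%N)
      f_factor p q (shifted_var T p) (shifted_var T q).

Definition H_space (T : 'I_n -> nat * nat) (z : 'I_n -> C) : Prop :=
  forall i p q, principal_hook i (T p) -> principal_hook i (T q) -> z p = z q.

(* For a linear subspace H: the restriction of r to H is defined, that is     *)
(* r = a / b for some b not vanishing identically on H, and it is the         *)
(* rational function c / d on H whenever d does not vanish identically on H.  *)
(* Every polynomial function on H is the restriction of one on C^n.           *)
Definition restricts_to (H : ('I_n -> C) -> Prop)
    (r : {fraction {mpoly C[n]}}) (c d : {mpoly C[n]}) : Prop :=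
  exists a b : {mpoly C[n]},
    [/\ r = a%:F / b%:F,
        exists2 z, H z & b.@[z] != 0
      & forall z, H z -> a.@[z] * d.@[z] = c.@[z] * b.@[z]].

(* The restriction of r to H is regular at the point z0 of H, with value y.   *)
Definition restriction_regular_with_value (H : ('I_n -> C) -> Prop)
    (r : {fraction {mpoly C[n]}}) (z0 : 'I_n -> C) (y : C) : Prop :=
  exists c d : {mpoly C[n]},
    [/\ restricts_to H r c d, d.@[z0] != 0 & y = c.@[z0] / d.@[z0]].

End FusionFunction.

Section YoungModules.

Variables (C : fieldType) (n : nat) (T : 'I_n -> nat * nat).

Definition row_group : {set 'S_n} :=
  [set s : 'S_n | [forall p, (T (s p)).1 == (T p).1]].

Definition col_group : {set 'S_n} :=
  [set s : 'S_n | [forall p, (T (s p)).2 == (T p).2]].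

(* For G the symmetric group on the entries 0, .., k - 1, the sets            *)
(* row_group :&: G and col_group :&: G are the row and column groups of the   *)
(* tableau formed by these entries of T.                                      *)
Definition young_symmetrizer (G : {group 'S_n}) : {ffun 'S_n -> C} :=
  ga_mul [ffun s => (s \in row_group :&: G)%:R]
         [ffun s => (-1) ^+ odd_perm s * (s \in col_group :&: G)%:R].

Definition young_row (G : {group 'S_n}) : 'rV[C]_(gcard G) :=
  \row_i young_symmetrizer G (enum_val i).

(* MathComp representations act on row vectors on the right: x sends w to     *)
(* w *m rG x, and w *m rG (t * s)%g = (w *m rG t) *m rG s.  For the product   *)
(* of ga_mul this is a left module.  In particular regular_repr sends the     *)
(* basis vector of t to that of (t * s)%g, which is left multiplication by s, *)
(* and the cyclic submodule below is the left ideal C G . P Q.                *)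
Definition young_repr (G : {group 'S_n}) :=
  submod_repr (cyclic_mx_module (regular_repr C G) (young_row G)).

(* rG is the irreducible G-module attached to the shape of the tableau T (or  *)
(* of the part of T moved by G).  Irreducibility is also a consequence of the *)
(* similarity with young_repr.                                                *)
Definition irreducible_of_shape (G : {group 'S_n}) (d : nat)
    (rG : mx_representation C G d) : Prop :=
  mx_irreducible rG /\ mx_rsim rG (young_repr G).

Definition Sym_initial (k : nat) : {group 'S_n} :=
  Sym_group [set p : 'I_n | (p < k)%N].

Definition irr_submodule_of_shape (m : nat)
    (rV : mx_representation C [set: 'S_n] m) (k : nat) (W : 'M[C]_m) : Prop :=
  exists modW : mxmodule (subg_repr rV (subsetT (Sym_initial k))) W,
    irreducible_of_shape (submod_repr modW).

End YoungModules.

(* V = W n >= W (n - 1) >= ... >= W 1 is the chain of submodules obtained by  *)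
(* successive restriction.                                                    *)
Definition young_vector (C : numClosedFieldType) (n : nat)
    (T : 'I_n -> nat * nat) (m : nat) (rV : mx_representation C [set: 'S_n] m)
    (form : {dot 'rV[C]_m for Num.conj}) (v : 'rV[C]_m) : Prop :=
  form v v = 1 /\
  exists W : nat -> 'M[C]_m,
    [/\ W n = 1%:M,
        forall k, (0 < k < n)%N -> (W k <= W k.+1)%MS
      & forall k, (0 < k <= n)%N ->
          irr_submodule_of_shape T rV k (W k) /\ (v <= W k)%MS].

Definition invariant_form (C : numClosedFieldType) (n m : nat)
    (rV : mx_representation C [set: 'S_n] m)
    (form : {dot 'rV[C]_m for Num.conj}) : Prop :=
  forall (s : 'S_n) (u w : 'rV[C]_m), form (u *m rV s) (w *m rV s) = form u w.

(* Main.v *)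
Require Import Defs.
From HB Require Import structures.
From mathcomp Require Import all_boot all_order all_algebra all_fingroup.
From mathcomp Require Import mxrepresentation sesquilinear fraction reals.
From mathcomp Require Import complex mpoly.
From mathcomp Require Import zify ring.

Set Implicit Arguments.
Unset Strict Implicit.
Unset Printing Implicit Defensive.

Import Order.TTheory GRing.Theory Num.Theory.
Local Open Scope ring_scope.
Local Open Scope complex_scope.

(** Each entry p of the tableau has a spectral parameter: its variable plus its
    content. The factors of index (p, q) satisfy the Yang-Baxter equation, so
    their product can be formed along any word in the entries, and words which
    differ by the exchange of two adjacent letters give products which differ
    by the factor of these letters ([wordprod_exchange]). The rational function
    of the theorem belongs to the word of the entries in increasing order.

    Regularity.  Consider the word which reads the diagram hook by hook, the
    corner and the arm of each hook before its leg. A factor (p, q) is singular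
    when p and q are on one diagonal. Then the letter r after p is a neighbour
    of p in the same hook; on the subspace H the parameters of p and r differ
    by +-1, the product over the preceding letters is an eigenvector of (p r),
    and the pole of the factor (p, q) cancels against the factor (r, q)
    ([link_factor]). This holds for one word. All others which are compatible
    with the tableau are reached from it by exchanging letters in incomparable
    boxes ([std_connect]); their contents differ by at least 2, and the factors
    involved are regular and invertible ([fusion]).

    The value E.  It is an eigenvector of the Jucys-Murphy elements, under left
    and right multiplication, with the contents as eigenvalues. For the hook
    word this is an induction on the length: let the other variables reach
    their limits before that of the last letter q. If t is the parameter of q,
    the Jucys-Murphy element of q acts on the product as t, up to the multiple
    of the preceding value by t times the product of 1 - (t - c_p)^-2 over the
    earlier letters p ([jucys_column]). This scalar has a zero at the content of
    q, because q is an addable box ([count_contents], [ratio_pole]). Exchanging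
    letters preserves the eigenvector property by the intertwining relations
    ([bieigen_swap]).

    Uniqueness.  Such an eigenvector is determined by its coefficient at the
    identity ([bieigen_unique]). Transport it to the words which read the
    diagram by rows and by columns. For the row word, positivity of the standard
    form on the group algebra forces it to absorb the row group; for the column
    word it absorbs the signed column group. With P and Q the row and column
    sums, it thus lies in a space which is spanned by P Q P, by the lemma of
    von Neumann that P x Q is always a multiple of P Q.

    The matrix element.  The sum of the transpositions of S_k is central and
    acts on the Young symmetrizer of the entries < k as the sum of their
    contents ([class_sum_young]), hence as this scalar on each submodule of the
    chain that contains v. Differences of these sums are the Jucys-Murphy
    elements, so v is an eigenvector of these with the contents as eigenvalues,
    and the matrix element of v is an eigenvector on both sides. Both it and E
    have coefficient 1 at the identity ([wordprod_coef1]), so they agree. *)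

(** * The group algebra as a ring *)

(** An alias, since finite functions already carry the pointwise product. *)
Definition galg (n : nat) (K : fieldType) := {ffun 'S_n -> K}.

Section GroupAlgebraRing.

Variables (n : nat) (K : fieldType).
Local Notation ga := (galg n K).

HB.instance Definition _ := GRing.Zmodule.copy ga {ffun 'S_n -> K}.

Definition gmul (a b : ga) : ga := @ga_mul n K a b.
Definition gone : ga := @ga_one n K.
Definition gscale (k : K) (a : ga) : ga := [ffun s => k * a s].

Lemma gmulE (a b : ga) r : gmul a b r = \sum_x a x * b (r * x^-1)%g.
Proof.
rewrite ffunE.
rewrite (eq_bigr (fun st : 'S_n * 'S_n => a st.1 * b (r * st.1^-1)%g)); last first.
  by move=> [s t] /= /eqP <-; rewrite mulgK.
rewrite (reindex_onto (fun s => (s, (r * s^-1)%g)) (fun st => st.1)) /=; last first.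
  by move=> [s t] /= /eqP <-; rewrite mulgK.
by apply: eq_bigl => s; rewrite mulgKV !eqxx.
Qed.

Lemma gmulA : associative gmul.
Proof.
move=> a b c; apply/ffunP => r; rewrite !gmulE.
under eq_bigr do rewrite gmulE mulr_sumr.
under [in RHS]eq_bigr do rewrite gmulE mulr_suml.
rewrite [RHS]exchange_big /=; apply: eq_bigr => x _.
rewrite [RHS](reindex (fun y => (y * x)%g)) /=; last first.
  by exists (fun y => (y * x^-1)%g) => y _; rewrite ?mulgKV ?mulgK.
by apply: eq_bigr => y _; rewrite mulrA mulgK invMg mulgA.
Qed.

Lemma gmul1 : left_id gone gmul.
Proof.
move=> a; apply/ffunP => r; rewrite gmulE (bigD1 1%g) //= big1.
  by rewrite ffunE eqxx mul1r invg1 mulg1 addr0.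
by move=> s /negPf s1; rewrite ffunE s1 mul0r.
Qed.

Lemma gmulr1 : right_id gone gmul.
Proof.
move=> a; apply/ffunP => r; rewrite gmulE (bigD1 r) //= big1.
  by rewrite ffunE mulgV eqxx mulr1 addr0.
move=> s /negPf s1; rewrite ffunE -eq_mulgV1 eq_sym s1 mulr0 //.
Qed.

Lemma gmulDl : left_distributive gmul +%R.
Proof.
move=> a b c; apply/ffunP => r; rewrite [RHS]ffunE !gmulE -big_split /=.
by apply: eq_bigr => x _; rewrite ffunE mulrDl.
Qed.

Lemma gmulDr : right_distributive gmul +%R.
Proof.
move=> a b c; apply/ffunP => r; rewrite [RHS]ffunE !gmulE -big_split /=.
by apply: eq_bigr => x _; rewrite ffunE mulrDr.
Qed.

Lemma gone_neq0 : gone != 0.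
Proof.
by apply/eqP => /ffunP/(_ 1%g)/eqP; rewrite !ffunE eqxx oner_eq0.
Qed.

HB.instance Definition _ := GRing.Zmodule_isNzRing.Build ga
  gmulA gmul1 gmulr1 gmulDl gmulDr gone_neq0.

Fact gscaleA a b (v : ga) : gscale a (gscale b v) = gscale (a * b) v.
Proof. by apply/ffunP => s; rewrite !ffunE mulrA. Qed.
Fact gscale1 : left_id 1 gscale.
Proof. by move=> v; apply/ffunP => s; rewrite !ffunE mul1r. Qed.
Fact gscaleDr : right_distributive gscale +%R.
Proof. by move=> a u v; apply/ffunP => s; rewrite !ffunE mulrDr. Qed.
Fact gscaleDl (v : ga) : {morph gscale^~ v : a b / a + b}.
Proof. by move=> a b; apply/ffunP => s; rewrite !ffunE mulrDl. Qed.

HB.instance Definition _ := GRing.Zmodule_isLmodule.Build K ga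
  gscaleA gscale1 gscaleDr gscaleDl.

Fact gscaleAl (k : K) (a b : ga) : k *: (a * b) = (k *: a) * b.
Proof.
apply/ffunP => r; rewrite ffunE /= !gmulE mulr_sumr.
by apply: eq_bigr => x _; rewrite ffunE mulrA.
Qed.

HB.instance Definition _ := GRing.Lmodule_isLalgebra.Build K ga gscaleAl.

Fact gscaleAr (k : K) (a b : ga) : k *: (a * b) = a * (k *: b).
Proof.
apply/ffunP => r; rewrite ffunE /= !gmulE mulr_sumr.
by apply: eq_bigr => x _; rewrite ffunE mulrCA.
Qed.

HB.instance Definition _ := GRing.Lalgebra_isAlgebra.Build K ga gscaleAr.

Lemma gaZE k (a : ga) s : (k *: a) s = k * a s.
Proof. by rewrite ffunE. Qed.

Lemma gaE (a b : ga) s : (a + b) s = a s + b s.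
Proof. by rewrite ffunE. Qed.

Lemma gaNE (a : ga) s : (- a) s = - a s.
Proof. by rewrite ffunE. Qed.

Lemma ga0E s : (0 : ga) s = 0.
Proof. by rewrite ffunE. Qed.

Lemma ga1E s : (1 : ga) s = (s == 1%g)%:R.
Proof. by rewrite ffunE. Qed.

Lemma gaME (a b : ga) r : (a * b) r = \sum_x a x * b (r * x^-1)%g.
Proof. exact: gmulE. Qed.

Lemma ga_sumE (I : Type) (r : seq I) (P : pred I) (F : I -> ga) s :
  (\sum_(i <- r | P i) F i) s = \sum_(i <- r | P i) F i s.
Proof. by elim/big_rec2: _ => [|i x y _ <-]; rewrite ?ga0E ?gaE. Qed.

(** ** Group elements *)

Definition gelt (s : 'S_n) : ga := [ffun t => (t == s)%:R].

Lemma gelt1 : gelt 1 = 1.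
Proof. by apply/ffunP => s; rewrite !ffunE. Qed.

(** The group acts on the left in this algebra, and permutations are composed
    from left to right, whence the reversal. *)
Lemma geltM s t : gelt s * gelt t = gelt (t * s).
Proof.
apply/ffunP => r; rewrite gaME (bigD1 s) //= big1.
  by rewrite !ffunE eqxx mul1r addr0 eq_sym eq_mulgV1 invMg invgK mulgA -eq_mulgV1
      eq_sym.
by move=> x /negPf xs; rewrite ffunE xs mul0r.
Qed.

Lemma geltEl (s : 'S_n) (a : ga) r : (gelt s * a) r = a (r * s^-1)%g.
Proof.
rewrite gaME (bigD1 s) //= big1 ?ffunE ?eqxx ?mul1r ?addr0 //.
by move=> x /negPf xs; rewrite ffunE xs mul0r.
Qed.

Lemma geltEr (s : 'S_n) (a : ga) r : (a * gelt s) r = a (s^-1 * r)%g.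
Proof.
rewrite gaME (bigD1 (s^-1 * r)%g) //= big1 ?ffunE.
  by rewrite invMg invgK mulKVg eqxx mulr1 addr0.
move=> x xs; rewrite ffunE; case: eqP => [e|_]; last by rewrite mulr0.
by case/eqP: xs; rewrite -e invMg invgK mulgKV.
Qed.

Lemma ga_decomp (a : ga) : a = \sum_s a s *: gelt s.
Proof.
apply/ffunP => t; rewrite ga_sumE (bigD1 t) //= big1 ?addr0.
  by rewrite gaZE ffunE eqxx mulr1.
by move=> s /negPf st; rewrite gaZE ffunE eq_sym st mulr0.
Qed.

(** Exchanges left and right multiplication and fixes the transpositions. *)
Definition star (a : ga) : ga := [ffun s => a s^-1%g].

Lemma starK : involutive star.
Proof. by move=> a; apply/ffunP => s; rewrite !ffunE invgK. Qed.

Lemma starM a b : star (a * b) = star b * star a.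
Proof.
apply/ffunP => r; rewrite ffunE !gaME.
rewrite (reindex (fun x => (x * r^-1)%g)) /=; last first.
  by exists (fun y => (y * r)%g) => y _; rewrite ?mulgKV ?mulgK.
apply: eq_bigr => x _; rewrite !ffunE mulrC !invMg !invgK.
by rewrite mulgA mulVg mul1g.
Qed.

Lemma starD a b : star (a + b) = star a + star b.
Proof. by apply/ffunP => s; rewrite !ffunE. Qed.

Lemma starN a : star (- a) = - star a.
Proof. by apply/ffunP => s; rewrite !ffunE. Qed.

Lemma starZ k a : star (k *: a) = k *: star a.
Proof. by apply/ffunP => s; rewrite !ffunE. Qed.

Lemma star1 : star 1 = 1.
Proof. by apply/ffunP => s; rewrite !ffunE eq_invg1. Qed.

Lemma star_gelt s : star (gelt s) = gelt s^-1.
Proof. by apply/ffunP => t; rewrite !ffunE -eq_invg_sym. Qed.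

(** ** Transpositions *)

Definition transp (p q : 'I_n) : ga := gelt (tperm p q).

Lemma transpC p q : transp p q = transp q p.
Proof. by rewrite /transp tpermC. Qed.

Lemma transp_sq p q : transp p q * transp p q = 1.
Proof. by rewrite geltM tperm2 gelt1. Qed.

Lemma transpK p q a : transp p q * (transp p q * a) = a.
Proof. by rewrite mulrA transp_sq mul1r. Qed.

Lemma star_transp p q : star (transp p q) = transp p q.
Proof. by rewrite star_gelt tpermV. Qed.

Lemma geltJ s p q : gelt s * transp p q = transp (s p) (s q) * gelt s.
Proof.
by rewrite !geltM; congr gelt; rewrite -tpermJ conjgE mulKVg.
Qed.

Lemma transpJ a b p q : transp a b * transp p q = transp (tperm a b p) (tperm a b q)
    * transp a b.
Proof. exact: geltJ. Qed.

Lemma transp_comm a b p q : a != p -> a != q -> b != p -> b != q ->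
  transp a b * transp p q = transp p q * transp a b.
Proof. by move=> ? ? ? ?; rewrite transpJ !tpermD. Qed.

(** The three products are one and the same 3-cycle on p, q and r. *)
Lemma transp_braid p q r : p != q -> p != r -> q != r ->
  (transp p q * transp p r = transp p r * transp q r) * (transp q r * transp p q =
      transp p r * transp q r).
Proof.
move=> pq pr qr; split; last by rewrite transpJ tpermL tpermD // 1?eq_sym.
by rewrite [RHS]transpJ [tperm p r q]tpermD // 1?eq_sym // tpermR transpC.
Qed.

End GroupAlgebraRing.

(** * Yang-Baxter words *)

Section Rearrangements.

Variable R : nzRingType.
Implicit Types a b f x y z A B C F Q P S V : R.

Lemma push_column Q V P C S : V * P * C = C * P * V -> V * S = S * V ->
  Q * C = C * Q -> Q * P * S = S * P * Q ->
  Q * V * P * (C * S) = C * S * P * (Q * V).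
Proof.
move=> e1 e2 e3 e4; transitivity (Q * (V * P * C) * S); first by rewrite !mulrA.
rewrite e1 !mulrA e3 -!mulrA e2.
transitivity (C * (Q * P * S) * V); first by rewrite !mulrA.
by rewrite e4 !mulrA.
Qed.

Lemma exchange_rows x y z A B : A * B * z = z * B * A -> x * B = B * x ->
  y * A = A * y -> z * y * x = x * y * z ->
  x * A * (y * B) * z = z * (y * B) * (x * A).
Proof.
move=> e1 e2 e3 e4; transitivity (x * (y * A) * B * z); first by rewrite e3 !mulrA.
transitivity (x * y * (A * B * z)); first by rewrite !mulrA.
rewrite e1; transitivity (x * y * z * B * A); first by rewrite !mulrA.
rewrite -e4; transitivity (z * y * (x * B) * A); first by rewrite !mulrA.
by rewrite e2 !mulrA.
Qed.

Lemma exchange_front f z A B F : A * B * z = z * B * A -> z * F = F * z ->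
  f * A * (B * F) * z = f * (z * B * (A * F)).
Proof.
move=> e1 e2; transitivity (f * (A * B * (F * z))); first by rewrite !mulrA.
by rewrite -e2 (mulrA (A * B)) e1 !mulrA.
Qed.

Lemma swap_middle A a b B f : f * A = A * f -> f * B = B * f ->
  a * b * f = f * b * a -> A * (a * (b * B)) * f = f * (A * (b * (a * B))).
Proof.
move=> e1 e2 e3; transitivity (A * (a * b * (B * f))); first by rewrite !mulrA.
rewrite -e2 (mulrA (a * b)) e3 [RHS]mulrA e1 !mulrA //.
Qed.

End Rearrangements.

Section Words.

Variables (n : nat) (K : fieldType).
Local Notation ga := (galg n K).
Implicit Types (p q r a b : 'I_n) (x y t : K) (w : seq 'I_n) (u : 'I_n -> K).

(** The factor of index (p, q), which only depends on the difference x of the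
    spectral parameters of p and q. *)
Definition factor p q x : ga := 1 - x^-1 *: transp K p q.

Lemma factor_mul p q r s x y : factor p q x * factor r s y =
  1 - x^-1 *: transp K p q - y^-1 *: transp K r s
    + (x^-1 * y^-1) *: (transp K p q * transp K r s).
Proof.
rewrite /factor mulrBl mul1r mulrBr mulr1 -scalerAl -scalerAr scalerA.
by apply/ffunP => g; rewrite !(gaE, gaNE, gaZE); ring.
Qed.

Lemma factor_comm p q r s x y : p != r -> p != s -> q != r -> q != s ->
  GRing.comm (factor p q x) (factor r s y).
Proof.
move=> pr ps qr qs; rewrite /GRing.comm !factor_mul transp_comm //.
by apply/ffunP => g; rewrite !(gaE, gaNE, gaZE); ring.
Qed.

Lemma factor_inv p q x : x != 0 ->
  factor p q x * factor q p (- x) = (1 - x ^- 2) *: 1.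
Proof.
move=> x0; rewrite factor_mul [transp K q p]transpC transp_sq.
by apply/ffunP => g; rewrite !(gaE, gaNE, gaZE); field; rewrite oppr_eq0 x0.
Qed.

Lemma star_factor p q x : star (factor p q x) = factor p q x.
Proof. by rewrite starD star1 starN starZ star_transp. Qed.

(** All terms cancel except multiples of a * b - b * a, and the coefficients
    of these add up to zero because z = x + y. *)
Lemma braid_product (a b c : ga) x y z : x != 0 -> y != 0 -> z != 0 -> z = x + y ->
  b * c = a * b -> c * a = a * b -> a * c = b * a -> c * b = b * a ->
  a * b * c = c * b * a ->
  (1 - x^-1 *: a) * (1 - z^-1 *: b) * (1 - y^-1 *: c)
  = (1 - y^-1 *: c) * (1 - z^-1 *: b) * (1 - x^-1 *: a).
Proof.
move=> x0 y0 z0 zE bc ca ac cb abc.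
have E : y^-1 * x^-1 = x^-1 * z^-1 + z^-1 * y^-1.
  by move: z0; rewrite zE => z0; field; rewrite ?x0 ?y0 ?z0.
rewrite !(mulrBl, mulrBr, mul1r, mulr1) -!(scalerAl, scalerAr) !scalerA.
rewrite abc bc ca ac cb; move: (a * b) (b * a) (c * b * a) => X Y Z.
apply/ffunP => g; rewrite !(gaE, gaNE, gaZE).
by rewrite [x^-1 * y^-1]mulrC E; ring.
Qed.

Lemma yang_baxter p q r x y z : p != q -> p != r -> q != r ->
  x != 0 -> y != 0 -> z != 0 -> z = x + y ->
  factor p q x * factor p r z * factor q r y = factor q r y * factor p r z * factor p
      q x.
Proof.
move=> pq pr qr x0 y0 z0 zE; have [e1 e2] := transp_braid K pq pr qr.
have f1 : transp K q r * transp K p r = transp K p r * transp K p q.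
  by have /(congr1 (@star _ _)) := e1; rewrite !starM !star_transp => ->.
have f2 : transp K p q * transp K q r = transp K p r * transp K p q.
  by have /(congr1 (@star _ _)) := e2; rewrite !starM !star_transp f1.
have abc : transp K p q * transp K p r * transp K q r = transp K q r * transp K p r *
    transp K p q.
  by rewrite e1 f1 -!mulrA !transp_sq.
exact: (braid_product x0 y0 z0 zE (esym e1) (etrans e2 (esym e1)) f2 f1 abc).
Qed.

Lemma commr_bigl (I : eqType) (l : seq I) (F : I -> ga) z :
  {in l, forall i, GRing.comm z (F i)} -> GRing.comm z (\prod_(i <- l) F i).
Proof.
by move=> h; rewrite big_seq; apply: commr_prod => i il; apply: h.
Qed.

Lemma star_prod (I : Type) (l : seq I) (F : I -> ga) :
  star (\prod_(i <- l) F i) = \prod_(i <- rev l) star (F i).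
Proof.
elim: l => [|i l IH]; first by rewrite !big_nil star1.
by rewrite rev_cons big_cons starM IH -cats1 big_cat big_seq1.
Qed.

(** The letters of the word carry their own spectral parameters. Reordering the
    entries of a tableau thus amounts to reading the same letters along another
    word, and all tableaux of one shape are compared in the same variables. *)
Fixpoint wordprod u w : ga :=
  if w is p :: w' then (\prod_(q <- w') factor p q (u p - u q)) * wordprod u w' else 1.

Definition column u w q t : ga := \prod_(p <- w) factor p q (u p - t).

Lemma column_cons u p w q t : column u (p :: w) q t = factor p q (u p - t) * column u
    w q t.
Proof. by rewrite /column big_cons. Qed.

Lemma column_rcons u p w q t : column u (rcons w p) q t = column u w q t * factor p q
    (u p - t).
Proof. by rewrite /column -cats1 big_cat big_seq1. Qed.

Lemma wordprod_comm u w p q x : p \notin w -> q \notin w ->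
  GRing.comm (factor p q x) (wordprod u w).
Proof.
elim: w => [|r w IH] /=; first by move=> _ _; apply: commr1.
rewrite !inE !negb_or => /andP[pr pw] /andP[qr qw].
apply: commrM; last exact: IH.
apply: commr_bigl => s sw; apply: factor_comm => //.
  by apply: contraNneq pw => ->.
by apply: contraNneq qw => ->.
Qed.

Lemma wordprod_rcons u w q : uniq (rcons w q) ->
  wordprod u (rcons w q) = wordprod u w * column u w q (u q).
Proof.
elim: w => [|p w IH] /=.
  by rewrite big_nil mul1r /column big_nil mul1r.
move=> /andP[]; rewrite mem_rcons inE negb_or => /andP[pq pw] uw.
have qw : q \notin w by move: uw; rewrite rcons_uniq => /andP[].
rewrite IH // column_cons -cats1 big_cat big_seq1 -!mulrA; congr (_ * _).
by rewrite !mulrA (wordprod_comm u (u p - u q) pw qw).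
Qed.

Definition generic u w := forall p q, p \in w -> q \in w -> p != q -> u p != u q.

Lemma genericW u w w' : generic u w -> {subset w' <= w} -> generic u w'.
Proof. by move=> g sw p q /sw ? /sw ? ?; apply: g. Qed.

(** One Yang-Baxter move for each letter of w. *)
Lemma row_column u p w q t : uniq [:: p, q & w] ->
  generic u (p :: w) -> {in p :: w, forall r, u r != t} ->
  (\prod_(r <- w) factor p r (u p - u r)) * factor p q (u p - t) * column u (rev w) q t
  = column u (rev w) q t * factor p q (u p - t) * \prod_(r <- w) factor p r (u p - u r).
Proof.
elim: w => [|r v IH] upq g gt; first by rewrite !big_nil /column big_nil mulr1 mul1r.
have /and4P[] := upq; rewrite !inE !negb_or.
move=> /and3P[pq pr pv] /andP[qr qv] rv uv.
rewrite big_cons rev_cons column_rcons.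
have cV : (\prod_(s <- v) factor p s (u p - u s)) * factor r q (u r - t)
    = factor r q (u r - t) * \prod_(s <- v) factor p s (u p - u s).
  apply/commr_sym/commr_bigl => s s_v; apply: factor_comm.
  - by rewrite eq_sym.
  - by apply: contraNneq rv => ->.
  - by rewrite eq_sym.
  - by apply: contraNneq qv => ->.
have cC : factor p r (u p - u r) * column u (rev v) q t
    = column u (rev v) q t * factor p r (u p - u r).
  apply: commr_bigl => s1; rewrite mem_rev => s_v; apply: factor_comm => //.
  - by apply: contraNneq pv => ->.
  - by apply: contraNneq rv => ->.
  - by rewrite eq_sym.
have {}IH : (\prod_(s <- v) factor p s (u p - u s)) * factor p q (u p - t) * column u
    (rev v) q t
    = column u (rev v) q t * factor p q (u p - t) * \prod_(s <- v) factor p s (u p -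
        u s).
  apply: IH; first by apply/and3P; rewrite inE negb_or pq pv qv.
    by apply: (genericW g) => s1; rewrite !inE => /orP[->|->] //; rewrite !orbT.
  by move=> s1; rewrite inE => /orP[/eqP->|sv]; apply: gt; rewrite !inE ?eqxx ?sv ?orbT.
apply: push_column IH cV cC _; apply: yang_baxter; rewrite ?subr_eq0.
- by [].
- by [].
- by rewrite eq_sym.
- by apply: g; rewrite ?inE ?eqxx ?orbT.
- by apply: gt; rewrite ?inE ?eqxx ?orbT.
- by apply: gt; rewrite ?inE ?eqxx ?orbT.
- by rewrite addrA subrK.
Qed.

(** A letter can be appended with its column on the right or, by Yang-Baxter,
    with the reversed column on the left. *)
Lemma wordprod_column u w q t : uniq (rcons w q) -> generic u w ->
  {in w, forall p, u p != t} ->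
  wordprod u w * column u w q t = column u (rev w) q t * wordprod u w.
Proof.
elim: w => [|p w IH] /=; first by rewrite /column !big_nil mul1r.
move=> /andP[]; rewrite mem_rcons inE negb_or => /andP[pq pw] uw g gt.
have [qw {}uw] : q \notin w /\ uniq w.
  by move: uw; rewrite rcons_uniq => /andP[].
rewrite column_cons -mulrA (mulrA (wordprod u w)) -(wordprod_comm u (u p - t) pw qw)
    -mulrA IH //; first last.
- by move=> r rw; apply: gt; rewrite inE rw orbT.
- by apply: (genericW g) => r rw; rewrite inE rw orbT.
- by rewrite rcons_uniq qw.
rewrite rev_cons column_rcons !mulrA; congr (_ * wordprod u w).
apply: row_column => //.
  by rewrite /= inE negb_or pq pw qw uw.
Qed.

(** By Yang-Baxter the product can be read backwards. *)
Lemma star_wordprod u w : uniq w -> generic u w -> star (wordprod u w) = wordprod u w.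
Proof.
elim/last_ind: w => [|w q IH] /= uw g; first exact: star1.
have gw : generic u w.
  by apply: (genericW g) => p pw; rewrite mem_rcons inE pw orbT.
rewrite wordprod_rcons // starM IH //; last by move: uw; rewrite rcons_uniq => /andP[].
rewrite wordprod_column //; last first.
  move=> p pw; apply: g; rewrite ?mem_rcons ?inE ?eqxx ?pw ?orbT //.
  by apply: contraTneq uw => <-; rewrite rcons_uniq pw.
congr (_ * _); rewrite /column star_prod; apply: eq_bigr => p _; exact: star_factor.
Qed.

Lemma row_exchange u a b w : uniq [:: a, b & w] -> generic u [:: a, b & w] ->
  (\prod_(q <- w) factor a q (u a - u q)) * (\prod_(q <- w) factor b q (u b - u q))
    * factor b a (u b - u a)
  = factor b a (u b - u a) * (\prod_(q <- w) factor b q (u b - u q))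
    * \prod_(q <- w) factor a q (u a - u q).
Proof.
elim: w => [|q w IH] ub g; first by rewrite !big_nil !mul1r !mulr1.
have /and4P[] := ub; rewrite !inE !negb_or.
move=> /and3P[ab aq aw] /andP[bq bw] qw uw; rewrite !big_cons.
have cA : factor b q (u b - u q) * (\prod_(s <- w) factor a s (u a - u s))
    = (\prod_(s <- w) factor a s (u a - u s)) * factor b q (u b - u q).
  apply: commr_bigl => s sw; apply: factor_comm.
  - by rewrite eq_sym.
  - by apply: contraNneq bw => ->.
  - by rewrite eq_sym.
  - by apply: contraNneq qw => ->.
have cB : factor a q (u a - u q) * (\prod_(s <- w) factor b s (u b - u s))
    = (\prod_(s <- w) factor b s (u b - u s)) * factor a q (u a - u q).
  apply: commr_bigl => s sw; apply: factor_comm.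
  - by [].
  - by apply: contraNneq aw => ->.
  - by rewrite eq_sym.
  - by apply: contraNneq qw => ->.
have {}IH : (\prod_(s <- w) factor a s (u a - u s)) * (\prod_(s <- w) factor b s (u b
    - u s))
    * factor b a (u b - u a) = factor b a (u b - u a)
    * (\prod_(s <- w) factor b s (u b - u s)) * \prod_(s <- w) factor a s (u a - u s).
  apply: IH; first by apply/and3P; rewrite inE negb_or ab aw bw.
  by apply: (genericW g) => s; rewrite !inE => /or3P[] ->; rewrite ?orbT.
have Y : factor b a (u b - u a) * factor b q (u b - u q) * factor a q (u a - u q)
   = factor a q (u a - u q) * factor b q (u b - u q) * factor b a (u b - u a).
  apply: yang_baxter => //; rewrite ?subr_eq0.
  - by rewrite eq_sym.
  - by apply: g; rewrite ?inE ?eqxx ?orbT // eq_sym.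
  - by apply: g; rewrite ?inE ?eqxx ?orbT // eq_sym.
  - by apply: g; rewrite ?inE ?eqxx ?orbT // eq_sym.
  - by rewrite addrA subrK.
exact: exchange_rows.
Qed.

Lemma row_swap u p w1 a b w2 : uniq (p :: w1 ++ [:: a, b & w2]) ->
  generic u (p :: w1 ++ [:: a, b & w2]) ->
  (\prod_(q <- w1 ++ [:: a, b & w2]) factor p q (u p - u q)) * factor a b (u a - u b)
  = factor a b (u a - u b) * \prod_(q <- w1 ++ [:: b, a & w2]) factor p q (u p - u q).
Proof.
rewrite cons_uniq => /andP[pw ub] g.
have [ab abw] : a != b /\ forall r, r \in w1 ++ w2 -> (a != r) && (b != r).
  move: ub; rewrite -[X in w1 ++ X]/([:: a; b] ++ w2) uniq_catCA /= inE negb_or.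
  move=> /and3P[/andP[ab aw] bw _]; split=> // r rw.
  by apply/andP; split; [apply: contraNneq aw | apply: contraNneq bw] => ->.
have pin q : q \in w1 ++ [:: a, b & w2] -> p != q by apply: contraTneq => <-.
have cf (v : seq 'I_n) : {subset v <= w1 ++ w2} ->
    factor a b (u a - u b) * (\prod_(q <- v) factor p q (u p - u q))
    = (\prod_(q <- v) factor p q (u p - u q)) * factor a b (u a - u b).
  move=> sv; apply: commr_bigl => r rv; have rw := sv _ rv.
  have /andP[ar br] := abw r rw; apply: factor_comm => //; rewrite eq_sym pin //.
    by rewrite mem_cat !inE eqxx !orbT.
  by rewrite mem_cat !inE eqxx !orbT.
rewrite !big_cat !big_cons; apply: swap_middle.
- by apply: cf => r rw; rewrite mem_cat rw.
- by apply: cf => r rw; rewrite mem_cat rw orbT.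
have ga : a \in p :: w1 ++ [:: a, b & w2] by rewrite inE mem_cat !inE eqxx !orbT.
have gb : b \in p :: w1 ++ [:: a, b & w2] by rewrite inE mem_cat !inE eqxx !orbT.
have pa : p != a by apply: pin; rewrite mem_cat !inE eqxx !orbT.
have pb : p != b by apply: pin; rewrite mem_cat !inE eqxx !orbT.
have pp : p \in p :: w1 ++ [:: a, b & w2] by rewrite inE eqxx.
apply: yang_baxter; rewrite ?subr_eq0; [by []|by []|by []|exact: g|exact: g|exact: g|].
by rewrite addrA subrK.
Qed.

(** Both words are the product of the same remaining factors, completed by the
    factor of a and b at the left end in one case, and by that of b and a at the
    right end in the other. *)
Lemma wordprod_exchange u w1 a b w2 : uniq (w1 ++ a :: b :: w2) ->
  generic u (w1 ++ a :: b :: w2) ->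
  wordprod u (w1 ++ a :: b :: w2) * factor b a (u b - u a)
  = factor a b (u a - u b) * wordprod u (w1 ++ b :: a :: w2).
Proof.
elim: w1 => [|p w1 IH] ub g.
  have /and3P[] := ub; rewrite inE negb_or => /andP[ab aw] bw uw.
  rewrite /= !big_cons; apply: exchange_front (row_exchange ub g) _.
  exact: wordprod_comm.
move: (ub); rewrite [(p :: w1) ++ _]/= cons_uniq => /andP[pw ub'].
have {}g' : generic u (w1 ++ [:: a, b & w2]).
  by apply: (genericW g) => s sw; rewrite inE sw orbT.
rewrite /= -mulrA IH // !mulrA; congr (_ * _); exact: row_swap.
Qed.

(** When the parameters of two adjacent letters differ by e = +-1, their factor
    is twice a projection onto an eigenspace of the transposition (a b), and it
    can be brought to the left end of the word. *)
Lemma wordprod_link u w1 a b w2 (e : K) : uniq (w1 ++ a :: b :: w2) ->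
  generic u (w1 ++ a :: b :: w2) -> u b - u a = e -> e ^+ 2 = 1 ->
  2%:R != 0 :> K ->
  transp K a b * wordprod u (w1 ++ a :: b :: w2) = e *: wordprod u (w1 ++ a :: b :: w2).
Proof.
move=> ub g uE e2 two0.
have e0 : e != 0.
  by apply/eqP => e0; move: e2; rewrite e0 expr0n => /esym/eqP; rewrite oner_eq0.
have trf : transp K a b * factor a b (u a - u b) = e *: factor a b (u a - u b).
  rewrite -opprB uE /factor mulrBr mulr1 -scalerAr transp_sq scalerBr scalerA.
  rewrite invrN mulrN mulfV // scaleN1r scaleNr !opprK.
  have -> : e^-1 = e by rewrite -[LHS]mulr1 -e2 expr2 mulKf.
  by rewrite addrC.
elim: w1 ub g => [|p w1 IH] ub g; first by rewrite /= big_cons !mulrA trf -!scalerAl.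
move: (ub); rewrite [(p :: w1) ++ _]/= cons_uniq => /andP[pw ub'].
have {}g' : generic u (w1 ++ [:: a, b & w2]).
  by apply: (genericW g) => s sw; rewrite inE sw orbT.
have {}IH := IH ub' g'.
(* The factor acts as 2 on the tail of the word; restoring it there allows
   to move it to the left of the row of p. *)
have fX : factor a b (u a - u b) * wordprod u (w1 ++ [:: a, b & w2])
    = 2%:R *: wordprod u (w1 ++ [:: a, b & w2]).
  rewrite -opprB uE /factor mulrBl mul1r -scalerAl IH scalerA invrN mulNr.
  by rewrite mulVf ?scaleN1r ?opprK ?scaler_nat ?mulr2n.
have E := row_swap ub g.
set P := \prod_(_ <- _) _ in E; set P' := \prod_(_ <- _) _ in E.
have {}E : 2%:R *: wordprod u ((p :: w1) ++ [:: a, b & w2])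
    = factor a b (u a - u b) * (P' * wordprod u (w1 ++ [:: a, b & w2])).
  by rewrite mulrA -E -mulrA fX -scalerAr.
apply: (scalerI two0); rewrite [LHS]scalerAr [RHS]scalerA mulrC -scalerA !E.
by rewrite [LHS]mulrA trf -scalerAl.
Qed.

(** ** The coefficient of the identity *)

Lemma row_supp p w u (s : 'S_n) : (\prod_(q <- w) factor p q (u p - u q)) s != 0 ->
  s p \in p :: w /\ (forall x : 'I_n, x \notin p :: w -> s x = x).
Proof.
elim: w s => [|q w IH] s.
  rewrite big_nil ga1E; have [-> _|_] := eqVneq s 1%g; last by rewrite eqxx.
  by rewrite perm1 inE eqxx; split=> // x; rewrite perm1.
rewrite big_cons mulrBl mul1r -scalerAl gaE gaNE gaZE geltEl tpermV.
set a := \prod_(_ <- _) _.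
have [a0|/IH[sp sx] _] := eqVneq (a s) 0; last first.
  split; first by move: sp; rewrite !inE => /orP[]->; rewrite ?orbT.
  by move=> x; rewrite !inE !negb_or => /and3P[? ? ?]; apply: sx; rewrite inE
      negb_or; apply/andP.
have [b0|/IH[] ] := eqVneq (a (s * tperm p q)%g) 0; first by rewrite a0 b0 mulr0
    subr0 eqxx.
rewrite permM => sp sx _; split.
  case: tpermP sp => [->|->|_ _]; rewrite ?inE ?eqxx ?orbT //.
  by move=> /orP[]->; rewrite ?orbT.
move=> x; rewrite !inE !negb_or => /and3P[xp xq xw].
have := sx x; rewrite inE negb_or xp xw permM => /(_ isT) e.
by rewrite -[LHS](tpermK p q) e tpermD // eq_sym.
Qed.

Lemma wordprod_supp u w (s : 'S_n) (x : 'I_n) : wordprod u w s != 0 -> x \notin w ->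
    s x = x.
Proof.
elim: w s => [|p w IH] s /=.
  by rewrite ga1E; have [-> _ _|_] := eqVneq s 1%g; rewrite ?perm1 ?eqxx.
rewrite gaME => h xw; apply: contraNeq h => sx; rewrite big1 // => t _.
have [->|/row_supp[_ /(_ x xw) tx]] := eqVneq ((\prod_(q <- w) factor p q (u p - u
    q)) t) 0.
  by rewrite mul0r.
have [->|/IH h] := eqVneq (wordprod u w (s * t^-1)%g) 0; first by rewrite mulr0.
case/eqP: sx; have := h _; rewrite permM => e.
rewrite -[LHS](permKV t) e ?tx //.
by move: xw; rewrite inE negb_or => /andP[].
Qed.

(** A nonempty product of distinct transpositions (p q) does not fix p. *)
Lemma row_coef p w u (s : 'S_n) : uniq (p :: w) -> s p = p ->
  (\prod_(q <- w) factor p q (u p - u q)) s = (s == 1%g)%:R.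
Proof.
elim: w => [|q w IH] upq sp; first by rewrite big_nil ga1E.
rewrite big_cons mulrBl mul1r -scalerAl gaE gaNE gaZE geltEl tpermV.
have /and3P[] := upq; rewrite inE negb_or => /andP[pq pw] qw uw.
rewrite IH //; last by apply/andP.
set a := \prod_(_ <- _) _.
suff -> : a (s * tperm p q)%g = 0 by rewrite mulr0 subr0.
apply/eqP; apply: contraT => /row_supp[]; rewrite permM sp tpermL inE eq_sym.
by rewrite (negPf pq) (negPf qw).
Qed.

(** A nonempty product of transpositions picked from the rows moves the first
    letter p whose row contributes. *)
Lemma wordprod_coef1 u w : uniq w -> wordprod u w 1%g = 1.
Proof.
elim: w => [|p w IH] upw; first by rewrite /= ga1E eqxx.
move: (upw); rewrite cons_uniq => /andP[pw uw] /=.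
rewrite gaME (bigD1 1%g) //= invg1 mulg1 row_coef ?perm1 // eqxx mul1r IH //.
rewrite big1 ?addr0 // => s s1; rewrite mul1g.
have [->|/wordprod_supp/(_ pw) h] := eqVneq (wordprod u w s^-1%g) 0; first by rewrite
    mulr0.
by rewrite row_coef ?(negPf s1) ?mul0r // -{1}h permKV.
Qed.

End Words.

(** * Jucys-Murphy eigenvectors *)

Section JucysMurphy.

Variables (n : nat) (K : fieldType).
Local Notation ga := (galg n K).
Implicit Types (p q r a b : 'I_n) (t : K) (w pre : seq 'I_n) (c u : 'I_n -> K).
Implicit Types (x y E : ga).

Definition jucys pre q : ga := \sum_(p <- pre) transp K p q.

(** The eigenvector conditions are recorded letter by letter, pre being the
    letters already read, so that they split along concatenations of words. *)
Fixpoint jmeigen c pre w x : Prop :=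
  if w is p :: w' then jucys pre p * x = c p *: x /\ jmeigen c (rcons pre p) w' x
  else True.

Lemma jmeigen_cat c pre w1 w2 x :
  jmeigen c pre (w1 ++ w2) x <-> jmeigen c pre w1 x /\ jmeigen c (pre ++ w1) w2 x.
Proof.
elim: w1 pre => [|p w IH] pre /=; first by rewrite cats0; split=> // -[].
rewrite IH cat_rcons; tauto.
Qed.

Lemma jmeigen_rcons c pre w q x :
  jmeigen c pre (rcons w q) x <->
  jmeigen c pre w x /\ jucys (pre ++ w) q * x = c q *: x.
Proof. by rewrite -cats1 jmeigen_cat /=; tauto. Qed.

Lemma eq_jucys pre pre' q : perm_eq pre pre' -> jucys pre q = jucys pre' q.
Proof. exact: perm_big. Qed.

Lemma jmeigen_perm c pre pre' w x :
  perm_eq pre pre' -> jmeigen c pre w x -> jmeigen c pre' w x.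
Proof.
elim: w pre pre' => [|p w IH] //= pre pre' e [h1 h2].
split; first by rewrite -(eq_jucys p e).
by apply: IH h2; rewrite -!cats1 perm_cat2r.
Qed.

Lemma jmeigen_mulr c pre w x y : jmeigen c pre w x -> jmeigen c pre w (x * y).
Proof.
elim: w pre => [|p w IH] //= pre [h1 h2]; split; last exact: IH.
by rewrite mulrA h1 -scalerAl.
Qed.

Lemma jmeigenZD c pre w k x y :
  jmeigen c pre w x -> jmeigen c pre w y -> jmeigen c pre w (x + k *: y).
Proof.
elim: w pre => [|p w IH] //= pre [h1 h2] [h3 h4]; split; last exact: IH.
by rewrite mulrDr h1 -scalerAr h3 scalerDr !scalerA mulrC.
Qed.

Lemma jmeigenZ c pre w k x : jmeigen c pre w x -> jmeigen c pre w (k *: x).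
Proof. by move=> h; rewrite -[x]mulr1 scalerAr; apply: jmeigen_mulr. Qed.

Lemma gelt_jucys (s : 'S_n) pre p :
  gelt K s * jucys pre p = jucys (map s pre) (s p) * gelt K s.
Proof.
rewrite mulr_sumr mulr_suml big_map; apply: eq_bigr => q _; exact: geltJ.
Qed.

Lemma perm_map_tperm a b pre : uniq pre -> (a \in pre) = (b \in pre) ->
  perm_eq (map (tperm a b) pre) pre.
Proof.
move=> up ab; apply: uniq_perm => //; first by rewrite map_inj_uniq //; apply: perm_inj.
move=> x; rewrite -{1}[x](tpermK a b) mem_map; last exact: perm_inj.
by case: tpermP => [->|->|].
Qed.

Lemma transp_jucys a b pre p : uniq pre -> (a \in pre) = (b \in pre) ->
  a != p -> b != p -> transp K a b * jucys pre p = jucys pre p * transp K a b.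
Proof.
move=> up ab ap bp; rewrite gelt_jucys tpermD //; congr (_ * _).
by apply: eq_jucys; apply: perm_map_tperm.
Qed.

Lemma jmeigen_transp c a b pre w x : uniq (pre ++ w) -> (a \in pre) = (b \in pre) ->
  a \notin w -> b \notin w -> jmeigen c pre w x -> jmeigen c pre w (transp K a b * x).
Proof.
elim: w pre => [|p w IH] //= pre up ab.
rewrite !inE !negb_or => /andP[ap aw] /andP[bp bw] [h1 h2]; split.
  rewrite mulrA -transp_jucys -?mulrA ?h1 -?scalerAr //.
  by move: up; rewrite cat_uniq => /andP[].
apply: IH => //; first by rewrite cat_rcons.
by rewrite !mem_rcons !inE (negPf ap) (negPf bp).
Qed.

Lemma jmeigen_factor c a b pre w k x : uniq (pre ++ w) -> (a \in pre) = (b \in pre) ->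
  a \notin w -> b \notin w -> jmeigen c pre w x -> jmeigen c pre w (factor a b k * x).
Proof.
move=> h1 h2 h3 h4 h5; rewrite mulrBl mul1r -scalerAl -scaleNr.
by apply: jmeigenZD => //; apply: jmeigen_transp.
Qed.

(** This is the intertwining relation of the degenerate affine Hecke algebra,
    whose polynomial generators act as the Jucys-Murphy elements. *)
Lemma jmeigen_swap c w1 a b w2 x : uniq (w1 ++ a :: b :: w2) -> c a != c b ->
  jmeigen c [::] (w1 ++ a :: b :: w2) x ->
  jmeigen c [::] (w1 ++ b :: a :: w2) (factor b a (c b - c a) * x).
Proof.
move=> uw cab /jmeigen_cat[h1] /= [h2] [h3] h4.
have d0 : c b - c a != 0 by rewrite subr_eq0 eq_sym.
have [uab [aw bw]] : uniq [:: a, b & w1 ++ w2] /\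
    a \notin w1 ++ w2 /\ b \notin w1 ++ w2.
  move: uw; rewrite -[X in w1 ++ X]/([:: a; b] ++ w2) uniq_catCA /= inE negb_or.
  by move=> /and3P[/andP[-> aw] bw ->]; rewrite aw bw.
move: aw bw; rewrite !mem_cat !negb_or => /andP[aw1 aw2] /andP[bw1 bw2].
have uw1 : uniq w1 by move: uw; rewrite cat_uniq => /andP[].
apply/jmeigen_cat; split.
  by apply: jmeigen_factor; rewrite // ?in_nil.
have smap : map (tperm a b) w1 = w1.
  rewrite -[RHS]map_id; apply/eq_in_map => q qw.
  by rewrite tpermD //; [apply: contraNneq aw1 | apply: contraNneq bw1] => ->.
have ys : jucys w1 b * transp K a b = transp K a b * jucys w1 a.
  by rewrite gelt_jucys tpermL smap.
have ys' : jucys w1 a * transp K a b = transp K a b * jucys w1 b.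
  by rewrite gelt_jucys tpermR smap.
have jmR p q : jucys (rcons w1 p) q = jucys w1 q + transp K p q.
  by rewrite /jucys -cats1 big_cat big_seq1.
have yb : jucys w1 b * x = c b *: x - transp K a b * x.
  by rewrite -h3 jmR mulrDl addrK.
rewrite /= jmR; split; [|split].
- rewrite /factor mulrBl mul1r -scalerAl mulrBr -scalerAr yb (transpC K b a).
  rewrite mulrA ys -mulrA h2 -scalerAr.
  by apply/ffunP => g; rewrite !(gaE, gaNE, gaZE); field.
- rewrite /factor mulrBl mul1r -scalerAl mulrBr -scalerAr mulrDl h2 (transpC K b a).
  rewrite mulrDl mulrA ys' -mulrA yb mulrBr -scalerAr !transpK.
  by apply/ffunP => g; rewrite !(gaE, gaNE, gaZE); field.
- apply: (@jmeigen_perm _ (rcons (rcons w1 a) b)).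
    by rewrite -!cats1 -!catA perm_cat2l /= (perm_catC [:: a] [:: b]).
  apply: jmeigen_factor => //; first by rewrite !cat_rcons.
  by rewrite !mem_rcons !inE !mem_rcons !inE !eqxx !orbT.
Qed.

(** Through star, the second condition concerns multiplication on the right. *)
Definition bieigen c w x := jmeigen c [::] w x /\ jmeigen c [::] w (star x).

Lemma bieigenZ c w k x : bieigen c w x -> bieigen c w (k *: x).
Proof. by move=> [h1 h2]; split; rewrite ?starZ; apply: jmeigenZ. Qed.

Lemma bieigen_swap c w1 a b w2 x : uniq (w1 ++ a :: b :: w2) -> c a != c b ->
  bieigen c (w1 ++ a :: b :: w2) x ->
  bieigen c (w1 ++ b :: a :: w2)
    (factor b a (c b - c a) * x * factor b a (c b - c a)).
Proof.
move=> uw cab [h1 h2]; split; first by apply: jmeigen_mulr; apply: jmeigen_swap.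
by rewrite !starM star_factor mulrA; apply: jmeigen_mulr; apply: jmeigen_swap.
Qed.

(** ** Adding a letter *)

(** Induction on the last letter r of w: conjugation by (r q) turns the column
    of q over the preceding letters into that of r, whose Jucys-Murphy element
    acts on x as the scalar c r. *)
Lemma column_jucys c w q t x : uniq (rcons w q) -> t != 0 ->
  {in w, forall p, t != c p} -> jmeigen c [::] w x ->
  (\prod_(p <- w) factor p q (t - c p)) * x = x - t^-1 *: (jucys w q * x).
Proof.
move=> + t0; elim/last_ind: w q => [|w r IH] q.
  by move=> _ _ _; rewrite /jucys !big_nil mul1r mul0r scaler0 subr0.
move=> uq gt /jmeigen_rcons[jw]; rewrite cat0s => jr.
have [rq [qw [rw uw]]] : r != q /\ q \notin w /\ r \notin w /\ uniq w.
  move: uq; rewrite !rcons_uniq mem_rcons inE negb_or eq_sym.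
  by case/and3P => /andP[].
have tr0 : t - c r != 0.
  by rewrite subr_eq0; apply: gt; rewrite mem_rcons inE eqxx.
have gw : {in w, forall p, t != c p}.
  by move=> p pw; apply: gt; rewrite mem_rcons inE pw orbT.
rewrite /jucys -cats1 !big_cat !big_seq1 /= -/(jucys w q).
rewrite -mulrA {2}/factor mulrBl mul1r mulrBr -scalerAl -scalerAr IH //; last first.
  by rewrite rcons_uniq qw.
have -> : (\prod_(p <- w) factor p q (t - c p)) * (transp K r q * x)
    = transp K r q * ((\prod_(p <- w) factor p r (t - c p)) * x).
  rewrite !mulrA; congr (_ * _).
  elim: w rw qw {IH uq jw jr gt uw gw} => [|p w IH].
    by move=> _ _; rewrite !big_nil mul1r mulr1.
  rewrite !inE !negb_or => /andP[rp rw] /andP[qp qw].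
  rewrite !big_cons -mulrA IH // !mulrA; congr (_ * _).
  rewrite /factor mulrBl mulrBr mul1r mulr1 -scalerAl -scalerAr; congr (_ - _ *: _).
  by rewrite [RHS]transpJ tpermL tpermD // eq_sym.
rewrite IH //; last by rewrite rcons_uniq rw.
rewrite jr mulrBr mulrDl -!scalerAr !scalerA.
apply/ffunP => g; rewrite !(gaE, gaNE, gaZE).
by field; rewrite t0 tr0.
Qed.

Lemma column_inv c w q t : {in w, forall p, t != c p} ->
  (\prod_(p <- w) factor p q (t - c p)) * column c (rev w) q t
  = (\prod_(p <- w) (1 - (t - c p) ^- 2)) *: 1 :> ga.
Proof.
elim: w => [|p w IH] gt; first by rewrite /column !big_nil mulr1 scale1r.
have tp : t - c p != 0 by rewrite subr_eq0 gt // inE eqxx.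
rewrite !big_cons rev_cons column_rcons mulrA -(mulrA (factor _ _ _)) IH; last first.
  by move=> r rw; apply: gt; rewrite inE rw orbT.
have := factor_inv p q tp; rewrite opprB {2}/factor (transpC K q p) -/(factor p q (c
    p - t)) => fi.
by rewrite -scalerAr mulr1 -scalerAl fi scalerA mulrC.
Qed.

(** The column of q is inverted, up to a scalar, by the opposite column, which
    by the previous lemmas acts as a linear function of the Jucys-Murphy element
    of q: this element acts as t on the extended product, up to a multiple of E. *)
Lemma jucys_column c w q t E : uniq (rcons w q) -> t != 0 ->
  {in w, forall p, t != c p} -> jmeigen c [::] w E ->
  E * column c w q t = column c (rev w) q t * E ->
  E * column c w q t - t^-1 *: (jucys w q * (E * column c w q t))
  = (\prod_(p <- w) (1 - (t - c p) ^- 2)) *: E.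
Proof.
move=> uq t0 gt jE cE.
rewrite -(@column_jucys c w q t) //; last exact: jmeigen_mulr.
by rewrite cE mulrA column_inv // -scalerAl mul1r.
Qed.

(** ** Fused factors *)

(** The pole x0 = 0 cancels: (p q) (r q) = (p r) (p q), and E absorbs (p r) as
    the scalar e. *)
Lemma link_factor p r q (x0 e : K) E : p != r -> p != q -> r != q ->
  E * transp K p r = e *: E -> e ^+ 2 = 1 -> x0 != 0 -> x0 + e != 0 ->
  E * (factor p q x0 * factor r q (x0 + e))
  = E * (1 - (x0 + e)^-1 *: (transp K p q + transp K r q)).
Proof.
move=> pr pq rq Er e2 x00 xe0; rewrite factor_mul.
have -> : transp K p q * transp K r q = transp K p r * transp K p q.
  by rewrite transpJ tpermR tpermD // 1?eq_sym // transpC.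
rewrite !(mulrDr, mulrN, mulr1) -!scalerAr !mulrDr mulrA Er -scalerAl scalerA.
apply/ffunP => g; rewrite !(gaE, gaNE, gaZE).
by field; rewrite x00 xe0.
Qed.

(** The column of q in which each factor that is singular when all variables
    agree is fused with the next one, which removes its pole. The default value
    1 stands for a singular last letter. *)
Fixpoint fused c u w q t : ga :=
  if w is p :: w' then
    if c p == c q then
      if w' is r :: w'' then
        (1 - (u r - t)^-1 *: (transp K p q + transp K r q)) * fused c u w'' q t
      else 1
    else factor p q (u p - t) * fused c u w' q t
  else 1.

(** Follows the recursion of the fused column. *)
Fixpoint linked (L : 'I_n -> 'I_n -> Prop) c w q : Prop :=
  if w is p :: w' then
    if c p == c q then
      if w' is r :: w'' then L p r /\ linked L c w'' q else False
    else linked L c w' q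
  else True.

Lemma linkedW (L L' : 'I_n -> 'I_n -> Prop) c w q :
  (forall p r, p \in w -> r \in w -> L p r -> L' p r) ->
  linked L c w q -> linked L' c w q.
Proof.
move: {2}(size w) (leqnn (size w)) => k; elim: k w => [|k IH] [|p [|r w]] //= sw LL.
have lw (w' : seq 'I_n) : {subset w' <= [:: p, r & w]} ->
    forall a b, a \in w' -> b \in w' -> L a b -> L' a b.
  by move=> sw' a b /sw' aw /sw' bw; apply: LL.
case: ifP => _.
  case=> h1 h2; split; first by apply: LL h1; rewrite !inE eqxx ?orbT.
  apply: IH h2; first by apply: ltnW.
  by apply: lw => a aw; rewrite !inE aw !orbT.
apply: (IH (r :: w)) => //; apply: lw => a aw; by rewrite inE aw orbT.
Qed.

(** The factors of a column commute with the transpositions of two later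
    letters, so that E remains an eigenvector of these while it is multiplied
    by the successive factors. *)
Lemma column_fused c u w q t E : uniq (rcons w q) ->
  {in w, forall p, u p != t} ->
  linked (fun p r => (u r - u p) ^+ 2 = 1 /\ E * transp K p r = (u r - u p) *: E)
    c w q ->
  E * column u w q t = E * fused c u w q t.
Proof.
move: {2}(size w) (leqnn (size w)) => k; elim: k w E => [|k IH] [|p w] E //=.
- by rewrite /column big_nil.
- by rewrite /column big_nil.
rewrite ltnS => sw /andP[pw uw] gt; rewrite column_cons; case: ifP => [/eqP cpq|_].
  case: w pw uw sw gt => [//|r w] /= prq /andP[rw uw] sw gt [[e2 Er] lw].
  move: prq rw; rewrite !inE !mem_rcons !inE !negb_or.
  move=> /and3P[pr pq pw] /andP[rq rw].
  rewrite column_cons; set e := u r - u p in e2 Er.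
  have ue : u r - t = u p - t + e by rewrite /e [RHS]addrC addrA subrK.
  transitivity (E * (factor p q (u p - t) * factor r q (u p - t + e)) * column u w q t).
    by rewrite -ue !mulrA.
  rewrite ue (link_factor pr pq rq Er) //; first last.
  - by rewrite -ue subr_eq0; apply: gt; rewrite !inE eqxx orbT.
  - by rewrite subr_eq0; apply: gt; rewrite !inE eqxx.
  rewrite [RHS]mulrA; apply: IH => //.
  - exact: ltnW.
  - by move=> a aw; apply: gt; rewrite !inE aw !orbT.
  apply: linkedW lw => a b aw bw [-> Eab]; split=> //.
  rewrite -mulrA.
  have nab z : z \notin w -> (a != z) && (b != z).
    by move=> zw; apply/andP; split; [apply: contraNneq zw => <- | apply: contraNneq
        zw => <-].
  have qw : q \notin w by move: uw; rewrite rcons_uniq => /andP[].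
  have /andP[ap bp] := nab p pw; have /andP[ar br] := nab r rw.
  have /andP[aq bq] := nab q qw.
  have -> : (1 - (u p - t + e)^-1 *: (transp K p q + transp K r q)) * transp K a b
     = transp K a b * (1 - (u p - t + e)^-1 *: (transp K p q + transp K r q)).
    rewrite mulrBl mulrBr mul1r mulr1 -scalerAl -scalerAr mulrDl mulrDr.
    by rewrite (transp_comm _ ap aq bp bq) (transp_comm _ ar aq br bq).
  by rewrite mulrA Eab -scalerAl.
move=> lw; rewrite !mulrA; apply: IH => //.
  by move=> a aw; apply: gt; rewrite inE aw orbT.
apply: linkedW lw => a b aw bw [-> Eab]; split=> //.
have pq : p != q by apply: contraNneq pw => ->; rewrite mem_rcons inE eqxx.
have {}pw : p \notin w by move: pw; rewrite mem_rcons inE negb_or => /andP[].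
have qw : q \notin w by move: uw; rewrite rcons_uniq => /andP[].
rewrite -mulrA.
have -> : factor p q (u p - t) * transp K a b = transp K a b * factor p q (u p - t).
  rewrite /factor mulrBl mulrBr mul1r mulr1 -scalerAl -scalerAr; congr (_ - _ *: _).
  by apply: transp_comm; [apply: contraNneq pw | apply: contraNneq pw | apply:
      contraNneq qw | apply: contraNneq qw] => ->.
by rewrite mulrA Eab -scalerAl.
Qed.

End JucysMurphy.

(** * Regular functions and their generic restrictions *)

Section Regular.

Variables (n : nat) (K : numFieldType).
Local Notation ga := (galg n K).
Implicit Types (P b d : {mpoly K[n]}) (z : 'I_n -> K).
Implicit Types (H : ('I_n -> K) -> Prop) (phi psi : ('I_n -> K) -> K).

Definition line z z' (s : K) : 'I_n -> K := fun p => (1 - s) * z p + s * z' p.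

Lemma eq_meval z z' P : z =1 z' -> P.@[z] = P.@[z'].
Proof. exact: meval_eq. Qed.

Lemma line0 z z' P : P.@[line z z' 0] = P.@[z].
Proof. by apply: eq_meval => p; rewrite /line subr0 mul1r mul0r addr0. Qed.

Lemma line1 z z' P : P.@[line z z' 1] = P.@[z'].
Proof. by apply: eq_meval => p; rewrite /line subrr mul1r mul0r add0r. Qed.

Lemma line_poly z z' P : exists f : {poly K}, forall s, f.[s] = P.@[line z z' s].
Proof.
exists (\sum_(m <- msupp P) (P@_m)%:P *
  \prod_i ((1 - 'X) * (z i)%:P + 'X * (z' i)%:P) ^+ m i) => s.
rewrite horner_sum mevalE; apply: eq_bigr => m _.
rewrite hornerM hornerC horner_prod; congr (_ * _); apply: eq_bigr => i _.
by rewrite horner_exp !hornerE.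
Qed.

Lemma poly_nonroot (f : {poly K}) : f != 0 -> exists s, f.[s] != 0.
Proof.
move=> f0; pose rs : seq K := [seq i%:R | i <- iota 0 (size f)].
have urs : uniq rs by rewrite map_inj_uniq ?iota_uniq //; apply: mulrIn; rewrite
    oner_neq0.
have [/(max_poly_roots f0)/(_ urs)|/allPn[s _ fs]] := boolP (all (root f) rs).
  by rewrite size_map size_iota ltnn.
by exists s.
Qed.

(** ** Generic properties on an affine subspace *)

Definition affine H := forall z z' s, H z -> H z' -> H (line z z' s).

Definition generically H (Q : ('I_n -> K) -> Prop) := exists b,
  (exists2 z, H z & b.@[z] != 0) /\ forall z, H z -> b.@[z] != 0 -> Q z.

Lemma generically_mono H (Q Q' : ('I_n -> K) -> Prop) :
  (forall z, H z -> Q z -> Q' z) -> generically H Q -> generically H Q'.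
Proof. by move=> QQ [b [bn bQ]]; exists b; split=> // z Hz /(bQ z Hz); apply: QQ. Qed.

Lemma generically_nz H b : (exists2 z, H z & b.@[z] != 0) -> generically H (fun z =>
    b.@[z] != 0).
Proof. by exists b. Qed.

(** Neither polynomial vanishes on the line joining the two points. *)
Lemma nonvanishingM H b b' : affine H ->
  (exists2 z, H z & b.@[z] != 0) -> (exists2 z, H z & b'.@[z] != 0) ->
  exists2 z, H z & (b * b').@[z] != 0.
Proof.
move=> aH [z Hz bz] [z' Hz' bz'].
have [f fE] := line_poly z z' b; have [f' fE'] := line_poly z z' b'.
have f0 : f != 0.
  by apply: contraNneq bz => f0; rewrite -(line0 z z') -fE f0 horner0.
have f0' : f' != 0.
  by apply: contraNneq bz' => f0'; rewrite -(line1 z z') -fE' f0' horner0.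
have [s fs] := poly_nonroot (mulf_neq0 f0 f0').
by exists (line z z' s); rewrite ?mevalM -?fE -?fE' -?hornerM //; apply: aH.
Qed.

Lemma generically_and H (Q Q' : ('I_n -> K) -> Prop) : affine H ->
  generically H Q -> generically H Q' -> generically H (fun z => Q z /\ Q' z).
Proof.
move=> aH [b [bn bQ]] [b' [bn' bQ']]; exists (b * b').
split=> [|z Hz]; first exact: nonvanishingM.
by rewrite mevalM mulf_eq0 negb_or => /andP[/(bQ z Hz) ? /(bQ' z Hz)].
Qed.

Lemma generically_all H z0 (I : eqType) (l : seq I) (Q : I -> ('I_n -> K) -> Prop) :
  affine H -> H z0 -> (forall i, i \in l -> generically H (Q i)) ->
  generically H (fun z => forall i, i \in l -> Q i z).
Proof.
move=> aH H0; elim: l => [|i l IH] g.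
  by exists 1; split=> //; exists z0; rewrite ?meval1 ?oner_neq0.
apply: (@generically_mono _ (fun z => Q i z /\ forall j, j \in l -> Q j z)).
  by move=> z _ [Qi Ql] j; rewrite inE => /orP[/eqP->|] //; apply: Ql.
apply: generically_and => //; first by apply: g; rewrite inE eqxx.
by apply: IH => j jl; apply: g; rewrite inE jl orbT.
Qed.

(** On the line from any point of H to a point where b does not vanish, P
    vanishes for all but finitely many parameters. *)
Lemma generically_eq0 H P : affine H -> generically H (fun z => P.@[z] = 0) ->
  forall z, H z -> P.@[z] = 0.
Proof.
move=> aH [b [[z1 Hz1 bz1] bP]] z Hz.
have [f fE] := line_poly z z1 b; have [g gE] := line_poly z z1 P.
have f0 : f != 0.
  by apply: contraNneq bz1 => f0; rewrite -(line1 z z1) -fE f0 horner0.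
have g0 : g = 0.
  apply/eqP; apply: contraT => g0.
  have [s] := poly_nonroot (mulf_neq0 f0 g0).
  rewrite hornerM fE gE mulf_eq0 negb_or => /andP[bs].
  by rewrite bP ?eqxx //; apply: aH.
by rewrite -(line0 z z1) -gE g0 horner0.
Qed.

(** ** Regular functions *)

(** The values of phi on the zero set of the denominator are arbitrary: they
    come from the convention for the inverse of 0. *)
Definition reg z0 phi := exists c d, d.@[z0] != 0 /\
  forall z, d.@[z] != 0 -> phi z = c.@[z] / d.@[z].

Lemma reg_cst z0 k : reg z0 (fun=> k).
Proof.
exists k%:MP, 1; rewrite meval1 oner_neq0; split=> // z _.
by rewrite mevalC meval1 divr1.
Qed.

Lemma reg_proj z0 p : reg z0 (fun z => z p).
Proof.
exists 'X_p, 1; rewrite meval1 oner_neq0; split=> // z _.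
by rewrite mevalXU meval1 divr1.
Qed.

Lemma regD z0 phi psi : reg z0 phi -> reg z0 psi ->
  reg z0 (fun z => phi z + psi z).
Proof.
move=> [c [d [d0 h]]] [c' [d' [d0' h']]]; exists (c * d' + c' * d), (d * d').
rewrite mevalM mulf_neq0 //; split=> // z.
rewrite mevalM mulf_eq0 negb_or => /andP[dz dz'].
by rewrite h // h' // mevalD !mevalM addf_div.
Qed.

Lemma regM z0 phi psi : reg z0 phi -> reg z0 psi ->
  reg z0 (fun z => phi z * psi z).
Proof.
move=> [c [d [d0 h]]] [c' [d' [d0' h']]]; exists (c * c'), (d * d').
rewrite mevalM mulf_neq0 //; split=> // z.
rewrite mevalM mulf_eq0 negb_or => /andP[dz dz'].
by rewrite h // h' // !mevalM mulf_div.
Qed.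

Lemma regN z0 phi : reg z0 phi -> reg z0 (fun z => - phi z).
Proof.
move=> [c [d [d0 h]]]; exists (- c), d; split=> // z dz.
by rewrite h // mevalN mulNr.
Qed.

Lemma regB z0 phi psi : reg z0 phi -> reg z0 psi ->
  reg z0 (fun z => phi z - psi z).
Proof. by move=> h1 h2; apply: regD => //; apply: regN. Qed.

Lemma regV z0 phi : reg z0 phi -> phi z0 != 0 -> reg z0 (fun z => (phi z)^-1).
Proof.
move=> [c [d [d0 h]]] p0; have c0 : c.@[z0] != 0.
  by apply: contraNneq p0 => c0; rewrite h // c0 mul0r.
exists (d * d), (c * d); rewrite mevalM mulf_neq0 //; split=> // z.
rewrite !mevalM mulf_eq0 negb_or => /andP[cz dz].
by rewrite h // invf_div -mulf_div divff ?mulr1.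
Qed.

Lemma reg_sum z0 (I : Type) (l : seq I) (F : I -> ('I_n -> K) -> K) :
  (forall i, reg z0 (F i)) -> reg z0 (fun z => \sum_(i <- l) F i z).
Proof.
move=> h; elim: l => [|i l [c [d [d0 e]]]].
  have [c [d [d0 e]]] := reg_cst z0 0; exists c, d; split=> // z dz.
  by rewrite big_nil; apply: e.
have [||c' [d' [d0' e']]] := @regD z0 (F i) (fun z => \sum_(i <- l) F i z) => //.
  by exists c, d.
by exists c', d'; split=> // z dz; rewrite big_cons; apply: e'.
Qed.

Definition rega z0 (Phi : ('I_n -> K) -> ga) := forall s, reg z0 (fun z => Phi z s).

Lemma eq_reg z0 phi psi : phi =1 psi -> reg z0 phi -> reg z0 psi.
Proof. by move=> e [c [d [d0 h]]]; exists c, d; split=> // z /h; rewrite e. Qed.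

Lemma rega_cst z0 (E : ga) : rega z0 (fun=> E).
Proof. by move=> s; apply: reg_cst. Qed.

Lemma regaD z0 Phi Psi : rega z0 Phi -> rega z0 Psi ->
  rega z0 (fun z => Phi z + Psi z).
Proof.
move=> h h' s; apply: eq_reg (regD (h s) (h' s)) => z.
by rewrite gaE.
Qed.

Lemma regaZ z0 phi Phi : reg z0 phi -> rega z0 Phi ->
  rega z0 (fun z => phi z *: Phi z).
Proof.
by move=> h h' s; apply: eq_reg (regM h (h' s)) => z; rewrite gaZE.
Qed.

Lemma regaN z0 Phi : rega z0 Phi -> rega z0 (fun z => - Phi z).
Proof. by move=> h s; apply: eq_reg (regN (h s)) => z; rewrite gaNE. Qed.

Lemma regaM z0 Phi Psi : rega z0 Phi -> rega z0 Psi ->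
  rega z0 (fun z => Phi z * Psi z).
Proof.
move=> h h' s; apply: (@eq_reg _ (fun z => \sum_x Phi z x * Psi z (s * x^-1)%g)).
  by move=> z; rewrite gaME.
by apply: reg_sum => x; apply: regM.
Qed.

Lemma rega_star z0 Phi : rega z0 Phi -> rega z0 (fun z => star (Phi z)).
Proof. by move=> h s; apply: eq_reg (h s^-1%g) => z; rewrite ffunE. Qed.

Lemma rega_prod z0 (I : eqType) (l : seq I) (F : I -> ('I_n -> K) -> ga) :
  (forall i, i \in l -> rega z0 (F i)) ->
  rega z0 (fun z => \prod_(i <- l) F i z).
Proof.
elim: l => [|i l IH] h s.
  by apply: eq_reg (rega_cst z0 1 s) => z; rewrite big_nil.
apply: (@eq_reg _ (fun z => (F i z * \prod_(i <- l) F i z) s)).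
  by move=> z; rewrite big_cons.
apply: regaM; first by apply: h; rewrite inE eqxx.
by apply: IH => j jl; apply: h; rewrite inE jl orbT.
Qed.

Lemma rega_factor z0 p q phi : reg z0 phi -> phi z0 != 0 ->
  rega z0 (fun z => factor p q (phi z)).
Proof.
move=> h p0; apply: regaD; first exact: rega_cst.
by apply: regaN; apply: regaZ; [apply: regV | apply: rega_cst].
Qed.

(** ** Limits *)

(** E is the value of a regular function which agrees generically with Phi on
    H; the value of Phi itself at z0 is meaningless when z0 lies on a pole. *)
Definition lim H z0 (Phi : ('I_n -> K) -> ga) (E : ga) := exists Psi,
  [/\ rega z0 Psi, Psi z0 = E & generically H (fun z => Phi z = Psi z)].

Section Limits.

Variables (H : ('I_n -> K) -> Prop) (z0 : 'I_n -> K).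
Hypotheses (aH : affine H) (H0 : H z0).
Implicit Types (Phi Psi : ('I_n -> K) -> ga) (E : ga).

Lemma generically_true (Q : ('I_n -> K) -> Prop) : (forall z, Q z) -> generically H Q.
Proof. by exists 1; split=> //; exists z0; rewrite ?meval1 ?oner_neq0. Qed.

Lemma lim_uniq Phi Psi E E' : lim H z0 Phi E -> lim H z0 Psi E' ->
  generically H (fun z => Phi z = Psi z) -> E = E'.
Proof.
move=> [A [rA <- gA]] [B [rB <- gB]] g.
apply/ffunP => s; have [c [d [d0 h]]] := rA s; have [c' [d' [d0' h']]] := rB s.
rewrite h // h' //; apply/eqP; rewrite eqr_div // -subr_eq0.
rewrite -!mevalM -mevalB; apply/eqP; apply: generically_eq0 H0 => //.
have gd0 : generically H (fun z => d.@[z] != 0) by apply: generically_nz; exists z0.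
have gd0' : generically H (fun z => d'.@[z] != 0) by apply: generically_nz; exists z0.
have G := generically_and aH (generically_and aH gd0 gd0') (generically_and aH
    (generically_and aH gA gB) g).
apply: generically_mono G => z _ [[dz dz'] [[eA eB] e]].
rewrite mevalB !mevalM; apply/eqP; rewrite subr_eq0 -eqr_div //.
by rewrite -h // -h' // -eA -eB e.
Qed.

Lemma lim_rega Phi : rega z0 Phi -> lim H z0 Phi (Phi z0).
Proof. by move=> r; exists Phi; split=> //; apply: generically_true. Qed.

Lemma lim_cst E : lim H z0 (fun=> E) E.
Proof. exact: (lim_rega (rega_cst z0 E)). Qed.

Lemma lim_eq Phi Psi E : generically H (fun z => Phi z = Psi z) ->
  lim H z0 Phi E -> lim H z0 Psi E.
Proof.
move=> g [A [rA eA gA]]; exists A; split=> //.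
by apply: generically_mono (generically_and aH g gA) => z _ [<-].
Qed.

Lemma limM Phi Psi E E' : lim H z0 Phi E -> lim H z0 Psi E' ->
  lim H z0 (fun z => Phi z * Psi z) (E * E').
Proof.
move=> [A [rA <- gA]] [B [rB <- gB]]; exists (fun z => A z * B z).
by split=> //; [apply: regaM | apply: generically_mono (generically_and aH gA gB) =>
    z _ [-> ->]].
Qed.

Lemma limD Phi Psi E E' : lim H z0 Phi E -> lim H z0 Psi E' ->
  lim H z0 (fun z => Phi z + Psi z) (E + E').
Proof.
move=> [A [rA <- gA]] [B [rB <- gB]]; exists (fun z => A z + B z).
by split=> //; [apply: regaD | apply: generically_mono (generically_and aH gA gB) =>
    z _ [-> ->]].
Qed.

Lemma limZ phi Phi E : reg z0 phi -> lim H z0 Phi E ->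
  lim H z0 (fun z => phi z *: Phi z) (phi z0 *: E).
Proof.
move=> rp [A [rA <- gA]]; exists (fun z => phi z *: A z).
by split=> //; [apply: regaZ | apply: generically_mono gA => z _ ->].
Qed.

Lemma lim_star Phi E : lim H z0 Phi E -> lim H z0 (fun z => star (Phi z)) (star E).
Proof.
move=> [A [rA <- gA]]; exists (fun z => star (A z)).
by split=> //; [apply: rega_star | apply: generically_mono gA => z _ ->].
Qed.

End Limits.

End Regular.

(** * Words compatible with a tableau *)

Lemma enum_pairwise (n : nat) : pairwise (fun a b : 'I_n => (a < b)%N) (enum 'I_n).
Proof.
by rewrite -(pairwise_map (val : 'I_n -> nat) ltn) val_enum_ord -sorted_pairwise
  ?iota_ltn_sorted //; apply: ltn_trans.
Qed.

Section TableauWords.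

Variables (n : nat) (T : 'I_n -> nat * nat).
Implicit Types (p q r a b : 'I_n) (w : seq 'I_n).

Definition below a b := ((T a).1 <= (T b).1)%N && ((T a).2 <= (T b).2)%N.

(** The consequences of standardness in terms of the order of the boxes, in
    which two boxes are compared by both their rows and their columns. *)
Definition young_filling :=
  [/\ injective T,
      forall p i j, (i <= (T p).1)%N -> (j <= (T p).2)%N -> exists q, T q = (i, j)
    & forall a b, below a b -> (a <= b)%N].

Lemma standard_young_filling lam : is_partition n lam ->
  standard_tableau lam T -> young_filling.
Proof.
move=> /and3P[slam _ _] [injT imT rowT colT].
have diagW i j i' j' : (i <= i')%N -> (j <= j')%N ->
    diagram lam (i', j') -> diagram lam (i, j).
  rewrite /diagram /= => ii jj h; apply: leq_ltn_trans jj _.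
  have [i'l|li'] := ltnP i' (size lam); last by rewrite nth_default in h.
  apply: (leq_trans h).
  have gt : transitive geq by move=> x y z /= h1 h2; apply: leq_trans h2 h1.
  by apply: (sorted_leq_nth gt leqnn 0%N slam i i'); rewrite ?inE ?(leq_ltn_trans ii).
have low p i j : (i <= (T p).1)%N -> (j <= (T p).2)%N -> exists q, T q = (i, j).
  move=> ip jp; apply/imT; apply: diagW ip jp _.
  by rewrite -surjective_pairing; apply/imT; exists p.
split=> // a b /andP[h1 h2].
have [c Tc] := low b (T a).1 (T b).2 h1 (leqnn _).
have ac : (a <= c)%N.
  move: h2; rewrite leq_eqVlt => /orP[/eqP e|lt]; last first.
    by apply: ltnW; apply: rowT; rewrite Tc.
  by rewrite (injT a c) // Tc -e -surjective_pairing.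
apply: leq_trans ac _; move: h1; rewrite leq_eqVlt => /orP[/eqP e|lt]; last first.
  by apply: ltnW; apply: colT; rewrite Tc.
by rewrite (injT c b) // Tc e -surjective_pairing.
Qed.

(** The subsequences of the linear extensions of the order of the boxes. *)
Definition std w := pairwise (fun a b => ~~ below b a) w.

(** Bubble sort: x travels to the front through letters incomparable to it. *)
Lemma std_connect (P : seq 'I_n -> Prop) :
  (forall w1 a b w2, ~~ below a b -> ~~ below b a ->
     P (w1 ++ a :: b :: w2) -> P (w1 ++ b :: a :: w2)) ->
  forall w w', std w -> std w' -> perm_eq w w' -> P w -> P w'.
Proof.
move=> hP w w'; elim: w' w P hP => [|x w' IH] w P hP sw sw' e Pw.
  by move: e Pw => /perm_nilP ->.
have xw : x \in w by rewrite (perm_mem e) inE eqxx.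
case/splitPr: xw sw e Pw => w1 w3 sw e Pw.
have e' : perm_eq (w1 ++ w3) w'.
  rewrite -(perm_cons x); apply: perm_trans e.
  exact: (permEl (perm_catCA [:: x] w1 w3)).
move: sw; rewrite /std pairwise_cat /= allrel_consr.
move=> /and3P[/andP[xw1 w13] sw1 /andP[_ sw3]].
have /andP[xw' {}sw'] : all (fun b => ~~ below b x) w' && std w' by [].
have Px : P (x :: w1 ++ w3).
  have : all (fun a => ~~ below a x && ~~ below x a) w1.
    apply/allP => y yw; rewrite (allP xw1) // andbT (allP xw') //.
    by rewrite -(perm_mem e') mem_cat yw.
  elim/last_ind: w1 w3 Pw {e e' xw1 w13 sw1 sw3} => [|w1 y IHw] w3 //.
  rewrite all_rcons cat_rcons => Pw /andP[/andP[h1 h2] hw].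
  by rewrite cat_rcons; apply: IHw => //; apply: hP.
apply: (IH (w1 ++ w3) (fun w => P (x :: w))) => //.
  by move=> v1 a b v2 h1 h2 Pv; apply: (hP (x :: v1)).
by rewrite /std pairwise_cat w13 sw1.
Qed.

(** ** Words sorted by a key *)

Section SortedWords.

Variable (key : 'I_n -> nat).
Hypotheses (ikey : injective key)
  (mkey : forall a b, below a b -> (key a <= key b)%N).

Definition word := sort (relpre key leq) (enum 'I_n).

Lemma word_perm : perm_eq word (enum 'I_n).
Proof. by rewrite perm_sort. Qed.

Lemma word_uniq : uniq word.
Proof. by rewrite sort_uniq enum_uniq. Qed.

Lemma mem_word p : p \in word.
Proof. by rewrite mem_sort mem_enum. Qed.

Lemma word_pairwise : pairwise (fun a b => (key a < key b)%N) word.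
Proof.
have h : pairwise (relpre key leq) word.
  rewrite -sorted_pairwise; last by move=> a b c; apply: leq_trans.
  by apply: sort_sorted => a b; apply: leq_total.
have := word_uniq; rewrite uniq_pairwise => h'.
have : pairwise [rel x y | relpre key leq x y && (x != y)] word.
  by rewrite pairwise_relI h h'.
apply: sub_pairwise => a b /= /andP[kab ab].
by rewrite ltn_neqAle kab andbT; apply: contra ab => /eqP/ikey ->.
Qed.

Lemma word_std : std word.
Proof.
apply: sub_pairwise word_pairwise => a b kab.
by apply: contraL kab => /mkey; rewrite -leqNgt.
Qed.

Lemma word_lt w1 p w2 q : word = w1 ++ p :: w2 -> q \in w2 -> (key p < key q)%N.
Proof.
move=> e qw; have := word_pairwise; rewrite e pairwise_cat /=.
by move=> /and4P[_ _ /allP h _]; apply: h.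
Qed.

Lemma word_next w1 p w2 r : word = w1 ++ p :: w2 -> key r = (key p).+1 ->
  exists w3, w2 = r :: w3.
Proof.
move=> e kr; have := mem_word r; rewrite e mem_cat inE.
have := word_pairwise; rewrite e pairwise_cat /= allrel_consr.
move=> /and4P[/andP[h1 _] _ h2 h3].
case/or3P => [/(allP h1)|/eqP rp|rw2].
- by rewrite kr ltnNge leqnSn.
- by move: kr; rewrite rp => /n_Sn.
case: w2 rw2 h2 h3 {e h1} => [//|s w3] + /= /andP[ps _] /andP[sw _].
rewrite inE => /orP[/eqP->|/(allP sw)]; first by exists w3.
by rewrite kr ltnS leqNgt ps.
Qed.

End SortedWords.

Lemma enum_std : young_filling -> std (enum 'I_n).
Proof.
move=> [_ _ mono]; have := enum_pairwise n.
by apply: sub_pairwise => a b ab; apply: contraL ab => /mono; rewrite -leqNgt.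
Qed.

(** ** Reading orders *)

Definition width := (\sum_p ((T p).1 + (T p).2)).+1.

Lemma box_bound p : ((T p).1 < width)%N /\ ((T p).2 < width)%N.
Proof.
have : ((T p).1 + (T p).2 <= \sum_p ((T p).1 + (T p).2))%N.
  by rewrite (bigD1 p) //= leq_addr.
by rewrite /width; split; lia.
Qed.

Definition rowkey p := ((T p).1 * width + (T p).2)%N.

Definition hook p := minn (T p).1 (T p).2.

(** Hook by hook, the corner and the arm of a hook before its leg. *)
Definition hookkey p := (hook p * (2 * width) +
  (if (T p).1 <= (T p).2 then (T p).2 else width + (T p).1))%N.

Hypothesis YT : young_filling.
Let injT : injective T. Proof. by case: YT. Qed.

Lemma muln_add_inj N i j i' j' : (j < N)%N -> (j' < N)%N ->
  (i * N + j = i' * N + j')%N -> i = i' /\ j = j'.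
Proof.
move=> jN jN' e; have N0 : (0 < N)%N by apply: leq_ltn_trans jN.
have ii : i = i'.
  by have := congr1 (divn^~ N) e; rewrite !divnMDl // !divn_small // !addn0.
by split=> //; move: e; rewrite ii => /addnI.
Qed.

Lemma T_inj p q : (T p).1 = (T q).1 -> (T p).2 = (T q).2 -> p = q.
Proof.
by move=> e1 e2; apply: injT; rewrite [LHS]surjective_pairing e1 e2 -surjective_pairing.
Qed.

Lemma rowkey_inj : injective rowkey.
Proof.
move=> p q; have [p1 p2] := box_bound p; have [q1 q2] := box_bound q.
by move=> /(muln_add_inj p2 q2)[]; apply: T_inj.
Qed.

Lemma hookkey_inj : injective hookkey.
Proof.
move=> p q; have [p1 p2] := box_bound p; have [q1 q2] := box_bound q.
move=> /muln_add_inj[||h]; [by case: ifP; lia | by case: ifP; lia|].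
by rewrite /hook in h; case: ifP; case: ifP => ? ? ?; apply: T_inj; lia.
Qed.

Lemma rowkey_mono a b : below a b -> (rowkey a <= rowkey b)%N.
Proof. by move=> /andP[h1 h2]; rewrite leq_add // leq_mul. Qed.

Lemma hookkey_mono a b : below a b -> (hookkey a <= hookkey b)%N.
Proof.
move=> /andP[h1 h2].
have [p1 p2] := box_bound a; have [q1 q2] := box_bound b.
have : (hook a <= hook b)%N by rewrite /hook; lia.
rewrite leq_eqVlt => /orP[/eqP e|lt].
  by rewrite /hookkey e leq_add2l; move: e; rewrite /hook; case: ifP; case: ifP; lia.
have : (hook a * (2 * width) + 2 * width <= hook b * (2 * width))%N.
  by rewrite -mulSnr leq_mul2r lt orbT.
by rewrite /hookkey; case: ifP => _; lia.
Qed.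

Lemma row_next p r : (T r).1 = (T p).1 -> (T r).2 = (T p).2.+1 ->
  rowkey r = (rowkey p).+1.
Proof. by rewrite /rowkey => -> ->; rewrite addnS. Qed.

(** ** Hook links *)

Definition hook_word := word hookkey.

(** A later letter q on the diagonal of p lies to the lower right of p, and
    therefore the arm or the leg of the hook of p continues beyond p. *)
Lemma hook_next w1 p w2 q : hook_word = w1 ++ p :: w2 -> q \in w2 ->
  content (T p) = content (T q) ->
  exists r w3, [/\ w2 = r :: w3, hook r = hook p &
    content (T r) = content (T p) + 1 \/ content (T r) = content (T p) - 1].
Proof.
move=> e qw cpq; have lt := word_lt hookkey_inj e qw.
have pq : ((T p).1 < (T q).1)%N && ((T p).2 < (T q).2)%N.
  have [p1 p2] := box_bound p; have [q1 q2] := box_bound q.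
  have : ~~ ((T q).1 <= (T p).1)%N.
    apply: contraL lt => h; rewrite -leqNgt; apply: hookkey_mono; rewrite /below h /=.
    by move: cpq; rewrite /content; lia.
  by move: cpq; rewrite /content; lia.
have [_ low _] := YT.
have [le|gt] := leqP (T p).1 (T p).2.
  have [||r Tr] := low q (T p).1 (T p).2.+1; try lia.
  have [|w3 ->] := word_next hookkey_inj e (r := r).
    rewrite /hookkey /hook Tr /= le (leqW le) addnS.
    by congr (_ * _ + _).+1; lia.
  exists r, w3; rewrite /hook /content Tr /=; split=> //; first lia.
  by left; lia.
have [||r Tr] := low q (T p).1.+1 (T p).2; try lia.
have [|w3 ->] := word_next hookkey_inj e (r := r).
  have f1 : ((T p).1 < (T p).2)%N = false by lia.
  have f2 : ((T p).1 <= (T p).2)%N = false by lia.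
  have m1 : minn (T p).1.+1 (T p).2 = minn (T p).1 (T p).2 by lia.
  by rewrite /hookkey /hook Tr /= f1 f2 m1 !addnS.
exists r, w3; rewrite /hook /content Tr /=; split=> //; first lia.
by right; lia.
Qed.

(** ** Counting contents *)

Lemma std_before w q w' (b : nat * nat) : std (w ++ q :: w') -> perm_eq (w ++ q ::
    w') (enum 'I_n) ->
  (b.1 <= (T q).1)%N -> (b.2 <= (T q).2)%N -> b != T q -> b \in map T w.
Proof.
move=> sw e h1 h2 bq; have [_ low _] := YT.
have [r Tr] := low q b.1 b.2 h1 h2.
have {}Tr : T r = b by rewrite Tr -surjective_pairing.
have : r \in w ++ q :: w' by rewrite (perm_mem e) mem_enum.
rewrite mem_cat inE => /or3P[rw|/eqP rq|rw']; first by rewrite -Tr map_f.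
  by rewrite -Tr rq eqxx in bq.
move: sw; rewrite /std pairwise_cat /= => /and4P[_ _ /allP/(_ r rw') + _].
by rewrite /below Tr h1 h2.
Qed.

Definition ncontent w (k : int) := count (fun p => content (T p) == k) w.

(** The right and the lower neighbours of the earlier boxes on the diagonal of
    q are earlier than q as well, and the neighbouring diagonal on the side of
    the main one has one box more. For q on the main diagonal the term c = 0
    takes the place of this box. *)
Lemma count_contents w q w' : std (w ++ q :: w') ->
  perm_eq (w ++ q :: w') (enum 'I_n) ->
  (2 * ncontent w (content (T q)) < (content (T q) == 0%R)
     + ncontent w (content (T q) + 1)%R + ncontent w (content (T q) - 1)%R)%N.
Proof.
move=> sw e; pose c := content (T q); rewrite -/c.
have uw : uniq (map T w).
  rewrite map_inj_uniq //.
  have : uniq (w ++ q :: w') by rewrite (perm_uniq e) enum_uniq.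
  by rewrite cat_uniq => /andP[].
pose D (k : int) := [seq b <- map T w | content b == k].
have sD k : ncontent w k = size (D k).
  by rewrite /D size_filter count_map.
have uD k : uniq (D k) by rewrite filter_uniq.
have inD k (b : nat * nat) : (b.1 <= (T q).1)%N -> (b.2 <= (T q).2)%N -> b != T q ->
    content b = k -> b \in D k.
  by move=> h1 h2 h3 h4; rewrite mem_filter h4 eqxx (std_before sw e).
have Dlt (b : nat * nat) : b \in D c -> (b.1 < (T q).1)%N /\ (b.2 < (T q).2)%N.
  rewrite mem_filter => /andP[/eqP cb /mapP[p pw pb]].
  have : ~~ below q p.
    by move: sw; rewrite /std pairwise_cat allrel_consr => /andP[/andP[/allP/(_ p pw)]].
  by rewrite /below -pb; move: cb; rewrite /content /c /content; lia.
have neqb (b b' : nat * nat) : (b.1 != b'.1) || (b.2 != b'.2) -> b != b'.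
  by apply: contraTneq => ->; rewrite !eqxx.
pose rgt (b : nat * nat) := (b.1, b.2.+1); pose dwn (b : nat * nat) := (b.1.+1, b.2).
have urgt : uniq (map rgt (D c)).
  by rewrite map_inj_uniq // => [[? ?] [? ?] [-> ->]].
have udwn : uniq (map dwn (D c)).
  by rewrite map_inj_uniq // => [[? ?] [? ?] [-> ->]].
have srgt (b : nat * nat) : b \in map rgt (D c) -> b \in D (c + 1).
  move=> /mapP[b' b'D ->]; have [h1 h2] := Dlt _ b'D.
  move: b'D; rewrite mem_filter => /andP[/eqP cb _].
  apply: inD; rewrite /rgt /=; [lia|lia| |].
    by apply: neqb => /=; lia.
  by move: cb; rewrite /content /=; lia.
have sdwn (b : nat * nat) : b \in map dwn (D c) -> b \in D (c - 1).
  move=> /mapP[b' b'D ->]; have [h1 h2] := Dlt _ b'D.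
  move: b'D; rewrite mem_filter => /andP[/eqP cb _].
  apply: inD; rewrite /dwn /=; [lia|lia| |].
    by apply: neqb => /=; lia.
  by move: cb; rewrite /content /=; lia.
have lrgt := uniq_leq_size urgt srgt; have ldwn := uniq_leq_size udwn sdwn.
rewrite !size_map in lrgt ldwn; rewrite !sD.
have [c0|c0] := eqVneq c 0; first by rewrite -addnA add1n ltnS mul2n -addnn leq_add.
have [lt|ge] := ltnP (T q).1 (T q).2.
  suff h : (size (D c) < size (D (c - 1)%R))%N.
    by rewrite add0n mul2n -addnn -addnS leq_add.
  pose b0 := (0%N, ((T q).2 - (T q).1).-1).
  have <- : size (b0 :: map dwn (D c)) = (size (D c)).+1 by rewrite /= size_map.
  apply: uniq_leq_size.
    by rewrite /= udwn andbT; apply/mapP => -[b' _ []].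
  move=> b; rewrite inE => /orP[/eqP->|]; last exact: sdwn.
  apply: inD; rewrite /b0 /=; [lia|lia| |by rewrite /c /content /=; lia].
  by apply: neqb => /=; lia.
suff h : (size (D c) < size (D (c + 1)%R))%N.
  by rewrite add0n mul2n -addnn -addSn leq_add.
pose b0 := (((T q).1 - (T q).2).-1, 0%N).
have cq : c = (T q).2%:Z - (T q).1%:Z by [].
have <- : size (b0 :: map rgt (D c)) = (size (D c)).+1 by rewrite /= size_map.
apply: uniq_leq_size.
  by rewrite /= urgt andbT; apply/mapP => -[b' _ []].
move=> b; rewrite inE => /orP[/eqP->|]; last exact: srgt.
apply: inD; rewrite /b0 /=; [lia|lia| |by rewrite /c /content /=; lia].
by apply: neqb => /=; lia.
Qed.

Lemma content_incomp a b : ~~ below a b -> ~~ below b a ->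
  (2 <= `|content (T a) - content (T b)|)%R.
Proof. by rewrite /below /content; lia. Qed.

Lemma hook_content_inj p q : hook p = hook q ->
  content (T p) = content (T q) -> p = q.
Proof. by rewrite /hook /content => h1 h2; apply: T_inj; lia. Qed.

End TableauWords.

(** * Fusion along the hook word *)

Section HookFusion.

Variables (n : nat) (K : numFieldType) (T : 'I_n -> nat * nat) (a : K).
Hypothesis YT : young_filling T.
Local Notation ga := (galg n K).
Implicit Types (p q r : 'I_n) (w : seq 'I_n) (z : 'I_n -> K).

Definition cont p : K := (content (T p))%:~R.
Definition shifted z p : K := z p + cont p.
Definition z0 : 'I_n -> K := fun=> a.
Local Notation H := (@H_space K n T).

Lemma principal_hookE i p : principal_hook i (T p) = (hook T p == i).
Proof. by rewrite /principal_hook /hook; case: (T p) => x y /=; apply/idP/idP; lia. Qed.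

Lemma H_hook z : H z <-> forall p q, hook T p = hook T q -> z p = z q.
Proof.
split=> h.
  by move=> p q e; apply: (h (hook T p)); rewrite principal_hookE ?e eqxx.
by move=> i p q; rewrite !principal_hookE => /eqP <- /eqP /esym; apply: h.
Qed.

Lemma affine_H : affine H.
Proof.
move=> z z' s /H_hook h /H_hook h'; apply/H_hook => p q e.
by rewrite /line (h p q e) (h' p q e).
Qed.

Lemma H_z0 : H z0. Proof. by apply/H_hook. Qed.

Lemma cont_inj p q : (cont p == cont q) = (content (T p) == content (T q)).
Proof. by rewrite eqr_int. Qed.

(** The contents of incomparable boxes differ by at least 2. *)
Lemma incomp_nonsing p r : ~~ below T p r -> ~~ below T r p ->
  cont p != cont r /\ 1 - (cont p - cont r) ^- 2 != 0.
Proof.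
move=> npr nrp; have c2 := content_incomp npr nrp.
split; first by rewrite cont_inj; apply: contraTneq c2 => ->; rewrite subrr.
rewrite subr_eq0 eq_sym; apply: contraTneq c2 => d2.
have : (cont p - cont r) ^+ 2 = 1 by rewrite -[LHS]invrK d2 invr1.
rewrite /cont -rmorphB -rmorphXn /= => /eqP.
rewrite (_ : 1 = 1%:~R) // eqr_int sqrf_eq1 => /orP[]/eqP->; lia.
Qed.

Lemma generically_shift (H' : ('I_n -> K) -> Prop) p q (k : K) :
  (exists2 z, H' z & z p - z q + k != 0) ->
  generically H' (fun z => z p - z q + k != 0).
Proof.
have E z : ('X_p - 'X_q + k%:MP : {mpoly K[n]}).@[z] = z p - z q + k.
  by rewrite mevalD mevalB !mevalXU mevalC.
move=> [z1 Hz1 h]; apply: (@generically_mono _ _ _ (fun z => ('X_p - 'X_q + k%:MP :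
    {mpoly K[n]}).@[z] != 0)).
  by move=> z _; rewrite E.
by apply: generically_nz; exists z1; rewrite ?E.
Qed.

Lemma generically_generic w : generically H (fun z => generic (shifted z) w).
Proof.
apply: (@generically_mono _ _ _ (fun z => forall pq : 'I_n * 'I_n, pq \in enum {:
    'I_n * 'I_n} ->
    pq.1 != pq.2 -> shifted z pq.1 != shifted z pq.2)).
  by move=> z _ h p q _ _ pq; apply: (h (p, q)); rewrite ?mem_enum.
apply: (generically_all affine_H H_z0) => -[p q] _ /=.
have [_|pq] := eqVneq p q; first by apply: (generically_true H_z0).
suff h : generically H (fun z => z p - z q + (cont p - cont q) != 0).
  apply: generically_mono h => z _ h _; apply: contraNneq h => e.
  by rewrite addrACA -opprD -/(shifted z p) e subrr.
apply: generically_shift; have [e|ne] := eqVneq (hook T p) (hook T q).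
  exists z0; first exact: H_z0.
  rewrite subrr add0r subr_eq0 cont_inj; apply: contra pq => /eqP h.
  by apply/eqP/(hook_content_inj YT).
exists (fun r => if hook T r == hook T p then 1 - (cont p - cont q) else 0).
  by apply/H_hook => r s ->.
by rewrite eqxx [hook T q == _]eq_sym (negPf ne) subr0 subrK oner_neq0.
Qed.

Lemma reg_shifted p : reg z0 (fun z => shifted z p).
Proof. by apply: regD; [apply: reg_proj | apply: reg_cst]. Qed.

Lemma generically_reg_ne0 (phi : ('I_n -> K) -> K) : reg z0 phi -> phi z0 != 0 ->
  generically H (fun z => phi z != 0).
Proof.
move=> [c [d [d0 h]]] p0; have c0 : c.@[z0] != 0.
  by apply: contraNneq p0 => c0; rewrite h // c0 mul0r.
apply: (@generically_mono _ _ _ (fun z => (c * d).@[z] != 0)) => [z _|].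
  by rewrite mevalM mulf_eq0 negb_or => /andP[cz dz]; rewrite h // mulf_neq0 //
      invr_neq0.
by apply: generically_nz; exists z0; [apply: H_z0 | rewrite mevalM mulf_neq0].
Qed.

(** The last condition makes the boxes of p and r neighbours. *)
Definition hlink w p r := [/\ exists w1 w2, w = w1 ++ [:: p, r & w2],
  hook T r = hook T p & (cont r - cont p) ^+ 2 = 1].

Lemma hook_linked w q w' : hook_word T = w ++ q :: w' ->
  linked (hlink w) cont w q.
Proof.
move=> e; suff from : forall k v v0, (size v <= k)%N -> w = v0 ++ v ->
    linked (hlink w) cont v q by apply: (from (size w) w [::]).
elim=> [|k IH] [|p v] v0 //= sv wE.
case: ifP => [|_]; last by apply: (IH v (rcons v0 p)); rewrite ?cat_rcons.
rewrite cont_inj => /eqP cpq.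
have [r [w3 [rE hr cr1]]] : exists r w3, [/\ v ++ q :: w' = r :: w3, hook T r = hook
    T p &
    content (T r) = content (T p) + 1 \/ content (T r) = content (T p) - 1].
  apply: (@hook_next _ _ YT v0 p _ q); first by rewrite e wE -catA.
    by rewrite mem_cat inE eqxx orbT.
  exact: cpq.
case: v rE sv wE => [[qr _]|s v [sr _]] /= sv wE.
  by exfalso; move: cpq cr1; rewrite qr; lia.
subst s; split; last first.
  apply: (IH v (rcons (rcons v0 p) r)); first by apply: ltnW.
  by rewrite !cat_rcons.
split=> //; first by exists v0, v.
by rewrite /cont -rmorphB -rmorphXn /=; case: cr1 => ->; rewrite addrAC subrr add0r
    ?sqrrN expr1n.
Qed.

(** The unfused factors belong to distinct contents, and the poles of the fused
    ones depend on the contents of r and q, which differ by one. *)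
Lemma rega_fused (Z : ('I_n -> K) -> 'I_n -> K) w q (t : ('I_n -> K) -> K) :
  (forall p, reg z0 (fun z => Z z p)) -> (forall p, Z z0 p = a + cont p) ->
  reg z0 t -> t z0 = a + cont q ->
  linked (hlink (hook_word T)) cont w q -> rega z0 (fun z => fused cont (Z z) w q (t
      z)).
Proof.
move=> rZ Z0 rt t0; move: {2}(size w) (leqnn (size w)) => k.
have d0 p : Z z0 p - t z0 = cont p - cont q by rewrite Z0 t0 opprD addrACA subrr add0r.
elim: k w => [|k IH] [|p w] //= sw; try by move=> _; apply: rega_cst.
case: ifP => [/eqP cpq|cpq lw].
  case: w sw => [//|r w] sw [[_ _ c2] lw].
  apply: regaM; last by apply: IH => //; apply: ltnW.
  apply: regaD; first exact: rega_cst.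
  apply: regaN; apply: regaZ; last exact: rega_cst.
  apply: regV; first by apply: regB.
  rewrite d0 -cpq; apply/eqP => c0; move: c2; rewrite c0 expr0n => /esym/eqP.
  by rewrite oner_eq0.
apply: regaM; last exact: IH.
by apply: rega_factor; [apply: regB | rewrite d0 subr_eq0 cpq].
Qed.

(** ** The pole of the added Jucys-Murphy element *)

(** In terms of the deviation of the parameter of q from its limit, a letter on
    the diagonal of q contributes a double pole, and a letter on a neighbouring
    diagonal a simple zero. *)
Lemma ratio_pole (q : 'I_n) w : exists2 g : ('I_n -> K) -> K, reg z0 g &
  forall z, z q != a -> {in w, forall p, z q - a + cont q != cont p} ->
  (z q - a) ^+ (2 * ncontent T w (content (T q))) *
    (\prod_(p <- w) (1 - (z q - a + cont q - cont p) ^- 2))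
  = (z q - a) ^+ (ncontent T w (content (T q) + 1) + ncontent T w (content (T q) -
      1)) * g z.
Proof.
elim: w => [|p w [g rg gE]].
  by exists (fun=> 1); [apply: reg_cst | move=> z _ _; rewrite big_nil !expr0].
pose x z := z q - a.
have rx : reg z0 x by apply: regB; [apply: reg_proj | apply: reg_cst].
have x0 : x z0 = 0 by rewrite /x subrr.
pose d := cont q - cont p.
have cd k : (d == k%:~R) = (content (T q) - content (T p) == k).
  by rewrite /d /cont -rmorphB /= eqr_int.
have nE k : ncontent T (p :: w) k = ((content (T p) == k) + ncontent T w k)%N by [].
have step (h : ('I_n -> K) -> K) (e1 e2 : nat) : reg z0 h ->
    ((content (T p) == content (T q))%R * 2 = e1)%N ->
    ((content (T p) == content (T q) + 1)%R + (content (T p) == content (T q) - 1)%R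
        = e2)%N ->
    (forall z, x z != 0 -> x z + d != 0 -> x z ^+ e1 * (1 - (x z + d) ^- 2) = x z ^+
        e2 * h z) ->
    exists2 g' : ('I_n -> K) -> K, reg z0 g' &
    forall z, z q != a -> {in p :: w, forall p, z q - a + cont q != cont p} ->
    (z q - a) ^+ (2 * ncontent T (p :: w) (content (T q))) *
      (\prod_(p <- p :: w) (1 - (z q - a + cont q - cont p) ^- 2))
    = (z q - a) ^+ (ncontent T (p :: w) (content (T q) + 1) + ncontent T (p :: w)
        (content (T q) - 1)) * g' z.
  move=> rh E1 E2 hE; exists (fun z => h z * g z); first exact: regM.
  move=> z za zw; rewrite big_cons !nE.
  have -> : (2 * ((content (T p) == content (T q)) + ncontent T w (content (T q)))
      = e1 + 2 * ncontent T w (content (T q)))%N by rewrite mulnDr -E1 mulnC.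
  have hz : (z q - a) ^+ e1 * (1 - (z q - a + cont q - cont p) ^- 2) = (z q - a) ^+
      e2 * h z.
    rewrite -addrA; apply: hE; first by rewrite subr_eq0.
    by rewrite /x /d addrA subr_eq0; apply: zw; rewrite inE eqxx.
  rewrite addnACA E2 (exprD _ e1) (exprD _ e2) mulrACA hz gE //; first by rewrite
      mulrACA.
  by move=> r rw; apply: zw; rewrite inE rw orbT.
have rxd : reg z0 (fun z => x z + d) by apply: regD => //; apply: reg_cst.
have rx2 : d != 0 -> reg z0 (fun z => (x z + d) ^- 2).
  move=> d0; apply: (@eq_reg _ _ _ (fun z => (x z + d)^-1 * (x z + d)^-1)).
    by move=> z; rewrite expr2 invfM.
  by apply: regM; apply: regV => //; rewrite x0 add0r.
have [e|ne] := eqVneq (content (T p)) (content (T q)).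
  have d0 : d = 0 by apply/eqP; rewrite (cd 0) e subrr.
  apply: (step (fun z => x z * x z - 1) 2%N 0%N).
  - by apply: regB; [apply: regM | apply: reg_cst].
  - by rewrite e eqxx.
  - by rewrite e; case: eqP => [|_]; [lia | case: eqP => [|_] //; lia].
  - by move=> z xz _; rewrite d0 addr0 expr0; field.
have dn0 : d != 0 by rewrite (cd 0) subr_eq0 eq_sym.
have [e|ne1] := eqVneq (content (T p)) (content (T q) + 1).
  have d1 : d = -1 by apply/eqP; rewrite (cd (-1)) e; apply/eqP; lia.
  apply: (step (fun z => (x z + d - 1) * (x z + d) ^- 2) 0%N 1%N).
  - by apply: regM; [apply: regB => //; apply: reg_cst | apply: rx2].
  - by rewrite (negPf ne).
  - by rewrite e eqxx; case: eqP => [|_] //; lia.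
  - by move=> z xz xd; rewrite expr0 expr1; move: xd; rewrite d1 => xd; field.
have [e|ne2] := eqVneq (content (T p)) (content (T q) - 1).
  have d1 : d = 1 by apply/eqP; rewrite (cd 1) e; apply/eqP; lia.
  apply: (step (fun z => (x z + d + 1) * (x z + d) ^- 2) 0%N 1%N).
  - by apply: regM; [apply: regD => //; apply: reg_cst | apply: rx2].
  - by rewrite (negPf ne).
  - by rewrite (negPf ne1) e eqxx.
  - by move=> z xz xd; rewrite expr0 expr1; move: xd; rewrite d1 => xd; field.
apply: (step (fun z => 1 - (x z + d) ^- 2) 0%N 0%N).
- by apply: regB; [apply: reg_cst | apply: rx2].
- by rewrite (negPf ne).
- by rewrite (negPf ne1) (negPf ne2).
- by move=> z xz xd; rewrite !expr0.
Qed.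

End HookFusion.

Section HookFusionValue.

Variables (n : nat) (K : numFieldType) (T : 'I_n -> nat * nat) (a : K).
Hypothesis YT : young_filling T.
Local Notation ga := (galg n K).
Local Notation cont := (cont K T).
Local Notation shifted := (shifted T).
Local Notation z0 := (@z0 n K a).
Implicit Types (p q r : 'I_n) (w : seq 'I_n) (z : 'I_n -> K).
Local Notation H := (@H_space K n T).

Let aH := affine_H (K := K) (T := T).
Let H0 : H z0 := @H_z0 n K T a.

Lemma shifted_z0 p : shifted z0 p = a + cont p. Proof. by []. Qed.

Lemma lim_star_wordprod w E : uniq w -> lim H z0 (fun z => wordprod (shifted z) w) E ->
  star E = E.
Proof.
move=> uw lE; apply: (lim_uniq aH H0 (lim_star lE) lE).
apply: generically_mono (generically_generic a YT w) => z _ g; exact: star_wordprod.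
Qed.

(** On H the parameters of linked letters differ by the constant +-1, whence
    the eigenvalue of their transposition persists in the limit. *)
Lemma lim_wordprod_link w p r E : uniq w -> lim H z0 (fun z => wordprod (shifted z)
    w) E ->
  hlink K T w p r -> E * transp K p r = (cont r - cont p) *: E.
Proof.
move=> uw lE [[w1 [w2 wE]] hr e2].
apply: (lim_uniq aH H0 (limM aH lE (lim_cst H0 (transp K p r)))).
  exact: (limZ (reg_cst z0 (cont r - cont p)) lE).
apply: generically_mono (generically_generic a YT w) => z /H_hook Hz g.
have d : shifted z r - shifted z p = cont r - cont p.
  by rewrite /shifted (Hz _ _ hr) opprD addrACA subrr add0r.
have two0 : 2%:R != 0 :> K by rewrite pnatr_eq0.
have := @wordprod_link n K (shifted z) w1 p r w2 (cont r - cont p).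
rewrite -wE => /(_ uw g d e2 two0) /(congr1 (@star _ _)).
by rewrite starM starZ star_transp star_wordprod.
Qed.

Lemma lim_column w q t : {in w, forall p, a + cont p != t} ->
  lim H z0 (fun z => column (shifted z) w q t) (column (shifted z0) w q t).
Proof.
move=> gt; apply: (lim_rega H0); apply: rega_prod => p pw; apply: rega_factor.
  by apply: regB; [apply: reg_shifted | apply: reg_cst].
by rewrite subr_eq0 shifted_z0 gt.
Qed.

Lemma lim_wordprod_column w q t E : uniq (rcons w q) ->
  lim H z0 (fun z => wordprod (shifted z) w) E -> {in w, forall p, a + cont p != t} ->
  E * column (shifted z0) w q t = column (shifted z0) (rev w) q t * E.
Proof.
move=> uq lE gt.
apply: (lim_uniq aH H0 (limM aH lE (lim_column q gt))).
  have gt' : {in rev w, forall p, a + cont p != t} by move=> p; rewrite mem_rev;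
      apply: gt.
  exact: (limM aH (lim_column q gt') lE).
have gg : generically H (fun z => forall p, p \in w -> shifted z p != t).
  apply: (generically_all aH H0) => p pw.
  apply: (@generically_mono _ _ _ (fun z => shifted z p - t != 0)); first by move=> z
      _; rewrite subr_eq0.
  apply: (@generically_reg_ne0 _ _ _ a (fun z => shifted z p - t)).
    by apply: regB; [apply: reg_shifted | apply: reg_cst].
  by rewrite subr_eq0 gt.
apply: generically_mono (generically_and aH (generically_generic a YT w) gg) => z _
    [g h].
exact: wordprod_column.
Qed.

(** On this line the parameter of q tends to its limit after those of the other
    letters have reached theirs. *)
Definition H1 q z := forall p, p != q -> z p = a.

Lemma affine_H1 q : affine (H1 q).
Proof.
move=> z z' s h h' p pq; rewrite /line h // h' // -mulrDl subrK mul1r //.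
Qed.

Lemma H1_z0 q : H1 q z0. Proof. by []. Qed.

Lemma generically_H1 q (k : K) : generically (H1 q) (fun z => z q + k != 0).
Proof.
have E z : ('X_q + k%:MP : {mpoly K[n]}).@[z] = z q + k.
  by rewrite mevalD mevalXU mevalC.
apply: (@generically_mono _ _ _ (fun z => ('X_q + k%:MP : {mpoly K[n]}).@[z] != 0)).
  by move=> z _; rewrite E.
apply: generically_nz; exists (fun p => if p == q then 1 - k else a).
  by move=> p /negPf ->.
by rewrite E eqxx subrK oner_neq0.
Qed.

(** The fused column makes the product regular. By lim_wordprod_column and
    jucys_column the new Jucys-Murphy element acts on the limit as the
    parameter of q, up to a multiple of E; its coefficient tends to zero because
    q is an addable box. *)
Lemma hook_fusion_step w q w' E : hook_word T = w ++ q :: w' ->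
  lim H z0 (fun z => wordprod (shifted z) w) E -> jmeigen cont [::] w E ->
  let E' := E * fused cont (shifted z0) w q (a + cont q) in
  lim H z0 (fun z => wordprod (shifted z) (rcons w q)) E' /\ jmeigen cont [::] (rcons
      w q) E'.
Proof.
move=> e lE jE E'.
have std_w : std T (w ++ q :: w').
  by rewrite -e; apply: word_std; [apply: hookkey_inj | apply: hookkey_mono].
have perm_w : perm_eq (w ++ q :: w') (enum 'I_n) by rewrite -e word_perm.
have uall : uniq (w ++ q :: w') by rewrite -e word_uniq.
have uq : uniq (rcons w q).
  by move: uall; rewrite -cat_rcons cat_uniq => /andP[].
have [qw uw] : q \notin w /\ uniq w by move: uq; rewrite rcons_uniq => /andP[].
have lw := hook_linked K YT e.
have lw' : linked (hlink K T (hook_word T)) cont w q.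
  apply: linkedW lw => p r pw rw [[w1 [w2 wE]] h1 h2]; split=> //.
  by exists w1, (w2 ++ q :: w'); rewrite e wE -catA.
have lE' : lim H z0 (fun z => wordprod (shifted z) (rcons w q)) E'.
  have rf : rega z0 (fun z => fused cont (shifted z) w q (shifted z q)).
    by apply: (rega_fused (a := a)) => //; [move=> p; apply: reg_shifted | apply:
        reg_shifted].
  have := limM aH lE (lim_rega H0 rf); apply: lim_eq => //.
  apply: generically_mono (generically_generic a YT (rcons w q)) => z /H_hook Hz g.
  have gw : generic (shifted z) w.
    by apply: (genericW g) => p pw; rewrite mem_rcons inE pw orbT.
  rewrite wordprod_rcons // -column_fused //.
    move=> p pw; apply: g; rewrite ?mem_rcons ?inE ?eqxx ?pw ?orbT //.
    by apply: contraNneq qw => <-.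
  apply: linkedW lw => p r pw rw [[w1 [w2 wE]] hr e2].
  have d : shifted z r - shifted z p = cont r - cont p.
    by rewrite /shifted (Hz _ _ hr) opprD addrACA subrr add0r.
  rewrite d; split=> //.
  have two0 : 2%:R != 0 :> K by rewrite pnatr_eq0.
  have := @wordprod_link n K (shifted z) w1 p r w2 (cont r - cont p).
  rewrite -wE => /(_ uw gw d e2 two0) /(congr1 (@star _ _)).
  by rewrite starM starZ star_transp star_wordprod.
split=> //; apply/jmeigen_rcons; rewrite cat0s.
split; first exact: jmeigen_mulr.
(* D z is the limit for w extended by the letter q with a free parameter,
   which tends to that of z0. *)
pose D z := E * fused cont (shifted z0) w q (shifted z q).
have rD : rega z0 D.
  apply: regaM; first exact: rega_cst.
  by apply: (rega_fused (a := a) (Z := fun=> shifted z0)) => //; [move=> p; apply: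
      reg_cst | apply: reg_shifted].
pose t z := z q - a + cont q.
have rt : reg z0 t.
  apply: regD; last exact: reg_cst.
  by apply: regB; [apply: reg_proj | apply: reg_cst].
have t0 : t z0 = cont q by rewrite /t /z0 subrr add0r.
have [g rg gE] := ratio_pole T a q w.
set m0 := ncontent T w (content (T q)) in gE.
set m1 := (_ + _)%N in gE.
have mlt : (2 * m0 < (content (T q) == 0%R) + m1)%N.
  by rewrite addnA; apply: (@count_contents _ _ YT w q w').
have ct0 : (cont q == 0) = (content (T q) == 0) by rewrite intr_eq0.
pose x z := z q - a.
have rx : reg z0 x by apply: regB; [apply: reg_proj | apply: reg_cst].
have regX k : reg z0 (fun z => x z ^+ k).
  elim: k => [|k IH]; first by apply: (@eq_reg _ _ _ (fun=> 1)) => [z|]; [rewrite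
      expr0 | apply: reg_cst].
  by apply: (@eq_reg _ _ _ (fun z => x z * x z ^+ k)) => [z|]; [rewrite exprS |
      apply: regM].
(* x z * h z is the coefficient of E in the defect of the eigenvector D z. *)
pose h z := (if content (T q) == 0 then 1 else t z) *
  (x z ^+ ((content (T q) == 0%R) + m1 - (2 * m0).+1) * g z).
have rh : reg z0 h.
  apply: regM; first by case: (content (T q) == 0); [apply: reg_cst | apply: rt].
  by apply: regM.
have key : generically (H1 q) (fun z => t z *: D z - jucys K w q * D z = (x z * h z)
    *: E).
  have gp : generically (H1 q) (fun z => forall p, p \in w -> z q + (- a + cont q -
      cont p) != 0).
    apply: (@generically_all _ _ (H1 q) z0 _ w (fun p z => z q + (- a + cont q - cont
        p) != 0)) => //.
      exact: affine_H1.
    by move=> p _; apply: generically_H1.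
  have gt := generically_H1 q (- a + cont q); have gx := generically_H1 q (- a).
  have G := generically_and (@affine_H1 q) gp (generically_and (@affine_H1 q) gt gx).
  apply: generically_mono G => z zq [zp [zt zx]].
  have {zt} tn : t z != 0 by move: zt; rewrite addrA.
  have {zp} zp : {in w, forall p, t z != cont p}.
    by move=> p /zp; rewrite !addrA subr_eq0.
  have shE p : shifted z0 p - shifted z q = cont p - t z.
    by rewrite /shifted /t /z0; ring.
  have crE (v : seq 'I_n) : column (shifted z0) v q (shifted z q) = column cont v q
      (t z).
    by rewrite /column; apply: eq_bigr => p _; rewrite shE.
  have gsh : {in w, forall p, shifted z0 p != shifted z q}.
    by move=> p /zp; rewrite -subr_eq0 -opprB oppr_eq0 -shE subr_eq0.
  have DE : D z = E * column cont w q (t z).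
    rewrite -crE; symmetry; apply: column_fused => //.
    apply: linkedW lw => p r pw rw lpr.
    have d : shifted z0 r - shifted z0 p = cont r - cont p by rewrite /shifted /z0;
        ring.
    by rewrite d; split; [case: lpr | apply: lim_wordprod_link lpr].
  have cE : E * column cont w q (t z) = column cont (rev w) q (t z) * E.
    by rewrite -!crE; apply: lim_wordprod_column.
  have := jucys_column uq tn zp jE cE; rewrite -DE => /(congr1 (fun y => t z *: y)).
  rewrite scalerBr scalerA mulfV // scale1r => ->; rewrite scalerA; congr (_ *: _).
  have xn : x z != 0 by rewrite /x.
  have zpz : {in w, forall p, z q - a + cont q != cont p} by exact: zp.
  have za : z q != a by move: zx; rewrite subr_eq0.
  have {}gE := gE z za zpz.
  apply: (mulfI (expf_neq0 (2 * m0) xn)); rewrite mulrCA gE /h -/(x z).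
  have tE : t z = (if content (T q) == 0 then 1 else t z) * x z ^+ (content (T q) == 0).
    rewrite /t -ct0; case: eqP => [->|_]; last by rewrite expr0 mulr1.
    by rewrite addr0 mul1r expr1.
  pose k := ((content (T q) == 0%R) + m1 - (2 * m0).+1)%N; rewrite {1}tE -/k.
  have -> : x z ^+ (2 * m0) * (x z * ((if content (T q) == 0 then 1 else t z) *
      (x z ^+ k * g z))) = (if content (T q) == 0 then 1 else t z) *
      (x z ^+ (2 * m0) * x z * x z ^+ k) * g z by ring.
  rewrite -exprSr -exprD /k subnKC // exprD; ring.
have lD := lim_rega (@H1_z0 q) rD.
have := lim_uniq (@affine_H1 q) (@H1_z0 q)
  (limD (@affine_H1 q) (limZ rt lD) (limZ (reg_cst z0 (-1))
     (limM (@affine_H1 q) (lim_cst (@H1_z0 q) (jucys K w q)) lD)))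
  (limZ (regM rx rh) (lim_cst (@H1_z0 q) E)).
have -> : x z0 = 0 by rewrite /x subrr.
rewrite mul0r scale0r t0 scaleN1r => /(_ _)/eqP; rewrite subr_eq0 => lk.
apply/eqP; rewrite eq_sym; apply: lk.
by apply: generically_mono key => z _ <-; rewrite scaleN1r.
Qed.

Lemma hook_fusion w w' : hook_word T = w ++ w' -> exists E,
  lim H z0 (fun z => wordprod (shifted z) w) E /\ jmeigen cont [::] w E.
Proof.
elim/last_ind: w w' => [|w q IH] w'; first by exists 1; split=> //; apply: lim_cst.
rewrite cat_rcons => e; have [E [lE jE]] := IH _ e.
by eexists; apply: (hook_fusion_step e lE jE).
Qed.

(** Exchanging letters in incomparable boxes preserves regularity, the
    intertwining factors being invertible. *)
Theorem fusion w : std T w -> perm_eq w (enum 'I_n) -> exists E,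
  lim H z0 (fun z => wordprod (shifted z) w) E /\ bieigen cont w E.
Proof.
move=> sw ew; have hperm : perm_eq (hook_word T) (enum 'I_n) := word_perm _.
pose P v := uniq v /\ exists E, lim H z0 (fun z => wordprod (shifted z) v) E /\
    bieigen cont v E.
suff : P w by case.
apply: (@std_connect _ T P _ (hook_word T)) => //; last first.
- have uh : uniq (hook_word T) by exact: word_uniq.
  have [|E [lE jE]] := @hook_fusion (hook_word T) [::]; first by rewrite cats0.
  by split=> //; exists E; rewrite /bieigen (lim_star_wordprod uh lE).
- by rewrite (permPl hperm) perm_sym.
- by apply: word_std; [apply: hookkey_inj | apply: hookkey_mono].
move=> w1 p r w2 npr nrp [uw [E [lE jE]]].
have uw' : uniq (w1 ++ r :: p :: w2).
  have e2 : perm_eq [:: p, r & w2] [:: r, p & w2].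
    exact: (permEl (perm_catCA [:: p] [:: r] w2)).
  have e3 : perm_eq (w1 ++ [:: p, r & w2]) (w1 ++ [:: r, p & w2]) by rewrite perm_cat2l.
  by rewrite -(perm_uniq e3).
split=> //.
have [cprK d1] := incomp_nonsing K npr nrp; set d := cont p - cont r in d1.
have dn : d != 0 by rewrite subr_eq0.
exists ((1 - d ^- 2)^-1 *: (factor r p (cont r - cont p) * E * factor r p (cont r -
    cont p))); split; last first.
  exact: bieigenZ (bieigen_swap uw cprK jE).
pose dz z := shifted z p - shifted z r.
have rdz : reg z0 dz by apply: regB; apply: reg_shifted.
have dz0 : dz z0 = d by rewrite /dz !shifted_z0 opprD addrACA subrr add0r.
have rF : lim H z0 (fun z => factor r p (- dz z)) (factor r p (cont r - cont p)).
  have -> : cont r - cont p = - dz z0 by rewrite dz0 opprB.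
  apply: (lim_rega H0); apply: rega_factor; first exact: regN.
  by rewrite oppr_eq0 dz0.
have rk : reg z0 (fun z => (1 - (dz z)^-1 * (dz z)^-1)^-1).
  have r1 : reg z0 (fun z => (dz z)^-1) by apply: regV; rewrite ?dz0.
  apply: regV; first by apply: regB; [apply: reg_cst | apply: regM].
  by rewrite dz0 -invfM -expr2.
have := limZ rk (limM aH (limM aH rF lE) rF).
rewrite dz0 -invfM -expr2; apply: lim_eq => //.
have g1 : generically H (fun z => 1 - (dz z)^-1 * (dz z)^-1 != 0).
  apply: (@generically_reg_ne0 _ _ _ a); last by rewrite dz0 -invfM -expr2.
  apply: regB; first exact: reg_cst.
  by apply: regM; apply: regV; rewrite ?dz0.
have g2 := generically_generic a YT (w1 ++ [:: p, r & w2]).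
apply: generically_mono (generically_and aH g1 g2) => z _ [nz g].
have prz : shifted z p != shifted z r.
  apply: g; rewrite ?mem_cat ?inE ?eqxx ?orbT //.
  by apply: contraNneq cprK => ->.
have := wordprod_exchange uw g.
have -> : shifted z r - shifted z p = - dz z by rewrite opprB.
rewrite -/(dz z) -mulrA => ->; rewrite mulrA.
have dzn : dz z != 0 by rewrite subr_eq0.
have := factor_inv r p (x := - dz z); rewrite opprK oppr_eq0 sqrrN => /(_ dzn) ->.
have dd : (dz z)^-1 * (dz z)^-1 = dz z ^- 2 by rewrite -invfM -expr2.
by rewrite -scalerAl mul1r scalerA dd mulVf ?scale1r // -dd.
Qed.

End HookFusionValue.

(** * Uniqueness of two-sided Jucys-Murphy eigenvectors *)

Section Positivity.

Variables (n : nat) (C : numClosedFieldType).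
Local Notation ga := (galg n C).
Implicit Types (x y : ga) (p q r : 'I_n) (w : seq 'I_n).

Definition dot x y : C := \sum_s x s * (y s)^*%R.

Lemma dotDl x y z : dot (x + y) z = dot x z + dot y z.
Proof. by rewrite -big_split; apply: eq_bigr => s _; rewrite gaE mulrDl. Qed.

Lemma dotZl k x y : dot (k *: x) y = k * dot x y.
Proof. by rewrite mulr_sumr; apply: eq_bigr => s _; rewrite gaZE mulrA. Qed.

Lemma dotDr x y z : dot x (y + z) = dot x y + dot x z.
Proof. by rewrite -big_split; apply: eq_bigr => s _; rewrite gaE rmorphD mulrDr. Qed.

Lemma dotZr k x y : dot x (k *: y) = k^*%R * dot x y.
Proof. by rewrite mulr_sumr; apply: eq_bigr => s _; rewrite gaZE rmorphM mulrCA. Qed.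

Lemma dot_transp p q x y : dot (transp C p q * x) y = dot x (transp C p q * y).
Proof.
rewrite /dot (reindex (fun s => (s * tperm p q)%g)) /=; last first.
  by exists (fun s => (s * tperm p q)%g) => s _; rewrite -mulgA tperm2 mulg1.
apply: eq_bigr => s _; rewrite !geltEl tpermV -mulgA tperm2 mulg1 //.
Qed.

Lemma dot_jucys w q x y : dot (jucys C w q * x) y = dot x (jucys C w q * y).
Proof.
rewrite /jucys; elim: w => [|p w IH].
  by rewrite !big_nil !mul0r /dot !big1 // => s _; rewrite ga0E ?rmorph0 ?mulr0 ?mul0r.
by rewrite !big_cons !mulrDl dotDl dotDr IH dot_transp.
Qed.

Lemma dot_eq0 x : dot x x = 0 -> x = 0.
Proof.
move=> h; apply/ffunP => s; rewrite ga0E.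
have pos t : true -> 0 <= x t * (x t)^*%R by move=> _; rewrite mul_conjC_ge0.
move: h => /eqP; rewrite (psumr_eq0 _ pos) => /allP/(_ s (mem_index_enum s)).
by rewrite mul_conjC_eq0 => /eqP.
Qed.

(** Unitarity: if two consecutive eigenvalues differ by e = +-1, then the
    component of (p r) x orthogonal to x vanishes. *)
Lemma jmeigen_link (c : 'I_n -> C) w1 p r w2 (e : C) x :
  uniq (w1 ++ [:: p, r & w2]) -> c r = c p + e -> e ^+ 2 = 1 ->
  (forall q, (c q)^*%R = c q) ->
  jmeigen c [::] (w1 ++ [:: p, r & w2]) x -> transp C p r * x = e *: x.
Proof.
move=> uw column e2 creal /jmeigen_cat[_] /= [h1] [h2] _.
have [pw rw] : p \notin w1 /\ r \notin w1.
  move: uw; rewrite -[X in w1 ++ X]/([:: p; r] ++ w2) uniq_catCA /= inE negb_or.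
  by rewrite !mem_cat !negb_or => /and3P[/andP[_ /andP[-> _]] /andP[-> _] _].
have e0 : e != 0.
  by apply/eqP => e0; move: e2; rewrite e0 expr0n => /esym/eqP; rewrite oner_eq0.
have smap : map (tperm p r) w1 = w1.
  rewrite -[RHS]map_id; apply/eq_in_map => q qw.
  by rewrite tpermD //; [apply: contraNneq pw | apply: contraNneq rw] => ->.
have ys : jucys C w1 p * transp C p r = transp C p r * jucys C w1 r by rewrite
    gelt_jucys tpermR smap.
have jr : jucys C w1 r * x = c r *: x - transp C p r * x.
  by rewrite -h2 /jucys -cats1 big_cat big_seq1 mulrDl addrK.
pose b := transp C p r * x - e *: x.
have sb : transp C p r * b = - e *: b.
  rewrite /b mulrBr transpK -scalerAr.
  apply/ffunP => g; rewrite !(gaE, gaNE, gaZE).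
  have E : x g = e * (e * x g) by rewrite mulrA -expr2 e2 mul1r.
  by rewrite {1}E; ring.
have yb : jucys C w1 p * b = c r *: b.
  rewrite /b mulrBr -scalerAr h1 mulrA ys -mulrA jr mulrBr -scalerAr transpK.
  apply/ffunP => g; rewrite !(gaE, gaNE, gaZE) column.
  have E : x g = e * (e * x g) by rewrite mulrA -expr2 e2 mul1r.
  apply/eqP; rewrite -subr_eq0; apply/eqP; transitivity (e * (e * x g) - x g).
    by ring.
  by rewrite -E subrr.
have bx : dot b x = 0.
  have := dot_jucys w1 p b x; rewrite yb h1 dotZl dotZr creal column mulrDl => /eqP.
  by rewrite addrC -subr_eq0 addrK mulf_eq0 (negPf e0) => /eqP.
suff : b = 0 by move=> /eqP; rewrite subr_eq0 => /eqP.
apply: dot_eq0; rewrite {2}/b -scaleNr dotDr dotZr bx mulr0 addr0.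
by rewrite -dot_transp sb dotZl bx mulr0.
Qed.

(** Induction on the support of s, multiplying by (p (s p)) to fix p. *)
Lemma transp_perm_inv (f : 'I_n -> nat) (e : C) x : e ^+ 2 = 1 ->
  (forall p q, p != q -> f p = f q -> transp C p q * x = e *: x) ->
  forall s : 'S_n, (forall p, f (s p) = f p) -> gelt C s * x = e ^+ odd_perm s *: x.
Proof.
move=> e2 h s; have [k] := ubnP #|[pred p | s p != p]|; elim: k s => // k IH s.
rewrite ltnS => sk fs.
case: (pickP [pred p | s p != p]) => [p /= ps|s1]; last first.
  have -> : s = 1%g.
    by apply/permP => p; rewrite perm1; have /negbT := s1 p; rewrite negbK => /eqP.
  by rewrite gelt1 odd_perm1 mul1r scale1r.
pose s' := (s * tperm p (s p))%g.
have s'E : s = (s' * tperm p (s p))%g by rewrite /s' -mulgA tperm2 mulg1.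
have {1}-> : gelt C s = transp C p (s p) * gelt C s' by rewrite geltM -s'E.
have odd_s : odd_perm s = ~~ odd_perm s'.
  by rewrite {1}s'E odd_permM odd_tperm eq_sym ps addbT.
have fs' q : f (s' q) = f q.
  rewrite permM -[RHS]fs; case: tpermP => // [->|->]; rewrite ?fs //.
rewrite -mulrA IH //; last first.
  apply: leq_trans sk; apply: proper_card; apply/properP; split.
    apply/subsetP => q; rewrite !inE permM; apply: contraNN => /eqP sq.
    rewrite sq; case: tpermP => [qp|qsp|] //.
      by move: ps; rewrite -qp sq eqxx.
    by case/eqP: ps; apply: (@perm_inj _ s); rewrite -qsp sq.
  by exists p; rewrite !inE ?permM ?tpermR ?eqxx.
rewrite -scalerAr h ?fs 1?eq_sym // scalerA odd_s; congr (_ *: _).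
by case: (odd_perm s'); rewrite /= ?expr1 ?expr0 ?mul1r // -expr2 e2.
Qed.

(** Neighbours in a row are consecutive letters of the row word, and their
    transpositions generate the row group. *)
Lemma row_word_inv (T : 'I_n -> nat * nat) (c : 'I_n -> C) (e : C) x :
  young_filling T -> e ^+ 2 = 1 -> (forall q, (c q)^*%R = c q) ->
  (forall p r, (T r).1 = (T p).1 -> (T r).2 = (T p).2.+1 -> c r = c p + e) ->
  jmeigen c [::] (word (rowkey T)) x ->
  forall s : 'S_n, (forall p, (T (s p)).1 = (T p).1) ->
  gelt C s * x = e ^+ odd_perm s *: x.
Proof.
move=> YT e2 creal cnext jx; apply: (transp_perm_inv (f := fun p => (T p).1) e2).
have adj1 p q : (T p).1 = (T q).1 -> (T q).2 = (T p).2.+1 ->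
    transp C p q * x = e *: x.
  move=> e1 e3; have pw : p \in word (rowkey T) by apply: mem_word.
  have [w1 [w2 wE]] : exists w1 w2, word (rowkey T) = w1 ++ p :: w2.
    by case/splitPr: pw => w1 w2; exists w1, w2.
  have [w3 w3E] := word_next (rowkey_inj YT) wE (row_next (esym e1) e3).
  move: jx (word_uniq (rowkey T)); rewrite wE w3E => jx' uw.
  by apply: (jmeigen_link uw _ e2 creal jx'); apply: cnext.
have adj d p q : (T p).1 = (T q).1 -> (T q).2 = ((T p).2 + d).+1 ->
    transp C p q * x = e *: x.
  elim: d p q => [|d IH] p q e1; first by rewrite addn0; apply: adj1.
  rewrite addnS => e3.
  have [_ low _] := YT; have [||r Tr] := low q (T p).1 ((T p).2 + d).+1.
  - by rewrite e1.
  - by rewrite e3.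
  have pr : p != r.
    by apply/eqP => pr; move: (congr1 snd Tr) => /=; rewrite -pr; lia.
  have pq : p != q by apply/eqP => pq; move: e3; rewrite pq; lia.
  have h1 : transp C p r * x = e *: x by apply: IH; rewrite Tr.
  have h2 : transp C r q * x = e *: x by apply: adj1; rewrite Tr.
  have -> : transp C p q = transp C r q * transp C p r * transp C r q.
    by rewrite transpJ tpermL tpermD 1?eq_sym // -mulrA transp_sq mulr1.
  by rewrite -!mulrA h2 -!scalerAr h1 -scalerAr h2 !scalerA -expr2 e2 mul1r.
move=> p q pq fpq; have [lt|ge] := ltnP (T p).2 (T q).2.
  by apply: (adj ((T q).2 - (T p).2).-1) => //; lia.
rewrite transpC; apply: (adj ((T p).2 - (T q).2).-1); first by [].
suff : (T p).2 != (T q).2 by lia.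
by apply: contra pq => /eqP e3; apply/eqP; apply: (T_inj YT).
Qed.

End Positivity.

(** ** The von Neumann lemma *)

Section VonNeumann.

Variables (n : nat) (C : numFieldType) (T : 'I_n -> nat * nat).
Hypothesis YT : young_filling T.
Local Notation ga := (galg n C).
Implicit Types (p q r i j : 'I_n) (s t : 'S_n) (x y : ga).

Definition rowsum (G : {set 'S_n}) : ga := [ffun s => (s \in row_group T :&: G)%:R].
Definition colsum (G : {set 'S_n}) : ga :=
  [ffun s : 'S_n => (-1) ^+ odd_perm s * (s \in col_group T :&: G)%:R].

Lemma row_groupP s : reflect (forall p, (T (s p)).1 = (T p).1) (s \in row_group T).
Proof.
by rewrite inE; apply: (iffP forallP) => h p; [apply/eqP | rewrite h].
Qed.

Lemma col_groupP s : reflect (forall p, (T (s p)).2 = (T p).2) (s \in col_group T).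
Proof.
by rewrite inE; apply: (iffP forallP) => h p; [apply/eqP | rewrite h].
Qed.

Lemma row_group_set : group_set (row_group T).
Proof.
apply/group_setP; split; first by apply/row_groupP => p; rewrite perm1.
move=> s t /row_groupP hs /row_groupP ht; apply/row_groupP => p.
by rewrite permM ht.
Qed.

Lemma col_group_set : group_set (col_group T).
Proof.
apply/group_setP; split; first by apply/col_groupP => p; rewrite perm1.
move=> s t /col_groupP hs /col_groupP ht; apply/col_groupP => p.
by rewrite permM ht.
Qed.

Canonical row_grp := Group row_group_set.
Canonical col_grp := Group col_group_set.

Lemma rowsum_gelt (G : {group 'S_n}) s : s \in row_group T :&: G ->
  rowsum G * gelt C s = rowsum G.
Proof.
move=> sG; apply/ffunP => t; rewrite geltEr !ffunE.
by rewrite (groupMl (G := [group of row_group T :&: G])) ?groupV.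
Qed.

Lemma gelt_colsum (G : {group 'S_n}) s : s \in col_group T :&: G ->
  gelt C s * colsum G = (-1) ^+ odd_perm s *: colsum G.
Proof.
move=> sG; apply/ffunP => t; rewrite geltEl gaZE !ffunE.
rewrite (groupMr _ (G := [group of col_group T :&: G])) ?groupV // odd_permM odd_permV.
by rewrite addbC signr_addb mulrA.
Qed.

Lemma star_rowsum (G : {group 'S_n}) : star (rowsum G) = rowsum G.
Proof.
apply/ffunP => s; rewrite !ffunE.
by rewrite (groupV [group of row_group T :&: G]).
Qed.

Lemma star_colsum (G : {group 'S_n}) : star (colsum G) = colsum G.
Proof.
apply/ffunP => s; rewrite !ffunE odd_permV.
by rewrite (groupV [group of col_group T :&: G]).
Qed.

(** The transposition is absorbed by the row sum, and yields a sign when it is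
    moved to the column sum. *)
Lemma row_col_collision (G : {group 'S_n}) i j s :
  i != j -> tperm i j \in row_group T :&: G ->
  tperm (s^-1 i)%g (s^-1 j)%g \in col_group T :&: G ->
  rowsum G * gelt C s * colsum G = 0.
Proof.
move=> ij ri cj; have two0 : 2%:R != 0 :> C by rewrite pnatr_eq0.
apply: (scalerI two0); rewrite scaler0.
have h : rowsum G * gelt C s * colsum G = - (rowsum G * gelt C s * colsum G).
  rewrite -{1}(rowsum_gelt ri) -(mulrA (rowsum G)).
  have -> : gelt C (tperm i j) * gelt C s = gelt C s * gelt C (tperm (s^-1 i)%g (s^-1
      j)%g).
    by rewrite [RHS]geltJ !permKV.
  rewrite -!mulrA (gelt_colsum cj) odd_tperm (inj_eq perm_inj) ij expr1.
  by rewrite scaleN1r !mulrN.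
by rewrite scaler_nat mulr2n {1}h addNr.
Qed.

Lemma tperm_row i j : (T i).1 = (T j).1 -> tperm i j \in row_group T.
Proof. by move=> e; apply/row_groupP => p; case: tpermP => // ->. Qed.

Lemma tperm_col i j : (T i).2 = (T j).2 -> tperm i j \in col_group T.
Proof. by move=> e; apply/col_groupP => p; case: tpermP => // ->. Qed.

(** If s^-1 keeps the letters of each row in distinct columns, then each of
    these columns meets the row. Otherwise let m be a column that misses the row
    of x0. In the columns before m, each row receives at most as many letters as
    it has boxes, and the row of x0 receives fewer, while the totals agree. *)
Lemma row_transversal s :
  (forall i j, i != j -> (T i).1 = (T j).1 -> (T (s^-1 i)%g).2 != (T (s^-1 j)%g).2) ->
  forall i, exists j, T j = ((T i).1, (T (s^-1 i)%g).2).
Proof.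
move=> ncol x0; pose k i := (T (s^-1 i)%g).2; set m := k x0.
have [_ low _] := YT.
case: (pickP [pred j | T j == ((T x0).1, m)]) => [j /= /eqP Tj|bad]; first by exists j.
exfalso.
pose A := [set i | (k i < m)%N]; pose B := [set i | ((T i).2 < m)%N].
pose R (r : nat) := [set i | (T i).1 == r].
have AB : #|A| = #|B|.
  rewrite -(card_preimset B (@perm_inj _ s^-1%g)); congr #|pred_of_set _|.
  by apply/setP => i; rewrite !inE.
have shortR (r j : nat) : r \notin [seq (T i).1 | i <- enum 'I_n & (T i).2 == j] ->
    forall i, (T i).1 = r -> ((T i).2 < j)%N.
  move=> h i ir; rewrite ltnNge; apply: contra h => le.
  have [j' Tj'] := low i r j (eq_leq (esym ir)) le.
  by apply/mapP; exists j'; [rewrite mem_filter Tj' /= eqxx mem_enum | rewrite Tj'].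
have le (r : nat) : (#|A :&: R r| <= #|B :&: R r|)%N.
  case: (boolP [forall i, (i \in A :&: R r) ==> [exists j, T j == (r, k i)]]).
    move=> /forallP h.
    pose f i := odflt i [pick j | T j == (r, k i)].
    have fE i : i \in A :&: R r -> T (f i) = (r, k i).
      move=> iA; have := h i; rewrite iA /= => /existsP[j Tj].
      by rewrite /f; case: pickP => [j' /eqP|/(_ j)] //=; rewrite Tj.
    rewrite -(card_in_imset (f := f)).
      apply: subset_leq_card; apply/subsetP => _ /imsetP[i iA ->].
      have := fE i iA; move: iA; rewrite !inE => /andP[km _] -> /=.
      by rewrite km eqxx.
    move=> i j iA jA fij; apply/eqP; apply: contraT => ij.
    have := fE i iA; rewrite fij fE // => -[kij].
    have := ncol i j ij; move: iA jA; rewrite !inE => /andP[_ /eqP->] /andP[_ /eqP->].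
    by rewrite -/(k i) -/(k j) kij eqxx => /(_ erefl).
  case/forallPn=> i; rewrite negb_imply negb_exists => /andP[iA /forallP nT].
  apply: subset_leq_card; apply/subsetP => j; rewrite !inE => /andP[_ jr].
  rewrite jr andbT; move: iA; rewrite !inE => /andP[km _].
  apply: ltn_trans (shortR r (k i) _ j (eqP jr)) km.
  apply/mapP => -[j']; rewrite mem_filter => /andP[/eqP j2 _] j1.
  by have := nT j'; rewrite [T j']surjective_pairing -j1 j2 eqxx.
have lt : (#|A :&: R (T x0).1| < #|B :&: R (T x0).1|)%N.
  apply: proper_card; apply/properP; split.
    apply/subsetP => j; rewrite !inE => /andP[_ jr]; rewrite jr andbT.
    apply: (shortR (T x0).1 m _ j (eqP jr)).
    apply/mapP => -[j']; rewrite mem_filter => /andP[/eqP j2 _] j1.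
    by have := bad j'; rewrite /= [T j']surjective_pairing -j1 j2 eqxx.
  exists x0; rewrite !inE ?eqxx ?ltnn //= andbT.
  apply: (shortR (T x0).1 m _ x0 erefl).
  apply/mapP => -[j']; rewrite mem_filter => /andP[/eqP j2 _] j1.
  by have := bad j'; rewrite /= [T j']surjective_pairing -j1 j2 eqxx.
have split (S : {set 'I_n}) : #|S| = (\sum_(r < width T) #|S :&: R r|)%N.
  have rb i : ((T i).1 < width T)%N by have [] := box_bound T i.
  rewrite -sum1_card (partition_big (fun i => Ordinal (rb i)) predT) //=.
  apply: eq_bigr => r _; rewrite -sum1_card; apply: eq_bigl => i.
  by rewrite !inE -val_eqE.
have : (#|A| < #|B|)%N.
  have r0 : ((T x0).1 < width T)%N by have [] := box_bound T x0.
  rewrite !split (bigD1 (Ordinal r0)) //= [X in (_ < X)%N](bigD1 (Ordinal r0)) //=.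
  by rewrite -addSn leq_add // leq_sum.
by rewrite AB ltnn.
Qed.

(** Either two letters of one row collide in one column and the term of s
    vanishes, or s is the product of an element of the row group and one of the
    column group. *)
Lemma von_neumann x : exists k,
  rowsum setT * x * colsum setT = k *: (rowsum setT * colsum setT).
Proof.
have inT (A : {set 'S_n}) : A :&: [set: 'S_n] = A by rewrite setIT.
rewrite [x]ga_decomp mulr_sumr mulr_suml.
apply: (big_ind (fun y => exists k, y = k *: (rowsum setT * colsum setT))).
- by exists 0; rewrite scale0r.
- by move=> y z [k ->] [l ->]; exists (k + l); rewrite scalerDl.
move=> s _; rewrite -scalerAr -scalerAl.
suff [k ->] : exists k, rowsum setT * gelt C s * colsum setT = k *: (rowsum setT *
    colsum setT).
  by exists (x s * k); rewrite scalerA.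
case: (pickP [pred ij : 'I_n * 'I_n | [&& ij.1 != ij.2, (T ij.1).1 == (T ij.2).1
   & (T (s^-1 ij.1)%g).2 == (T (s^-1 ij.2)%g).2]]) => [[i j] /= /and3P[ij /eqP e1
       /eqP e2]|no].
  exists 0; rewrite scale0r; apply: (@row_col_collision _ i j) => //.
    by rewrite inT tperm_row.
  by rewrite inT tperm_col.
have ncol i j : i != j -> (T i).1 = (T j).1 -> (T (s^-1 i)%g).2 != (T (s^-1 j)%g).2.
  by move=> ij e1; have /negbT := no (i, j); rewrite /= ij e1 eqxx.
have ex := row_transversal ncol.
pose f i := odflt i [pick j | T j == ((T i).1, (T (s^-1 i)%g).2)].
have fE i : T (f i) = ((T i).1, (T (s^-1 i)%g).2).
  by rewrite /f; case: pickP => [j /eqP//|] /=; have [j Tj] := ex i => /(_ j);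
      rewrite Tj eqxx.
have finj : injective f.
  move=> i j fij; apply/eqP; apply: contraT => ij.
  have := fE i; rewrite fij fE => -[e1 e2].
  by have := ncol i j ij (esym e1); rewrite e2 eqxx.
pose t := perm finj.
have transp_ : t \in row_group T by apply/row_groupP => p; rewrite permE fE.
have sc : (s * t)%g \in col_group T.
  by apply/col_groupP => p; rewrite permM permE fE /= permK.
exists ((-1) ^+ odd_perm (s * t)).
have -> : gelt C s = gelt C t^-1 * gelt C (s * t) by rewrite geltM mulgK.
rewrite mulrA rowsum_gelt ?inT ?groupV // -mulrA gelt_colsum ?inT //.
by rewrite -scalerAr.
Qed.

Lemma von_neumann_star x : exists k,
  colsum setT * x * rowsum setT = k *: (colsum setT * rowsum setT).
Proof.
have [k /(congr1 (@star _ _))] := von_neumann (star x).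
rewrite starZ !starM starK (star_rowsum [group of setT]) (star_colsum [group of setT]).
by rewrite mulrA => ->; exists k.
Qed.

End VonNeumann.

Section Uniqueness.

Variables (n : nat) (C : numClosedFieldType) (T : 'I_n -> nat * nat).
Hypothesis YT : young_filling T.
Local Notation ga := (galg n C).
Local Notation cont := (cont C T).
Implicit Types (p q r : 'I_n) (v w : seq 'I_n) (x y : ga).

Lemma conj_cont p : (cont p)^*%R = cont p.
Proof. exact: rmorph_int. Qed.

(** Each exchange multiplies by an invertible factor on both sides. *)
Lemma bieigen_transport w v : std T w -> std T v ->
  perm_eq w (enum 'I_n) -> perm_eq v (enum 'I_n) ->
  exists A B A' B' : ga, [/\ B * A = 1, A' * B' = 1 &
    forall x, bieigen cont w x -> bieigen cont v (A * x * A')].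
Proof.
move=> sw sv ew ev.
pose P u := uniq u /\ exists A B A' B' : ga, [/\ B * A = 1, A' * B' = 1 &
    forall x, bieigen cont w x -> bieigen cont u (A * x * A')].
suff : P v by case.
apply: (@std_connect _ T P _ w) => //; last first.
- split; first by rewrite (perm_uniq ew) enum_uniq.
  exists 1, 1, 1, 1; split; rewrite ?mulr1 // => x.
  by rewrite mul1r mulr1.
- by rewrite (permPl ew) perm_sym.
move=> w1 p r w2 npr nrp [uw [A [B [A' [B' [BA AB h]]]]]].
have [cpr d1] := incomp_nonsing C npr nrp; set d := cont p - cont r in d1.
split.
  have e2 : perm_eq [:: p, r & w2] [:: r, p & w2].
    exact: (permEl (perm_catCA [:: p] [:: r] w2)).
  have e3 : perm_eq (w1 ++ [:: p, r & w2]) (w1 ++ [:: r, p & w2]) by rewrite perm_cat2l.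
  by rewrite -(perm_uniq e3).
pose f : ga := factor r p (cont r - cont p); pose g : ga := (1 - d ^- 2)^-1 *: factor
    p r d.
have dn : d != 0 by rewrite subr_eq0.
have dE : cont r - cont p = - d by rewrite opprB.
have gf : g * f = 1.
  by rewrite /g /f -scalerAl dE factor_inv // scalerA mulVf // scale1r.
have fg : f * g = 1.
  have := factor_inv r p (x := - d); rewrite opprK oppr_eq0 sqrrN => /(_ dn) fi.
  by rewrite /g /f -scalerAr dE fi scalerA mulVf // scale1r.
exists (f * A), (B * g), (A' * f), (g * B'); split.
- by rewrite -mulrA (mulrA g) gf mul1r.
- by rewrite -mulrA (mulrA f) fg mul1r.
move=> x /h hx; have := bieigen_swap uw cpr hx.
by rewrite -/f !mulrA.
Qed.

(** ** Row and column words *)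

Definition transposed p := ((T p).2, (T p).1).

Lemma below_transposed p q : below transposed p q = below T p q.
Proof. by rewrite /below andbC. Qed.

Lemma young_transposed : young_filling transposed.
Proof.
have [injT low mono] := YT; split.
- by move=> p q [e1 e2]; apply: (T_inj YT).
- by move=> p i j h1 h2; have [q Tq] := low p j i h2 h1; exists q; rewrite
    /transposed Tq.
- by move=> a b; rewrite below_transposed; apply: mono.
Qed.

Lemma sum_absorb (e : C) (S : {set 'S_n}) x : S != set0 ->
  (forall s, s \in S -> gelt C s * x = e ^+ odd_perm s *: x) -> e ^+ 2 = 1 ->
  x = (#|S|%:R)^-1 *: ((\sum_(s in S) e ^+ odd_perm s *: gelt C s) * x).
Proof.
move=> S0 h e2; have -> : (\sum_(s in S) e ^+ odd_perm s *: gelt C s) * x = \sum_(s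
    in S) x.
  rewrite mulr_suml; apply: eq_bigr => s sS.
  by rewrite -scalerAl h // scalerA -expr2 -exprM mulnC exprM e2 expr1n scale1r.
rewrite sumr_const -scaler_nat scalerA mulVf ?scale1r //.
by rewrite pnatr_eq0 -lt0n card_gt0.
Qed.

Local Notation P := (@rowsum n C T setT).
Local Notation Q := (@colsum n C T setT).

Lemma rowsumE : P = \sum_(s in row_group T) 1 ^+ odd_perm s *: gelt C s.
Proof.
rewrite [LHS]ga_decomp [RHS]big_mkcond /=; apply: eq_bigr => s _.
by rewrite ffunE setIT expr1n; case: ifP; rewrite ?scale0r.
Qed.

Lemma colsumE : Q = \sum_(s in col_group T) (-1) ^+ odd_perm s *: gelt C s.
Proof.
rewrite [LHS]ga_decomp [RHS]big_mkcond /=; apply: eq_bigr => s _.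
by rewrite ffunE setIT; case: ifP; rewrite ?mulr1 ?mulr0 ?scale0r.
Qed.

Lemma row_word_absorb x : bieigen cont (word (rowkey T)) x -> exists k,
  x = k *: (P * x * P).
Proof.
have absorbed y : jmeigen cont [::] (word (rowkey T)) y -> exists k, y = k *: (P * y).
  move=> jy; exists (#|row_group T|%:R)^-1; rewrite rowsumE.
  have one1 : (1 : C) ^+ 2 = 1 by rewrite expr1n.
  apply: sum_absorb => //; first by apply/set0Pn; exists 1%g; apply: group1 (row_grp T).
  move=> s /row_groupP hs; apply: (row_word_inv YT one1 conj_cont _ jy hs) => p r e1
      e2'.
  rewrite /cont (_ : content (T r) = content (T p) + 1) ?intrD //.
  by rewrite /content e1 e2'; lia.
move=> [h1 h2]; have [k xk] := absorbed _ h1; have [l yl] := absorbed _ h2.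
have {}yl : x = l *: (x * P).
  by rewrite -[LHS]starK yl starZ starM starK (star_rowsum C T [group of setT]).
by exists (k * l); rewrite {1}xk {1}yl -scalerAr scalerA mulrA.
Qed.

Lemma col_word_absorb x : bieigen cont (word (rowkey transposed)) x -> exists k,
  x = k *: (Q * x * Q).
Proof.
have YT' := young_transposed.
have absorbed y : jmeigen cont [::] (word (rowkey transposed)) y -> exists k, y = k
    *: (Q * y).
  move=> jy; exists (#|col_group T|%:R)^-1; rewrite colsumE.
  have two1 : (-1 : C) ^+ 2 = 1 by rewrite sqrrN expr1n.
  apply: sum_absorb => //; first by apply/set0Pn; exists 1%g; apply: group1 (col_grp T).
  move=> s /col_groupP hs; apply: (row_word_inv YT' two1 conj_cont _ jy hs) => p r e1
      e2'.
  rewrite /cont (_ : content (T r) = content (T p) + -1) ?intrD //.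
  by move: e1 e2'; rewrite /content /transposed /= => -> ->; lia.
move=> [h1 h2]; have [k xk] := absorbed _ h1; have [l yl] := absorbed _ h2.
have {}yl : x = l *: (x * Q).
  by rewrite -[LHS]starK yl starZ starM starK (star_colsum C T [group of setT]).
by exists (k * l); rewrite {1}xk {1}yl -scalerAr scalerA mulrA.
Qed.

(** A two-sided eigenvector for the row word lies in P A Q A Q A P, A being
    the group algebra, and that space is spanned by P Q P. *)
Lemma row_word_span w : std T w -> perm_eq w (enum 'I_n) ->
  exists A B A' B' : ga, [/\ B * A = 1, A' * B' = 1 &
    forall x, bieigen cont w x -> exists k, A * x * A' = k *: (P * Q * P)].
Proof.
move=> sw ew.
have sr : std T (word (rowkey T)).
  by apply: word_std; [apply: rowkey_inj | apply: rowkey_mono].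
have sc : std T (word (rowkey transposed)).
  apply: word_std; first exact: (rowkey_inj young_transposed).
  by move=> a b; rewrite -below_transposed; apply: rowkey_mono.
have [A [B [A' [B' [BA AB h]]]]] := bieigen_transport sw sr ew (word_perm _).
have [D [E [D' [E' [ED DE h']]]]] := bieigen_transport sw sc ew (word_perm _).
exists A, B, A', B'; split=> // x jx.
have [k ->] := row_word_absorb (h x jx).
have [l yl] := col_word_absorb (h' x jx).
have xE : x = E * (D * x * D') * E' by rewrite -!mulrA DE mulr1 !mulrA ED mul1r.
set y := D * x * D' in yl xE.
have [k1 e1] := von_neumann YT (A * E).
have [k2 e2] := von_neumann_star YT (y * Q * (E' * A')).
exists (k * (l * (k1 * k2))); rewrite -scalerA; congr (_ *: _).
rewrite xE {1}yl -!(scalerAl, scalerAr) -scalerA; congr (_ *: _).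
transitivity (P * (A * E) * Q * (y * Q * (E' * A')) * P).
  by rewrite !mulrA.
rewrite e1 -!scalerAl.
transitivity (k1 *: (P * (Q * (y * Q * (E' * A')) * P))); first by rewrite !mulrA.
by rewrite e2 -scalerAr scalerA mulrA.
Qed.

(** By the previous lemma the eigenvectors form at most a line, on which the
    coefficient of the identity is injective as soon as it is nonzero. *)
Lemma bieigen_unique w x y : std T w -> perm_eq w (enum 'I_n) ->
  bieigen cont w x -> bieigen cont w y -> x 1%g = 1 -> y 1%g = 1 -> x = y.
Proof.
move=> sw ew jx jy x1 y1.
have [A [B [A' [B' [BA AB h]]]]] := row_word_span sw ew.
have back z k : A * z * A' = k *: (P * Q * P) -> z = k *: (B * (P * Q * P) * B').
  move=> e; have -> : z = B * (A * z * A') * B'.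
    by rewrite -!mulrA AB mulr1 !mulrA BA mul1r.
  by rewrite e -scalerAr -scalerAl.
have [k /back xk] := h x jx; have [l /back yl] := h y jy.
set z := B * _ * B' in xk yl.
move: x1 y1; rewrite xk yl !gaZE => e1 e2.
have z0 : z 1%g != 0 by apply: contra_eq_neq e1 => ->; rewrite mulr0 eq_sym oner_neq0.
by congr (_ *: _); apply: (mulIf z0); rewrite e1 e2.
Qed.

End Uniqueness.

(** * The Young vector is a Jucys-Murphy eigenvector *)

Section SymmetricSums.

Variables (n : nat) (V : nmodType).

Lemma sum_ordered_pairs (k : nat) (e : 'I_n -> 'I_n -> V) :
  (forall p q, e p q = e q p) ->
  \sum_(pq : 'I_n * 'I_n | [&& pq.1 != pq.2, (pq.1 < k)%N & (pq.2 < k)%N]) e pq.1 pq.2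
  = (\sum_(q : 'I_n | (q < k)%N) \sum_(p : 'I_n | (p < q)%N) e p q) *+ 2.
Proof.
move=> esym; rewrite (bigID (fun pq : 'I_n * 'I_n => (pq.1 < pq.2)%N)) /= mulr2n.
have E : \sum_(q : 'I_n | (q < k)%N) \sum_(p : 'I_n | (p < q)%N) e p q
   = \sum_(pq : 'I_n * 'I_n | [&& pq.1 != pq.2, (pq.1 < k)%N & (pq.2 < k)%N]
        && (pq.1 < pq.2)%N) e pq.1 pq.2.
  rewrite (exchange_big_dep (fun p : 'I_n => (p < k)%N)) /=; last first.
    by move=> q p qk pq; apply: ltn_trans qk.
  rewrite pair_big_dep /=; apply: eq_bigl => -[p q] /=.
  by rewrite -(inj_eq val_inj) /=; lia.
congr (_ + _); first by rewrite E.
rewrite E (reindex_inj (h := fun pq : 'I_n * 'I_n => (pq.2, pq.1))) /=; last first.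
  by move=> [p q] [p' q'] [-> ->].
rewrite (eq_bigr (fun pq => e pq.1 pq.2)) => [|pq _]; last exact: esym.
by apply: eq_bigl => -[p q] /=; rewrite -!(inj_eq val_inj) /=; lia.
Qed.

End SymmetricSums.

Section ClassSum.

Variables (n : nat) (C : numFieldType) (T : 'I_n -> nat * nat).
Hypothesis YT : young_filling T.
Local Notation ga := (galg n C).
Implicit Types (p q r : 'I_n) (s t : 'S_n).

Definition pair_below (k : nat) : pred ('I_n * 'I_n) :=
  fun pq => [&& pq.1 != pq.2, (pq.1 < k)%N & (pq.2 < k)%N].

(** Twice the sum of the transpositions of the entries < k. Summing over the
    ordered pairs makes the invariance under conjugation plain. *)
Definition class_sum k : ga := \sum_(pq | pair_below k pq) transp C pq.1 pq.2.

Lemma Sym_initialP k s : reflect (forall p, (k <= p)%N -> s p = p) (s \in Sym_initial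
    n k).
Proof.
rewrite inE; apply: (iffP subsetP) => h p.
  by move=> kp; apply/eqP; apply: contraT => /h; rewrite inE ltnNge kp.
by rewrite !inE => sp; rewrite ltnNge; apply: contra sp => /h ->.
Qed.

Lemma Sym_initial_lt k s p : s \in Sym_initial n k -> (s p < k)%N = (p < k)%N.
Proof.
move=> sk; have le (t : 'S_n) q : t \in Sym_initial n k -> (q < k)%N -> (t q < k)%N.
  move=> /Sym_initialP h qk; rewrite ltnNge; apply/negP => kt.
  by have := h _ kt => /perm_inj e; move: kt; rewrite e leqNgt qk.
apply/idP/idP => h; last exact: le.
by rewrite -(permK s p); apply: le => //; rewrite groupV.
Qed.

Lemma tperm_Sym_initial k p q : (p < k)%N -> (q < k)%N -> tperm p q \in Sym_initial n k.
Proof.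
move=> pk qk; apply/Sym_initialP => r kr.
by rewrite tpermD //; [apply: contraTneq pk | apply: contraTneq qk] => ->; rewrite
    -leqNgt.
Qed.

Lemma pair_below_perm k s (pq : 'I_n * 'I_n) : s \in Sym_initial n k ->
  pair_below k (s pq.1, s pq.2) = pair_below k pq.
Proof. by move=> sk; rewrite /pair_below /= (inj_eq perm_inj) !Sym_initial_lt. Qed.

Lemma sum_pair_perm (V : nmodType) k s (F : 'I_n -> 'I_n -> V) : s \in Sym_initial n
    k ->
  \sum_(pq | pair_below k pq) F pq.1 pq.2
  = \sum_(pq | pair_below k pq) F (s pq.1) (s pq.2).
Proof.
move=> sk; rewrite (reindex_inj (h := fun pq : 'I_n * 'I_n => (s pq.1, s pq.2))) /=.
  by apply: eq_bigl => pq; apply: pair_below_perm.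
by move=> [p q] [p' q'] [/perm_inj -> /perm_inj ->].
Qed.

Lemma class_sum_gelt k s : s \in Sym_initial n k ->
  gelt C s * class_sum k = class_sum k * gelt C s.
Proof.
move=> sk; rewrite /class_sum mulr_sumr mulr_suml [RHS](sum_pair_perm (fun p q =>
    transp C p q * gelt C s) sk).
by apply: eq_bigr => pq _; apply: geltJ.
Qed.

(** If p and q are neither in one row nor in one column, the box in the row of
    one and the column of the other, which lies to the left of one of them, gives
    a collision. *)
Lemma row_transp_col k p q : pair_below k (p, q) ->
  rowsum C T (Sym_initial n k) * transp C p q * colsum C T (Sym_initial n k)
  = (((T p).1 == (T q).1)%:R - ((T p).2 == (T q).2)%:R) *:
    (rowsum C T (Sym_initial n k) * colsum C T (Sym_initial n k)).
Proof.
move=> /and3P[/= pq pk qk].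
have [e1|n1] := eqVneq (T p).1 (T q).1.
  have n2 : (T p).2 != (T q).2.
    by apply: contra pq => /eqP e2; apply/eqP; apply: (T_inj YT).
  rewrite (negPf n2) subr0 scale1r rowsum_gelt // inE tperm_Sym_initial //.
  by rewrite tperm_row.
have [e2|n2] := eqVneq (T p).2 (T q).2.
  rewrite sub0r -mulrA gelt_colsum.
    by rewrite odd_tperm pq expr1 -scalerAr.
  by rewrite inE tperm_Sym_initial // tperm_col.
rewrite subr0 scale0r; have [_ low mono] := YT.
wlog lt : p q pq pk qk n1 n2 / ((T p).1 < (T q).1)%N.
  move=> hw; have [lt|gt|e] := ltngtP (T p).1 (T q).1; first exact: hw.
    by rewrite transpC; apply: hw => //; rewrite eq_sym.
  by rewrite e eqxx in n1.
have neq (i j : 'I_n) : T i != T j -> i != j by apply: contraNneq => ->.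
have [lt2|ge2] := ltnP (T p).2 (T q).2.
  have [||r Tr] := low q (T q).1 (T p).2 => //; first exact: ltnW.
  have rk : (r < k)%N.
    by apply: leq_ltn_trans qk; apply: mono; rewrite /below Tr /= leqnn ltnW.
  apply: (@row_col_collision _ _ _ _ r q).
  - by apply: neq; rewrite Tr; apply: contra n2 => /eqP/(congr1 snd)/= ->.
  - by rewrite inE tperm_Sym_initial // tperm_row // Tr.
  - rewrite tpermV tpermR [tperm p q r]tpermD //.
    + by rewrite inE tperm_Sym_initial // tperm_col // Tr.
    + by apply: neq; rewrite Tr; apply: contra n1 => /eqP/(congr1 fst)/= ->.
    + by apply: neq; rewrite Tr; apply: contra n2 => /eqP/(congr1 snd)/= ->.
have {}ge2 : ((T q).2 < (T p).2)%N by rewrite ltn_neqAle eq_sym n2.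
have [||r Tr] := low p (T p).1 (T q).2 => //; first exact: ltnW.
have rk : (r < k)%N.
  by apply: leq_ltn_trans pk; apply: mono; rewrite /below Tr /= leqnn ltnW.
apply: (@row_col_collision _ _ _ _ p r).
- by apply: neq; rewrite Tr; apply: contra n2 => /eqP/(congr1 snd)/= ->.
- by rewrite inE tperm_Sym_initial // tperm_row // Tr.
- rewrite tpermV tpermL [tperm p q r]tpermD //.
  + by rewrite inE tperm_Sym_initial // tperm_col // Tr.
  + by apply: neq; rewrite Tr; apply: contra n2 => /eqP/(congr1 snd)/= ->.
  + by apply: neq; rewrite Tr; apply: contra n1 => /eqP/(congr1 fst)/= ->.
Qed.

End ClassSum.

Lemma card_row_before (n : nat) (T : 'I_n -> nat * nat) (q : 'I_n) : young_filling T ->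
  #|[pred p : 'I_n | (p < q)%N & (T p).1 == (T q).1]| = (T q).2.
Proof.
move=> YT; have [_ low mono] := YT.
rewrite -[RHS](size_iota 0) cardE -(size_map (fun p => (T p).2)).
apply: perm_size; apply: uniq_perm; rewrite ?iota_uniq //.
  rewrite map_inj_in_uniq ?enum_uniq // => p r; rewrite !mem_enum !inE.
  by move=> /andP[_ /eqP e1] /andP[_ /eqP e2] e; apply: (T_inj YT); rewrite ?e1.
move=> j; rewrite mem_iota add0n; apply/mapP/idP => [[p]|jq].
  rewrite mem_enum inE => /andP[pq /eqP e1] ->.
  rewrite ltnNge; apply/negP => h.
  by have := mono q p; rewrite /below e1 leqnn h leqNgt pq => /(_ isT).
have [||r Tr] := low q (T q).1 j => //; first exact: ltnW.
have rq : (r <= q)%N by apply: mono; rewrite /below Tr /= leqnn ltnW.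
exists r; last by rewrite Tr.
rewrite mem_enum inE Tr eqxx andbT ltn_neqAle rq andbT.
by apply/eqP => /val_inj rqE; move: jq; rewrite -rqE Tr ltnn.
Qed.

Section ClassSumEigen.

Variables (n : nat) (C : numFieldType) (T : 'I_n -> nat * nat).
Hypothesis YT : young_filling T.
Local Notation cont := (cont C T).
Implicit Types (p q r : 'I_n) (s t : 'S_n).

Definition content_sum (k : nat) : C := \sum_(q : 'I_n | (q < k)%N) cont q.

Lemma sum_signs k : \sum_(pq | pair_below k pq)
    (((T pq.1).1 == (T pq.2).1)%:R - ((T pq.1).2 == (T pq.2).2)%:R)
  = content_sum k *+ 2 :> C.
Proof.
rewrite /pair_below (sum_ordered_pairs k
  (e := fun p q : 'I_n => ((T p).1 == (T q).1)%:R - ((T p).2 == (T q).2)%:R : C));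
      last first.
  by move=> p q; rewrite eq_sym [(T p).2 == _]eq_sym.
congr (_ *+ 2); apply: eq_bigr => q _.
have cnt T' : young_filling T' ->
    \sum_(p : 'I_n | (p < q)%N) ((T' p).1 == (T' q).1)%:R = ((T' q).2)%:R :> C.
  move=> YT'; rewrite -[in RHS](card_row_before q YT') -sum1_card natr_sum.
  by rewrite big_mkcondr /=; apply: eq_bigr => p _; case: eqP.
rewrite sumrB /cont /content rmorphB /= -!pmulrn cnt //.
by rewrite (cnt _ (young_transposed YT)).
Qed.

Lemma class_sum_young k :
  class_sum n C k * young_symmetrizer C T (Sym_initial n k)
  = content_sum k *+ 2 *: (young_symmetrizer C T (Sym_initial n k) : galg n C).
Proof.
have -> : young_symmetrizer C T (Sym_initial n k)
  = rowsum C T (Sym_initial n k) * colsum C T (Sym_initial n k) by [].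
have comm : class_sum n C k * rowsum C T (Sym_initial n k)
    = rowsum C T (Sym_initial n k) * class_sum n C k.
  rewrite [rowsum _ _ _]ga_decomp mulr_sumr mulr_suml; apply: eq_bigr => s _.
  rewrite -scalerAr -scalerAl ffunE inE.
  case: (boolP (s \in Sym_initial n k)) => [sk|_]; last by rewrite andbF !scale0r.
  by rewrite class_sum_gelt.
rewrite mulrA comm /class_sum mulr_sumr mulr_suml -sum_signs scaler_suml.
by apply: eq_bigr => -[p q] pqk; apply: row_transp_col.
Qed.

End ClassSumEigen.

(** ** Transfer to the Young module *)

Section YoungModule.

Variables (n : nat) (C : numFieldType) (T : 'I_n -> nat * nat).
Hypothesis YT : young_filling T.
Implicit Types (p q r : 'I_n) (s t : 'S_n).

Definition ga_row (G : {group 'S_n}) (x : galg n C) : 'rV[C]_(gcard G) :=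
  \row_i x (enum_val i).

Lemma ga_row_regular (G : {group 'S_n}) (x : galg n C) s : s \in G ->
  ga_row G x *m regular_repr C G s = ga_row G (gelt C s * x).
Proof.
move=> sG; apply/rowP => j; rewrite !mxE geltEl.
have jG : enum_val j \in G by apply: enum_valP.
have jsG : (enum_val j * s^-1)%g \in G by rewrite groupM ?groupV.
rewrite (bigD1 (gring_index G (enum_val j * s^-1)%g)) //= big1.
  rewrite !mxE gring_indexK // mulgKV gring_valK !eqxx mulr1 addr0 //.
move=> i ij; rewrite !mxE eqxx /=; case: eqP => [e|_]; last by rewrite mulr0.
case/eqP: ij; rewrite e gring_indexK; last by rewrite groupM // enum_valP.
by rewrite mulgK gring_valK.
Qed.

Definition class_mx (k d : nat) (rG : mx_representation C (Sym_initial n k) d) : 'M_d :=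
  \sum_(pq : 'I_n * 'I_n | pair_below k pq) rG (tperm pq.1 pq.2).

Lemma class_mx_cent k d (rG : mx_representation C (Sym_initial n k) d) :
  centgmx rG (class_mx rG).
Proof.
apply/centgmxP => s sk; rewrite /class_mx mulmx_suml mulmx_sumr.
have sk' : s^-1%g \in Sym_initial n k by rewrite groupV.
rewrite [LHS](sum_pair_perm (fun p q => rG (tperm p q) *m rG s) sk').
have tk pq : pair_below k pq -> tperm pq.1 pq.2 \in Sym_initial n k.
  by move=> /and3P[_ ? ?]; apply: tperm_Sym_initial.
apply: eq_bigr => pq h; rewrite -!repr_mxM ?tk //; last first.
  by rewrite tperm_Sym_initial ?Sym_initial_lt //; case/and3P: h.
by congr (rG _); rewrite -tpermJ conjgE invgK -!mulgA mulVg mulg1.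
Qed.

Lemma class_mx_submod k d (rG : mx_representation C (Sym_initial n k) d)
    (U : 'M_d) (modU : mxmodule rG U) (e : C) :
  (class_mx (submod_repr modU) = e%:M) <->
  (forall v : 'rV_d, (v <= U)%MS -> v *m class_mx rG = e *: v).
Proof.
have tk pq : pair_below k pq -> tperm pq.1 pq.2 \in Sym_initial n k.
  by move=> /and3P[_ ? ?]; apply: tperm_Sym_initial.
have vE (w : 'rV_(\rank U)) :
    val_submod (w *m class_mx (submod_repr modU)) = val_submod w *m class_mx rG.
  rewrite /class_mx !mulmx_sumr linear_sum; apply: eq_bigr => pq h.
  by rewrite -(val_submodJ modU) ?tk.
split=> [h v vU|h].
  rewrite -(in_submodK vU) -vE h mul_mx_scalar linearZ //.
apply/row_matrixP => i; rewrite !rowE; apply: val_submod_inj.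
by rewrite vE h ?val_submodP // mul_mx_scalar linearZ.
Qed.

Lemma class_mx_rsim k d1 d2 (r1 : mx_representation C (Sym_initial n k) d1)
    (r2 : mx_representation C (Sym_initial n k) d2) (e : C) :
  mx_rsim r1 r2 -> class_mx r2 = e%:M -> class_mx r1 = e%:M.
Proof.
case=> B _ fB hB h; apply: (row_free_inj fB).
rewrite /class_mx mulmx_suml.
rewrite (eq_bigr (fun pq : 'I_n * 'I_n => B *m r2 (tperm pq.1 pq.2))) => [|pq h1].
  by rewrite -mulmx_sumr -/(class_mx r2) h mul_mx_scalar mul_scalar_mx.
by apply: hB; move: h1 => /and3P[_ ? ?]; apply: tperm_Sym_initial.
Qed.

(** The class sum commutes with the group, hence acts on the whole left ideal
    as on its generator. *)
Lemma class_mx_young k :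
  class_mx (young_repr C T (Sym_initial n k)) = (content_sum C T k *+ 2)%:M.
Proof.
apply/class_mx_submod => v.
set e := content_sum C T k *+ 2; set y := young_row C T _ => vU.
set rG := regular_repr C (Sym_initial n k) in vU *.
have cG : centgmx rG (class_mx rG - e%:M).
  apply/centgmxP => s sk; have /centgmxP/(_ s sk) h := class_mx_cent rG.
  by rewrite mulmxBl mulmxBr h scalar_mxC.
have : (v <= kermx (class_mx rG - e%:M))%MS.
  apply: submx_trans vU _; apply: cyclic_mx_sub; first exact: kermx_centg_module.
  apply/sub_kermxP; rewrite mulmxBr mul_mx_scalar /class_mx mulmx_sumr.
  have -> : y = ga_row (Sym_initial n k) (young_symmetrizer C T (Sym_initial n k)) by
      [].
  set x := young_symmetrizer _ _ _.
  rewrite (eq_bigr (fun pq : 'I_n * 'I_n => ga_row (Sym_initial n k) (transp C pq.1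
      pq.2 * x))).
    apply/eqP; rewrite subr_eq0; apply/eqP/rowP => i.
    rewrite summxE !mxE -gaZE -class_sum_young // /class_sum mulr_suml ga_sumE.
    by apply: eq_bigr => pq _; rewrite mxE.
  by move=> pq /and3P[_ ? ?]; apply: ga_row_regular; apply: tperm_Sym_initial.
move/sub_kermxP; rewrite mulmxBr mul_mx_scalar => /eqP.
by rewrite subr_eq0 => /eqP.
Qed.

Lemma young_submodule_class m (rV : mx_representation C [set: 'S_n] m) k (W : 'M_m)
    (v : 'rV_m) :
  irr_submodule_of_shape T rV k W -> (v <= W)%MS ->
  v *m (\sum_(q : 'I_n | (q < k)%N) \sum_(p : 'I_n | (p < q)%N) rV (tperm p q))
  = content_sum C T k *: v.
Proof.
move=> [modW [_ sim]] vW.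
have h := class_mx_rsim sim (class_mx_young k).
have /class_mx_submod/(_ v vW) := h.
rewrite /class_mx /pair_below (sum_ordered_pairs k (e := fun p q => rV (tperm p q)));
    last first.
  by move=> p q; rewrite tpermC.
have two0 : 2%:R != 0 :> C by rewrite pnatr_eq0.
rewrite mulr2n mulmxDr -mulr2n => e; apply: (scalerI two0).
by rewrite !scaler_nat e scalerMnl.
Qed.

End YoungModule.

Section YoungVector.

Variables (n : nat) (C : numClosedFieldType) (T : 'I_n -> nat * nat) (m : nat).
Variables (rV : mx_representation C [set: 'S_n] m).
Variables (form : {dot 'rV[C]_m for Num.conj}) (v : 'rV[C]_m).
Hypotheses (YT : young_filling T) (inv : invariant_form rV form).
Hypothesis yv : young_vector T rV form v.
Implicit Types (p q : 'I_n) (s : 'S_n).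

(** A Jucys-Murphy element is the difference of two class sums, both of which
    act on v as scalars. *)
Lemma young_vector_jucys q :
  v *m (\sum_(p : 'I_n | (p < q)%N) rV (tperm p q)) = cont C T q *: v.
Proof.
have [_ [W [_ _ hW]]] := yv.
have act k : (k <= n)%N ->
    v *m (\sum_(q : 'I_n | (q < k)%N) \sum_(p : 'I_n | (p < q)%N) rV (tperm p q))
    = content_sum C T k *: v.
  case: k => [_|k kn].
    by rewrite /content_sum !big_pred0 // mulmx0 scale0r.
  have [h1 h2] := hW k.+1 kn; exact: young_submodule_class h1 h2.
have split (V : nmodType) (F : 'I_n -> V) :
    \sum_(p : 'I_n | (p < q.+1)%N) F p = F q + \sum_(p : 'I_n | (p < q)%N) F p.
  rewrite (bigD1 q) //=; congr (_ + _); apply: eq_bigl => p.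
  by rewrite ltnS ltn_neqAle andbC.
have := act q.+1 (ltn_ord q); rewrite /content_sum !split mulmxDr scalerDl.
by rewrite act ?(ltnW (ltn_ord q)) // => /addIr.
Qed.

Definition matrix_element : galg n C := [ffun s => form v (v *m rV s)].

Lemma matrix_element1 : matrix_element 1%g = 1.
Proof. by rewrite ffunE repr_mx1 mulmx1; case: yv. Qed.

Lemma jmeigen_enum (c : 'I_n -> C) x :
  (forall q, (\sum_(p : 'I_n | (p < q)%N) transp C p q) * x = c q *: x) ->
  jmeigen c [::] (enum 'I_n) x.
Proof.
move=> h; have from w1 w2 : enum 'I_n = w1 ++ w2 -> jmeigen c w1 w2 x.
  elim: w2 w1 => [//|q w2 IH] w1 e /=; split; last by apply: IH; rewrite cat_rcons.
  rewrite -h; congr (_ * _); rewrite /jucys -[RHS]big_filter; apply: perm_big.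
  have := enum_pairwise n.
  rewrite e pairwise_cat /= allrel_consr => /and3P[/andP[h1 _] _ /andP[h2 _]].
  have u1 : uniq w1 by have := enum_uniq 'I_n; rewrite e cat_uniq => /andP[].
  apply: uniq_perm => //; first by rewrite filter_uniq // /index_enum -enumT enum_uniq.
  move=> p; rewrite mem_filter mem_index_enum andbT.
  apply/idP/idP => [pw|pq]; first exact: (allP h1).
  have : p \in enum 'I_n by rewrite mem_enum.
  rewrite e mem_cat inE => /or3P[//|/eqP pE|/(allP h2)].
    by rewrite pE ltnn in pq.
  by rewrite ltnNge ltnW.
exact: from.
Qed.

Lemma bieigen_matrix_element : bieigen (cont C T) (enum 'I_n) matrix_element.
Proof.
have real q : (cont C T q)^*%R = cont C T q by exact: rmorph_int.
have tinv p q s : form v (v *m rV (s * tperm p q)%g) = form (v *m rV (tperm p q)) (v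
    *m rV s).
  rewrite -[LHS](inv (tperm p q)) -[in X in form _ X]mulmxA -repr_mxM ?inE //.
  by rewrite -mulgA tperm2 mulg1.
have L q : (\sum_(p : 'I_n | (p < q)%N) transp C p q) * matrix_element = cont C T q
    *: matrix_element.
  apply/ffunP => s; rewrite gaZE mulr_suml ga_sumE.
  rewrite (eq_bigr (fun p => form (v *m rV (tperm p q)) (v *m rV s))) => [|p _].
    rewrite -linear_sumlz /= -mulmx_sumr young_vector_jucys linearZl_LR /= ffunE //.
  by rewrite geltEl ffunE tpermV tinv.
have R q : (\sum_(p : 'I_n | (p < q)%N) transp C p q) * star matrix_element
    = cont C T q *: star matrix_element.
  apply/ffunP => s; rewrite gaZE mulr_suml ga_sumE.
  rewrite (eq_bigr (fun p => form v (v *m rV (tperm p q) *m rV s^-1%g))) => [|p _].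
    rewrite -linear_sumr /= -mulmx_suml -mulmx_sumr young_vector_jucys -scalemxAl.
    by rewrite linearZr_LR /= real !ffunE.
  by rewrite geltEl tpermV !ffunE invMg tpermV -mulmxA -repr_mxM ?inE.
by split; apply: jmeigen_enum.
Qed.

End YoungVector.

(** * Fractions and their values *)

Section Fractions.

Variables (n : nat) (C : numFieldType) (H : ('I_n -> C) -> Prop).
Hypothesis aH : affine H.
Local Notation F := {fraction {mpoly C[n]}}.
Local Notation "x %:F" := (@FracField.tofrac _ x) : ring_scope.
Implicit Types (f g : F) (phi psi : ('I_n -> C) -> C).

(** phi is the restriction of f to H, off a hypersurface of H which does not
    contain H. *)
Definition frac_value f phi := exists a b : {mpoly C[n]},
  [/\ f = a%:F / b%:F, exists2 z, H z & b.@[z] != 0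
    & forall z, H z -> b.@[z] != 0 -> phi z = a.@[z] / b.@[z]].

Lemma tofrac_neq0 (b : {mpoly C[n]}) :
  (exists2 z, H z & b.@[z] != 0) -> b%:F != 0.
Proof.
by move=> [z _ bz]; rewrite tofrac_eq0; apply: contraNneq bz => ->; rewrite meval0.
Qed.

Lemma frac_valueD f g phi psi : frac_value f phi -> frac_value g psi ->
  frac_value (f + g) (fun z => phi z + psi z).
Proof.
move=> [a [b [-> nb h]]] [a' [b' [-> nb' h']]].
exists (a * b' + a' * b), (b * b'); split; last 1 first.
- move=> z Hz; rewrite mevalM mulf_eq0 negb_or => /andP[bz bz'].
  by rewrite h // h' // mevalD !mevalM addf_div.
- by rewrite addf_div ?tofrac_neq0 // rmorphD !rmorphM.
- exact: nonvanishingM.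
Qed.

Lemma frac_valueM f g phi psi : frac_value f phi -> frac_value g psi ->
  frac_value (f * g) (fun z => phi z * psi z).
Proof.
move=> [a [b [-> nb h]]] [a' [b' [-> nb' h']]].
exists (a * a'), (b * b'); split; last 1 first.
- move=> z Hz; rewrite mevalM mulf_eq0 negb_or => /andP[bz bz'].
  by rewrite h // h' // !mevalM mulf_div.
- by rewrite mulf_div !rmorphM.
- exact: nonvanishingM.
Qed.

Lemma frac_valueN f phi : frac_value f phi -> frac_value (- f) (fun z => - phi z).
Proof.
move=> [a [b [-> nb h]]]; exists (- a), b; split=> // [|z Hz bz].
  by rewrite rmorphN mulNr.
by rewrite h // mevalN mulNr.
Qed.

Lemma frac_value_inv (b : {mpoly C[n]}) : (exists2 z, H z & b.@[z] != 0) ->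
  frac_value (b%:F)^-1 (fun z => (b.@[z])^-1).
Proof.
move=> nb; exists 1, b; split=> // [|z Hz bz]; first by rewrite rmorph1 mul1r.
by rewrite meval1 mul1r.
Qed.

Lemma eq_frac_value f phi psi : phi =1 psi -> frac_value f phi -> frac_value f psi.
Proof. by move=> e [a [b [h1 h2 h3]]]; exists a, b; split=> // z; rewrite -e; apply:
    h3. Qed.

Hypothesis H_nonempty : exists z, H z.

Lemma frac_value_nat (k : nat) : frac_value k%:R (fun=> k%:R).
Proof.
exists k%:R, 1; split.
- by rewrite rmorph1 divr1 rmorph_nat.
- by have [z Hz] := H_nonempty; exists z; rewrite ?meval1 ?oner_neq0.
- by move=> z _ _; rewrite meval1 divr1 rmorph_nat.
Qed.

Lemma frac_value_sum (I : Type) (l : seq I) (f : I -> F) (phi : I -> ('I_n -> C) -> C) :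
  (forall i, frac_value (f i) (phi i)) ->
  frac_value (\sum_(i <- l) f i) (fun z => \sum_(i <- l) phi i z).
Proof.
move=> h; elim: l => [|i l IH].
  by rewrite big_nil; apply: eq_frac_value (frac_value_nat 0) => z; rewrite big_nil.
by rewrite big_cons; apply: eq_frac_value (frac_valueD (h i) IH) => z; rewrite big_cons.
Qed.

Definition ga_value (A : galg n F) (Phi : ('I_n -> C) -> galg n C) :=
  forall s, frac_value (A s) (fun z => Phi z s).

Lemma ga_value1 : ga_value 1 (fun=> 1).
Proof.
move=> s; rewrite ga1E; apply: eq_frac_value (frac_value_nat _) => z.
by rewrite ga1E.
Qed.

Lemma ga_valueM A B Phi Psi : ga_value A Phi -> ga_value B Psi ->
  ga_value (A * B) (fun z => Phi z * Psi z).
Proof.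
move=> hA hB s; rewrite gaME.
apply: (@eq_frac_value _ (fun z => \sum_x Phi z x * Psi z (s * x^-1)%g)).
  by move=> z; rewrite gaME.
by apply: frac_value_sum => x; apply: frac_valueM.
Qed.

Lemma ga_value_factor p q (b : {mpoly C[n]}) : (exists2 z, H z & b.@[z] != 0) ->
  ga_value (factor p q b%:F) (fun z => factor p q b.@[z]).
Proof.
move=> nb s; rewrite gaE gaNE gaZE.
apply: (@eq_frac_value _ (fun z => (1 : galg n C) s - b.@[z]^-1 * transp C p q s)).
  by move=> z; rewrite gaE gaNE gaZE.
apply: frac_valueD; first exact: ga_value1.
apply: frac_valueN; apply: frac_valueM; first exact: frac_value_inv.
by rewrite ffunE; apply: eq_frac_value (frac_value_nat _) => z; rewrite ffunE.
Qed.

Lemma ga_value_wordprod (U : 'I_n -> F) (u : ('I_n -> C) -> 'I_n -> C) w : uniq w ->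
  (forall p q, p != q -> exists b : {mpoly C[n]}, [/\ U p - U q = b%:F,
     forall z, b.@[z] = u z p - u z q & exists2 z, H z & b.@[z] != 0]) ->
  ga_value (wordprod U w) (fun z => wordprod (u z) w).
Proof.
move=> uw h; elim: w uw => [_|p w IH]; first exact: ga_value1.
rewrite cons_uniq => /andP[pw uw]; apply: ga_valueM; last exact: IH.
elim: w pw {IH uw} => [_|q w IH].
  by rewrite big_nil => s; apply: eq_frac_value (ga_value1 s) => z; rewrite big_nil.
rewrite inE negb_or => /andP[pq pw]; rewrite big_cons.
have [b [e be nb]] := h p q pq.
move=> s; apply: (@eq_frac_value _ (fun z =>
   (factor p q b.@[z] * \prod_(j <- w) factor p j (u z p - u z j)) s)).
  by move=> z; rewrite big_cons be.
by rewrite e; apply: ga_valueM; [apply: ga_value_factor | apply: IH].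
Qed.

End Fractions.

(** ** The rational function of the tableau *)

Section FusionFunction.

Variables (n : nat) (C : numFieldType) (T : 'I_n -> nat * nat).
Hypothesis YT : young_filling T.
Local Notation F := {fraction {mpoly C[n]}}.
Local Notation "x %:F" := (@FracField.tofrac _ x) : ring_scope.

Lemma wordprod_lex (K : fieldType) (u : 'I_n -> K) (w : seq 'I_n) :
  pairwise (fun a b : 'I_n => (a < b)%N) w ->
  wordprod u w = \prod_(p <- w) \prod_(q <- w | (p < q)%N) factor p q (u p - u q).
Proof.
elim: w => [|p w IH] /=; first by rewrite big_nil.
move=> /andP[/allP pw hw]; rewrite big_cons [in RHS]big_cons ltnn IH //.
congr (_ * _); first by rewrite [RHS]big_seq_cond big_seq; apply: eq_bigl => q;
  case: (boolP (q \in w)) => // /pw ->.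
rewrite [LHS]big_seq [RHS]big_seq; apply: eq_bigr => r rw.
by rewrite big_cons ltnNge ltnW ?pw.
Qed.

Lemma F_functionE : F_function C T = wordprod (shifted_var C T) (enum 'I_n).
Proof.
rewrite (wordprod_lex _ (enum_pairwise n)) !enumT /F_function.
rewrite -[Finite.enum _]/(index_enum _).
transitivity (\prod_(p < n) \prod_(q < n | (p < q)%N)
   (f_factor p q (shifted_var C T p) (shifted_var C T q) : galg n F)); first by [].
apply: eq_bigr => p _; apply: eq_bigr => q _; apply/ffunP => s.
by rewrite gaE gaNE gaZE !ffunE mulrC.
Qed.

Lemma F_function_value (a : C) :
  ga_value (@H_space C n T) (F_function C T) (fun z => wordprod (shifted T z) (enum
      'I_n)).
Proof.
rewrite F_functionE; apply: ga_value_wordprod; rewrite ?enum_uniq //.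
- exact: affine_H.
- by exists (@z0 n _ a); apply: H_z0.
move=> p q pq; exists ('X_p - 'X_q + (cont C T p - cont C T q)%:MP); split.
- rewrite /shifted_var opprD addrACA tofracD tofracB; congr (_ + _).
  by rewrite mpolyCB tofracB /cont !rmorph_int.
- by move=> z; rewrite mevalD mevalB !mevalXU mevalC /shifted opprD addrACA.
have [b [[z Hz bz] h]] := generically_generic a YT (enum 'I_n).
exists z => //; have := h z Hz bz p q; rewrite !mem_enum => /(_ isT isT pq).
by rewrite mevalD mevalB !mevalXU mevalC /shifted -subr_eq0 opprD addrACA.
Qed.

End FusionFunction.

Lemma lim_coef (n : nat) (K : numFieldType) (H : ('I_n -> K) -> Prop) z1 Phi
    (E : galg n K) s :
  lim H z1 Phi E -> lim H z1 (fun z => Phi z s *: 1) (E s *: 1).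
Proof.
move=> [Psi [rP <- g]]; exists (fun z => Psi z s *: 1); split=> //.
  by apply: regaZ => //; apply: rega_cst.
by apply: generically_mono g => z _ ->.
Qed.

Theorem theorem3p1 (R : realType) (n : nat) (lam : seq nat)
    (T : 'I_n -> nat * nat) (m : nat)
    (rV : mx_representation R[i] [set: 'S_n] m)
    (form : {dot 'rV[R[i]]_m for Num.conj}) (v : 'rV[R[i]]_m) :
  is_partition n lam -> standard_tableau lam T ->
  irreducible_of_shape T rV -> invariant_form rV form ->
  young_vector T rV form v ->
  forall (a : R[i]) (s : 'S_n),
    restriction_regular_with_value (H_space T) (F_function R[i] T s)
      (fun=> a) (form v (v *m rV s)).
Proof.
move=> lamP stdT _ inv yv a s.
have YT := standard_young_filling lamP stdT.
have [E [lE jE]] := fusion a YT (enum_std YT) (perm_refl _).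
have aH := affine_H (K := R[i]) (T := T).
have H0 : H_space T (@z0 n _ a) by apply: H_z0.
have E1 : E 1%g = 1.
  have := lim_uniq aH H0 (lim_coef 1%g lE) (lim_cst H0 (1 : galg n R[i])).
  have g : generically (H_space T) (fun z => wordprod (shifted T z) (enum 'I_n) 1%g
      *: (1 : galg n R[i]) = 1).
    by apply: (generically_true H0) => z; rewrite wordprod_coef1 ?enum_uniq // scale1r.
  move=> /(_ g)/ffunP/(_ 1%g); rewrite gaZE ga1E eqxx mulr1 //.
have EM : E = matrix_element rV form v.
  apply: (bieigen_unique YT (enum_std YT) (perm_refl _) jE) => //.
    exact: bieigen_matrix_element YT inv yv.
  exact: matrix_element1 yv.
have -> : form v (v *m rV s) = E s by rewrite EM ffunE.
have [Psi [rP PE gP]] := lE.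
have [c [d [d0 h]]] := rP s; have [p [q [Fs nq hF]]] := F_function_value YT a s.
exists c, d; split=> //; last by rewrite -PE h.
exists p, q; split=> // z Hz.
apply/eqP; rewrite -subr_eq0 -!mevalM -mevalB; apply/eqP.
apply: (generically_eq0 aH) Hz.
have gd0 : generically (H_space T) (fun z => d.@[z] != 0) by apply: generically_nz;
    exists (@z0 n _ a).
have G := generically_and aH (generically_and aH gd0 (generically_nz nq)) gP.
apply: generically_mono G => y Hy [[dy qy] e].
rewrite mevalB !mevalM; apply/eqP; rewrite subr_eq0 -eqr_div //.
by rewrite -hF // e -h.
Qed.
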